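(* Let $\Omega\subset\mathbb{R}^n$ be a bounded domain with smooth boundary, $0<\alpha<1$, $f^1,f^2\in C^\alpha(\Omega)$, $\psi^1,\psi^2\in C^{2,\alpha}(\Omega)$ with $\psi^1+\psi^2\ge0$ in $\Omega$, and $g^1,g^2\in C^2$ with $g^1-g^2+\psi^1\ge0$ and $g^2-g^1+\psi^2\ge0$ on $\partial\Omega$. For $\varepsilon>0$ let $(u^1_\varepsilon,u^2_\varepsilon)$ be a classical solution of the penalized system $$\begin{cases}-\Delta u^1_\varepsilon+f^1+\beta_\varepsilon(u^1_\varepsilon-u^2_\varepsilon+\psi^1)=0\\ -\Delta u^2_\varepsilon+f^2+\beta_\varepsilon(u^2_\varepsilon-u^1_\varepsilon+\psi^2)=0\end{cases}\quad\text{in }\Omega,\qquad u^i_\varepsilon=g^i\ \text{on }\partial\Omega.$$ Let $(u^1_0,u^2_0)=\lim_{\varepsilon\to0}(u^1_\varepsilon,u^2_\varepsilon)$ through a subsequence, weakly in $W^{2,p}$ for every $1<p<\infty$ and strongly in $C^{1,\gamma}$ for every $0<\gamma<1$. Then $(u^1_0,u^2_0)$ solves the system $$\begin{cases}\min(-\Delta u^1_0+f^1,\;u^1_0-u^2_0+\psi^1)=0,\\ \min(-\Delta u^2_0+f^2,\;u^2_0-u^1_0+\psi^2)=0,\\ \min(-\Delta u^1_0+f^1,\;-\Delta u^2_0+f^2)=0\end{cases}$$ in the strong sense: $u^1_0-u^2_0+\psi^1\ge0$ and $u^2_0-u^1_0+\psi^2\ge0$ in $\Omega$; if the first (respectively second)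 of these inequalities is strict at some point, then $\Delta u^1_0=f^1$ (respectively $\Delta u^2_0=f^2$) in a neighborhood of that point; $-\Delta u^i_0+f^i\ge0$ a.e. for $i=1,2$; and $\min(-\Delta u^1_0+f^1,-\Delta u^2_0+f^2)=0$ a.e. in $\Omega$.
   Context: $\beta_\varepsilon(s)=\beta(s/\varepsilon)$, where $\beta:\mathbb{R}\to(-\infty,0]$ is a fixed smooth function with $\beta(s)=0$ for $s\ge0$, $\beta(s)<0$ and $0<\beta'(s)\le1$ for $s<0$, and $\lim_{s\to-\infty}\beta(s)=-\infty$. $C^{\alpha}(\Omega)$ and $C^{2,\alpha}(\Omega)$ are the usual Hölder spaces with derivatives continuous up to $\overline\Omega$ and finite Hölder seminorm on $\overline\Omega$. Classical solution means $u^i_\varepsilon\in C^2(\Omega)$, continuous up to $\partial\Omega$. *)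

(* Defs.v *)
From HB Require Import structures.
From mathcomp Require Import all_boot all_order all_algebra.
From mathcomp Require Import all_classical all_reals all_analysis.

Set Implicit Arguments.
Unset Strict Implicit.
Unset Printing Implicit Defensive.

Import Order.TTheory GRing.Theory Num.Theory.
Import numFieldNormedType.Exports.

Local Open Scope classical_set_scope.
Local Open Scope ring_scope.

(* The library has the product sigma-algebra on [n.-tuple T] but no Lebesgue
   measure in dimension n.  It is obtained on tuples by iterating [\x], each step
   being transported along the measurable bijection R x R^n -> R^n.+1, and then
   transported to row vectors. *)

Section pushforward.
Context d1 d2 (T1 : measurableType d1) (T2 : measurableType d2) (R : realType).
Variables (f : T1 -> T2) (mu : {measure set T1 -> \bar R}).
Let nu := pushforward mu f.

Lemma pushforward0 : nu set0 = 0%E.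
Proof. by rewrite /nu /pushforward preimage_set0 measure0. Qed.

Lemma pushforward_ge0 A : (0 <= nu A)%E.
Proof. exact: (measure_ge0 mu). Qed.

Hypothesis mf : measurable_fun [set: T1] f.

Let mpre A : measurable A -> measurable (f @^-1` A).
Proof. by move=> mA; rewrite -[X in measurable X]setTI; exact: mf. Qed.

Lemma pushforward_sigma_additive : semi_sigma_additive nu.
Proof.
move=> F mF tF mUF; rewrite /nu /pushforward preimage_bigcup.
apply: measure_semi_sigma_additive.
- by move=> n; exact: mpre.
- apply/trivIsetP => /= i j _ _ ij; rewrite -preimage_setI.
  by move/trivIsetP : tF => /(_ _ _ _ _ ij) ->//; rewrite preimage_set0.
- by rewrite -preimage_bigcup; exact: mpre.
Qed.

Lemma pushforward_sigma_finite (g : T2 -> T1) :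
  measurable_fun [set: T2] g -> cancel f g ->
  sigma_finite [set: T1] mu -> sigma_finite [set: T2] nu.
Proof.
move=> mg fK [F TF Foo]; exists (fun n => g @^-1` F n).
  by rewrite -preimage_bigcup -TF preimage_setT.
move=> n; have [mFn Fnoo] := Foo n; split.
  by rewrite -[X in measurable X]setTI; exact: mg.
rewrite /nu /pushforward -comp_preimage (_ : g \o f = id) ?preimage_id//.
by apply/funext => x /=.
Qed.

End pushforward.

(* The library's instance of this fact is shadowed by the one for
   subprobabilities and is not found by unification. *)
Lemma product_sigma_finite d1 d2 (T1 : measurableType d1)
    (T2 : measurableType d2) (R : realType)
    (m1 : {sigma_finite_measure set T1 -> \bar R})
    (m2 : {sigma_finite_measure set T2 -> \bar R}) :
  sigma_finite [set: T1 * T2] (m1 \x m2)%E.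
Proof.
have /sigma_finiteP[F [TF ndF Foo]] := sigma_finiteT m1.
have /sigma_finiteP[G [TG ndG Goo]] := sigma_finiteT m2.
exists (fun n => F n `*` G n).
  rewrite -setXTT TF TG predeqE => -[x y]; split.
    move=> [/= [n _ Fnx] [k _ Gky]]; exists (maxn n k) => //; split.
    - by move: x Fnx; exact/subsetPset/ndF/leq_maxl.
    - by move: y Gky; exact/subsetPset/ndG/leq_maxr.
  by move=> [n _ []/= ? ?]; split; exists n.
move=> k; have [? ?] := Foo k; have [? ?] := Goo k.
split; first exact: measurableX.
by rewrite product_measure1E// lte_mul_pinfty// ge0_fin_numE.
Qed.

Section power_measure.
Context d (T : measurableType d) (R : realType).

Definition tcons n (p : T * n.-tuple T) : n.+1.-tuple T := [tuple of p.1 :: p.2].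

Definition tuncons n (t : n.+1.-tuple T) : T * n.-tuple T :=
  (thead t, [tuple of behead t]).

Lemma tconsK n : cancel (@tcons n) (@tuncons n).
Proof. by case=> x t; congr pair => //; apply/val_inj. Qed.

Lemma measurable_tcons n : measurable_fun [set: T * n.-tuple T] (@tcons n).
Proof. exact: measurable_cons. Qed.

Lemma measurable_tuncons n : measurable_fun [set: n.+1.-tuple T] (@tuncons n).
Proof.
apply/measurable_fun_pairP; split; first exact: measurable_tnth.
exact: measurable_behead.
Qed.

Variable m : {sigma_finite_measure set T -> \bar R}.

Section step.
Variables (n : nat) (mu : {sigma_finite_measure set (n.-tuple T) -> \bar R}).

Definition power_step : set (n.+1.-tuple T) -> \bar R :=
  pushforward (m \x mu)%E (@tcons n).

HB.instance Definition _ := isMeasure.Build _ _ _ power_step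
  (pushforward0 _ _) (pushforward_ge0 _ _)
  (pushforward_sigma_additive (@measurable_tcons n)).

Lemma power_step_sigma_finite : sigma_finite [set: n.+1.-tuple T] power_step.
Proof.
apply: (pushforward_sigma_finite (@measurable_tuncons n) (@tconsK n)).
exact: product_sigma_finite.
Qed.

HB.instance Definition _ := Measure_isSigmaFinite.Build _ _ _ power_step
  power_step_sigma_finite.

End step.

Definition power0 : set (0.-tuple T) -> \bar R := dirac [tuple].

HB.instance Definition _ := Measure.on power0.
HB.instance Definition _ := SigmaFiniteMeasure.on power0.

Fixpoint power_measure n : {sigma_finite_measure set (n.-tuple T) -> \bar R} :=
  if n is k.+1 then power_step (power_measure k) else power0.

End power_measure.

Definition row_display : measure_display -> measure_display.
Proof. exact. Qed.

Section measurable_row.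
Context {R : realType} {n : nat}.
Notation T := (n.-tuple (measurableTypeR R)).

Definition tuple_of_row (x : 'rV[R]_n) : T := [tuple x 0 i | i < n].
Definition row_of_tuple (t : T) : 'rV[R]_n := \row_i tnth t i.

Lemma row_of_tupleK : cancel row_of_tuple tuple_of_row.
Proof. by move=> t; apply/eq_from_tnth => i; rewrite tnth_mktuple mxE. Qed.

Lemma tuple_of_rowK : cancel tuple_of_row row_of_tuple.
Proof. by move=> x; apply/rowP => i; rewrite mxE tnth_mktuple. Qed.

(* This is the sigma-algebra generated by the coordinates, i.e. the Borel one. *)
Definition measurable_row : set (set 'rV[R]_n) :=
  preimage_set_system setT tuple_of_row measurable.

Let measurable_row0 : measurable_row set0.
Proof. by exists set0; rewrite ?preimage_set0 ?setI0. Qed.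

Let measurable_rowC A : measurable_row A -> measurable_row (~` A).
Proof. by case=> B mB <-; exists (~` B); rewrite ?setTI//; exact: measurableC. Qed.

Let measurable_row_bigcup (F : (set 'rV[R]_n)^nat) :
  (forall i, measurable_row (F i)) -> measurable_row (\bigcup_i F i).
Proof.
move=> mF; have /choice[G GF] : forall i, exists B, measurable B /\
    tuple_of_row @^-1` B = F i.
  by move=> i; have [B mB] := mF i; rewrite setTI => <-; exists B.
exists (\bigcup_i G i); first by apply: bigcupT_measurable => i; case: (GF i).
by rewrite setTI preimage_bigcup; apply: eq_bigcupr => i _; case: (GF i).
Qed.

HB.instance Definition _ := @isMeasurable.Build (row_display default_measure_display)
  'rV[R]_n measurable_row measurable_row0 measurable_rowC measurable_row_bigcup.

Lemma measurable_row_of_tuple : measurable_fun [set: T] row_of_tuple.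
Proof.
move=> _ _ [B mB <-]; rewrite !setTI -comp_preimage.
rewrite (_ : tuple_of_row \o row_of_tuple = id) ?preimage_id//.
by apply/funext => t /=; rewrite row_of_tupleK.
Qed.

Lemma measurable_tuple_of_row : measurable_fun [set: 'rV[R]_n] tuple_of_row.
Proof. by move=> _ B mB; exists B. Qed.

Definition lebesgue_row : set 'rV[R]_n -> \bar R :=
  pushforward (power_measure (@lebesgue_measure R) n) row_of_tuple.

HB.instance Definition _ := isMeasure.Build _ _ _ lebesgue_row
  (pushforward0 _ _) (pushforward_ge0 _ _)
  (pushforward_sigma_additive measurable_row_of_tuple).

Lemma lebesgue_row_sigma_finite : sigma_finite [set: 'rV[R]_n] lebesgue_row.
Proof.
apply: (pushforward_sigma_finite measurable_tuple_of_row row_of_tupleK).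
exact: sigma_finiteT.
Qed.

HB.instance Definition _ := Measure_isSigmaFinite.Build _ _ _ lebesgue_row
  lebesgue_row_sigma_finite.

End measurable_row.

Section spaces.
Context {R : realType} {n : nat}.
Notation V := 'rV[R]_n.
Implicit Types (A U Om : set V) (f g u w phi : V -> R) (s : seq 'I_n).

Definition enorm (x : V) : R := Num.sqrt (\sum_(i < n) x 0 i ^+ 2).

(* [pder [:: i1; ...; ik] f] is the iterated partial derivative
   d_i1 (... (d_ik f)); it is meaningful only where the derivatives exist. *)
Definition pder s f : V -> R :=
  foldr (fun i h (x : V) => 'D_(delta_mx 0 i) h x) f s.

Definition laplacian f (x : V) : R := \sum_(i < n) pder [:: i; i] f x.

(* f is of class C^k on the open set U. *)
Definition Ck (k : nat) U f : Prop :=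
  (forall s x, (size s <= k)%N -> U x -> {for x, continuous (pder s f)}) /\
  (forall s i x, (size s < k)%N -> U x ->
     derivable (pder s f) x (delta_mx 0 i : V)).

Definition Csmooth U f : Prop := forall k, Ck k U f.

Definition bdry Om : set V := closure Om `\` interior Om.

Definition domain Om : Prop := [/\ open Om, connected Om & Om !=set0].

(* Near each of its boundary points Om is a strict sublevel set of a smooth
   function whose gradient does not vanish on the boundary. *)
Definition smooth_boundary Om : Prop :=
  forall x0, bdry Om x0 -> exists U (rho : V -> R),
    [/\ open U /\ U x0, Csmooth U rho,
        forall x, U x -> (Om x <-> rho x < 0),
        forall x, U x -> (bdry Om x <-> rho x = 0) &
        forall x, U x -> bdry Om x -> exists i, pder [:: i] rho x != 0].

(* g is of class C^k on the hypersurface bdry Om: locally it is the restriction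
   of a C^k function of n variables. *)
Definition Ck_bdry (k : nat) Om g : Prop :=
  forall x0, bdry Om x0 -> exists U G,
    [/\ open U /\ U x0, Ck k U G & forall x, U x -> bdry Om x -> G x = g x].

Definition sup_norm A f : \bar R := ereal_sup [set (`|f x|)%:E | x in A].

Definition hoelder_seminorm (a : R) A f : \bar R :=
  ereal_sup [set (`|f z.1 - f z.2| / enorm (z.1 - z.2) `^ a)%:E
            | z in [set z : V * V | [/\ A z.1, A z.2 & z.1 != z.2]]].

(* C^{k,a}(Om) for a bounded domain Om.  As a function has no partial derivatives
   on the boundary, "continuous up to the closure" is stated by an extension F,
   which is unique; for s = [::] it is f itself. *)
Definition hoelder_space (k : nat) (a : R) Om f : Prop :=
  [/\ Ck k Om f, {within closure Om, continuous f} &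
      forall s, (size s <= k)%N -> exists F : V -> R,
        [/\ {within closure Om, continuous F},
            forall x, Om x -> F x = pder s f x &
            size s = k -> (hoelder_seminorm a (closure Om) F < +oo)%E]].

(* The suprema over Om and over its closure agree on [hoelder_space k a Om]. *)
Definition hoelder_norm (k : nat) (a : R) Om f : \bar R :=
  (\sum_(j < k.+1) \sum_(s : j.-tuple 'I_n) sup_norm Om (pder s f) +
   \sum_(s : k.-tuple 'I_n) hoelder_seminorm a Om (pder s f))%E.

Definition hoelder_cvg (k : nat) (a : R) Om (u_ : nat -> V -> R) u : Prop :=
  [/\ forall m, hoelder_space k a Om (u_ m), hoelder_space k a Om u &
      hoelder_norm k a Om (u_ m \- u) @[m --> \oo] --> 0%E].

Definition test_function Om phi : Prop :=
  [/\ Csmooth setT phi, compact (closure [set x | phi x != 0]) &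
      closure [set x | phi x != 0] `<=` Om].

Definition loc_integrable Om f : Prop :=
  forall K, compact K -> K `<=` Om -> (@lebesgue_row R n).-integrable K (EFin \o f).

(* w is the weak derivative of u in Om for the multi-index listed by s. *)
Definition weak_der Om s u w : Prop :=
  [/\ loc_integrable Om u, loc_integrable Om w &
      forall phi, test_function Om phi ->
        (\int[@lebesgue_row R n]_(x in Om) (u x * pder s phi x) =
         (-1) ^+ size s * \int[@lebesgue_row R n]_(x in Om) (w x * phi x))%R].

(* Weak derivatives are unique up to a null set; this picks one of them. *)
Definition wder Om s u : V -> R := xget (fun=> 0) [set w | weak_der Om s u w].

Definition weak_laplacian Om u (x : V) : R := \sum_(i < n) wder Om [:: i; i] u x.

Definition Lp_norm (p : R) Om f : \bar R :=
  ('N[@lebesgue_row R n]_p%:E [EFin \o (f \_ Om)])%E.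

Definition Lp (p : R) Om f : Prop :=
  measurable_fun Om f /\ (Lp_norm p Om f < +oo)%E.

(* W^{k,p}(Om), as a set of functions rather than of classes modulo a.e. equality *)
Definition sobolev (k : nat) (p : R) Om u : Prop :=
  forall s, (size s <= k)%N -> exists w, weak_der Om s u w /\ Lp p Om w.

Definition sobolev_norm (k : nat) (p : R) Om u : \bar R :=
  (\sum_(j < k.+1) \sum_(s : j.-tuple 'I_n) Lp_norm p Om (wder Om s u))%E.

(* Continuous linear functionals on W^{k,p}(Om).  Boundedness makes them constant
   on classes modulo a.e. equality. *)
Definition sobolev_dual (k : nat) (p : R) Om (l : (V -> R) -> R) : Prop :=
  (forall (a : R) u w, sobolev k p Om u -> sobolev k p Om w ->
     l (fun x => a * u x + w x) = a * l u + l w) /\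
  (exists C : R, forall u, sobolev k p Om u ->
     ((`|l u|)%:E <= C%:E * sobolev_norm k p Om u)%E).

Definition sobolev_weak_cvg (k : nat) (p : R) Om (u_ : nat -> V -> R) u : Prop :=
  [/\ forall m, sobolev k p Om (u_ m), sobolev k p Om u &
      forall l, sobolev_dual k p Om l -> l (u_ m) @[m --> \oo] --> l u].

Definition penalized_solution (beta : R -> R) (eps : R) Om
    (f1 f2 psi1 psi2 g1 g2 u1 u2 : V -> R) : Prop :=
  [/\ Ck 2 Om u1 /\ Ck 2 Om u2,
      {within closure Om, continuous u1} /\ {within closure Om, continuous u2},
      forall x, Om x ->
        - laplacian u1 x + f1 x + beta ((u1 x - u2 x + psi1 x) / eps) = 0,
      forall x, Om x ->
        - laplacian u2 x + f2 x + beta ((u2 x - u1 x + psi2 x) / eps) = 0 &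
      forall x, bdry Om x -> u1 x = g1 x /\ u2 x = g2 x].

End spaces.

Definition penalty {R : realType} (beta : R -> R) : Prop :=
  [/\ forall k s, derivable (derive1n k beta) s 1,
      forall s, 0 <= s -> beta s = 0,
      forall s, s < 0 -> beta s < 0 /\ 0 < derive1 beta s <= 1 &
      beta s @[s --> -oo] --> -oo].

(* Main.v *)
From HB Require Import structures.
Require Import Defs.
From mathcomp Require Import all_boot all_order all_algebra.
From mathcomp Require Import ring lra.
From mathcomp Require Import all_classical all_reals all_analysis measurable_realfun.

Import Order.TTheory GRing.Theory Num.Theory.
Import numFieldNormedType.Exports.

Set Implicit Arguments.
Unset Strict Implicit.
Unset Printing Implicit Defensive.

Local Open Scope classical_set_scope.
Local Open Scope ring_scope.

(** The limit functions inherit everything from local estimates on the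
    penalized system, which are uniform in the penalty parameter. Write
    w = u1 - u2 + psi1, and let A = - beta (w / eps), which is nonnegative, be
    the term added by the penalty to the first equation: Delta u1 = f1 - A.
    Where w < 0 the inequality psi1 + psi2 >= 0 makes the other obstacle
    inactive, so that Delta w = h - A with h = f1 - f2 + Delta psi1.

    The estimate that carries the proof is penalty_bound. If w >= - eta on a
    cube of radius r around x and w x < 0, then A x <= sup h + 4 n eta / r^2: at
    an interior minimum of w plus a quadratic barrier the Laplacian of w is
    nearly nonnegative, hence A is nearly bounded by h there, and the
    monotonicity of beta transfers the bound to x. A first use, with a crude
    eta, bounds A independently of eps; as beta tends to -oo this forces
    w >= - C eps, so the limit of w is nonnegative (obstacle_ge0). Then eta may
    be taken arbitrarily small, and A is asymptotically at most the positive
    part of h near every point (penalty_near_contact). Where the limit of w is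
    positive, A vanishes eventually near the point (penalty_off_contact).

    There the functions u1 solve one Poisson equation and converge in C^1.
    Differences of them are harmonic, so the interior estimate harmonic_second
    makes their second derivatives locally uniformly Cauchy: the limit is of
    class C^2 and solves the equation classically (poisson_C2_limit). The
    gradient of a harmonic function is estimated by comparison: its odd part
    under a reflection stays below an explicit barrier (harmonic_difference).

    The inequalities on weak Laplacians come from testing with smooth bumps. An
    inequality between Delta u1 and continuous functions that holds for small
    eps passes to the limit after two integrations by parts, and an integrable
    function with nonnegative integral against all bumps is nonnegative almost
    everywhere (weak_limit_nonneg, nonneg_of_bumps). From 0 <= A follows
    - Delta u1 + f1 >= 0 almost everywhere. From the asymptotic bounds on A
    follows equality almost everywhere on the set where the limit of w is
    positive or h <= 0.

    By symmetry the same holds for the second equation, with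
    k = f2 - f1 + Delta psi2 in place of h. So the minimum of the two
    expressions vanishes almost everywhere, except perhaps on the set where
    both obstacles are in contact and h, k > 0. On that set psi1 + psi2
    vanishes, although it is nonnegative on the domain, and its Laplacian h + k
    is positive. Such a set is null (negligible_nonflat_contact): where a second
    derivative d_i d_i F of a function F >= 0 does not vanish, a line in the
    direction i contains at most one zero of F, locally, so the set of these
    zeros is disjoint from its translates and has measure zero. *)

(** * Derivatives along lines *)

Lemma is_derive_line {R : realType} {V : normedModType R} (f : V -> R) (x v : V)
    (t df : R) :
  is_derive (x + t *: v) v f df -> is_derive t 1 (fun s => f (x + s *: v)) df.
Proof.
move=> [dfx <-].
have E : (fun h : R => h^-1 *: (((fun s => f (x + s *: v)) \o shift t) (h *: 1) -
             f (x + t *: v))) =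
  (fun h => h^-1 *: ((f \o shift (x + t *: v)) (h *: v) - f (x + t *: v))).
  apply/funext => h /=; congr (_ *: (f _ - _)).
  by rewrite [h *: 1]mulr1 scalerDl addrCA.
by constructor; rewrite /derivable /derive /= E.
Qed.

(** Since g' is only known to be differentiable at 0, there is no Taylor expansion
    with a second derivative at an intermediate point. The mean value theorem is
    applied to s |-> g s + g (- s) - c s^2, whose derivative
    g' s - g' (- s) - 2 c s is o(s). *)
Lemma second_difference_cvg {R : realType} (g g' : R -> R) (d c : R) :
  0 < d -> (forall s, `|s| < d -> is_derive s (1 : R) g (g' s)) ->
  is_derive (0 : R) (1 : R) g' c ->
  (g t + g (- t) - 2 * g 0) / t ^+ 2 @[t --> 0^'+] --> c.
Proof.
move=> d0 gg' [dg'].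
move/cvgrPdist_le : (dg'); rewrite /derive /= => dg'c <-.
set c' := lim _ in dg'c *.
apply/cvgrPdist_le => e e0.
have e20 : 0 < e / 2 by rewrite divr_gt0.
have := dg'c _ e20; rewrite near_withinE => -[r /= r0 Hr].
near=> t.
have t0 : 0 < t by near: t; exact: nbhs_right_gt.
have tr : t < r by near: t; exact: nbhs_right_lt.
have td : t < d by near: t; exact: nbhs_right_lt.
have Hs s : 0 < `|s| < r -> `|g' s - g' 0 - c' * s| <= e / 2 * `|s|.
  move=> /andP[s0 sr].
  have sn0 : s != 0 by rewrite -normr_gt0.
  have := Hr s; rewrite /= sub0r normrN => /(_ sr sn0).
  rewrite addr0 [s *: 1]mulr1 => H.
  rewrite -ler_pdivrMr// -normfV -normrM -normrN.
  suff -> : - ((g' s - g' 0 - c' * s) / s) = c' - s^-1 *: (g' s - g' 0) by [].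
  by rewrite -[_ *: _]/(_ * _); field.
pose G := fun s : R => g s + g (- s) - c' * s ^+ 2.
have dG s : `|s| < d -> is_derive s (1:R) G (g' s - g' (- s) - 2 * c' * s).
  move=> sd.
  have D1 := gg' _ sd.
  have D2 : is_derive s (1:R) (fun s => g (- s)) (- g' (- s)).
    have sd' : `|- s| < d by rewrite normrN.
    have D3 := gg' _ sd'.
    rewrite -mulrN1.
    exact: (is_derive1_comp (f := g) D3 (is_deriveN (is_derive_id s (1 : R)))).
  have D3 := is_deriveB (is_deriveD D1 D2)
    (is_deriveZ c' (is_deriveX 2 (is_derive_id s (1 : R)))).
  have -> : g' s - g' (- s) - 2 * c' * s =
    g' s + - g' (- s) - c' *: ((1.+1%:R * (id : R -> R) s ^+ 1) *: (1 : R)).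
    by rewrite /= expr1 -![_ *: _]/(_ * _); ring.
  exact: D3.
have [] := @MVT R G (fun s => g' s - g' (- s) - 2 * c' * s) 0 t t0.
- move=> x; rewrite in_itv/= => /andP[x0 xt]; apply: dG.
  by rewrite gtr0_norm//; apply: lt_trans td.
- apply: derivable_within_continuous => x; rewrite in_itv/= => /andP[x0 xt].
  have [] // := dG x _.
  by rewrite ger0_norm//; apply: le_lt_trans td.
move=> s; rewrite in_itv/= => /andP[s0 st]; rewrite subr0 => GE.
have sr : 0 < `|s| < r by rewrite gtr0_norm// s0/=; apply: lt_trans tr.
have sr' : 0 < `|- s| < r by rewrite normrN.
have := Hs _ sr; have := Hs _ sr'; rewrite normrN (gtr0_norm s0) => H1 H2.
have t2 : 0 < t ^+ 2 by rewrite exprn_gt0.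
have E : G t - G 0 = (g t + g (- t) - 2 * g 0) - c' * t ^+ 2.
  by rewrite /G oppr0; ring.
rewrite distrC.
have -> : (g t + g (- t) - 2 * g 0) / t ^+ 2 - c' = (G t - G 0) / t ^+ 2.
  by rewrite E; field; rewrite gt_eqF.
rewrite normrM normfV (gtr0_norm t2) ler_pdivrMr// GE normrM (gtr0_norm t0).
(* the intermediate point s is below t, and each of the two difference
   quotients of g' at 0 contributes e / 2 *)
apply: (@le_trans _ _ ((e * s) * t)); last first.
  by rewrite expr2 -mulrA ler_wpM2l ?(ltW e0)// ler_wpM2r ?(ltW t0)// ltW.
rewrite ler_wpM2r ?(ltW t0)//.
have -> : g' s - g' (- s) - 2 * c' * s = (g' s - g' 0 - c' * s) - (g' (- s) - g' 0 - c' * - s)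
  by ring.
apply: le_trans (ler_normB _ _) _.
by apply: le_trans (lerD H2 H1) _; lra.
Unshelve. all: by end_near. Qed.

(** * Cubes and second differences *)

Lemma cvg_sumr {R : realType} {T I : Type} (F : set_system T) {FF : Filter F}
    (r : seq I) (f : I -> T -> R) (a : I -> R) :
  (forall i, f i x @[x --> F] --> a i) ->
  \sum_(i <- r) f i x @[x --> F] --> \sum_(i <- r) a i.
Proof. by move=> fa; apply: cvg_big => //; exact: add_continuous. Qed.

Section rows.
Context {R : realType} {n : nat}.
Notation V := 'rV[R]_n.
Implicit Types (x y z : V) (U : set V).

Notation e j := (delta_mx 0 j : V).

Lemma row_ballP x r y : ball x r y <-> 0 < r /\ forall i, `|x 0 i - y 0 i| < r.
Proof.
split; first by move=> [r0 H]; split=> // i; exact: H.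
by move=> [r0 H]; split=> // i j; rewrite ord1; exact: H.
Qed.

Lemma row_normP x r : 0 < r -> (`|x| < r <-> forall i, `|x 0 i| < r).
Proof.
move=> r0; have <- : @ball R V 0 r x <-> `|x| < r.
  by rewrite mx_norm_ball /ball_/= sub0r normrN.
rewrite row_ballP; split.
  by move=> [_ H] i; have := H i; rewrite mxE sub0r normrN.
by move=> H; split=> // i; rewrite mxE sub0r normrN.
Qed.

Lemma row_norm_coord x i : `|x 0 i| <= `|x|.
Proof.
rewrite leNgt; apply/negP => xi.
have := (row_normP x (le_lt_trans (normr_ge0 x) xi)).1 xi i.
by rewrite ltxx.
Qed.

Lemma row_norm_le x r : 0 <= r -> (forall i, `|x 0 i| <= r) -> `|x| <= r.
Proof.
move=> r0 xr; apply/ler_addgt0Pr => d d0; apply/ltW.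
have rd : 0 < r + d by rewrite ltr_wpDl.
by apply/(row_normP _ rd) => i; rewrite (le_lt_trans (xr i))// ltrDl.
Qed.

Lemma norm_delta_row t j : `|t *: e j| <= `|t|.
Proof.
apply: row_norm_le => // i; rewrite !mxE normrM ler_piMr//.
by case: (_ && _); rewrite ?normr1 ?normr0.
Qed.

Lemma row_norm_eq x r : 0 < r -> `|x| = r -> exists i, `|x 0 i| = r.
Proof.
move=> r0 xr; apply: contrapT => /forallNP H.
suff : `|x| < r by rewrite xr ltxx.
apply/(row_normP _ r0) => i; rewrite lt_neqAle; apply/andP; split.
  by apply/eqP; exact: H.
by rewrite -xr row_norm_coord.
Qed.

(** Row vectors carry the maximum norm, so balls are cubes: their measure is a
    product, and on their boundary one coordinate difference is extremal. *)
Definition cube x r : set V := [set y | `|y - x| < r].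
Definition closed_cube x r : set V := [set y | `|y - x| <= r].

Lemma cubeE x r : cube x r = ball x r.
Proof.
by rewrite mx_norm_ball /ball_; apply/funext => y; rewrite /cube/= distrC.
Qed.

Lemma open_cube x r : open (cube x r).
Proof. by rewrite cubeE; exact: ball_open. Qed.

Lemma compact_closed_cube x r : compact (closed_cube x r).
Proof.
apply: bounded_closed_compact.
  exists (`|x| + r); split; first exact: num_real.
  move=> M rM y /= yx; apply: le_trans (ltW rM).
  by rewrite -[y](subrK x) addrC (le_trans (ler_normD _ _))// lerD2l.
have cN : {in ~` ((fun y => `|y - x|) @^-1` [set t : R | t <= r]),
    continuous (fun y : V => `|y - x|)}.
  move=> y _; have H : z - x @[z --> y] --> y - x.
    exact: (cvgB (@cvg_id _ (nbhs y)) (@cvg_cst _ x _ (nbhs y) _)).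
  exact: (cvg_norm H).
exact: (preimage_closed cN (@closed_le _ r)).
Qed.

Lemma open_closed_cube U x : open U -> U x ->
  exists r, 0 < r /\ closed_cube x r `<=` U.
Proof.
move=> oU Ux; have /nbhs_ballP[r /= r0 rU] := open_nbhs_nbhs (conj oU Ux).
exists (r / 2); split; first by rewrite divr_gt0.
move=> y yx; apply: rU; rewrite -cubeE; apply: le_lt_trans yx _.
by rewrite ltr_pdivrMr// ltr_pMr// ltr1n.
Qed.

Lemma cube_nbhs x r : 0 < r -> nbhs x (cube x r).
Proof. by move=> r0; rewrite cubeE; exact: nbhsx_ballx. Qed.

Lemma cube_sub x r : cube x r `<=` closed_cube x r.
Proof. by move=> y /ltW. Qed.

Definition second_quotient (F : V -> R) y j (t : R) : R :=
  (F (y + t *: e j) + F (y - t *: e j) - 2 * F y) / t ^+ 2.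

(** A Laplacian defined by second differences. It composes with translations and
    reflections by mere computation, it is exact on quadratic polynomials, and it is
    nonnegative at a minimum, which is what comparison arguments use. *)
Definition difflap (F : V -> R) y (L : R) : Prop :=
  \sum_(j < n) second_quotient F y j t @[t --> 0^'+] --> L.

Lemma difflapD F G y a b : difflap F y a -> difflap G y b -> difflap (F \+ G) y (a + b).
Proof.
move=> Fa Gb; rewrite /difflap.
have -> : (fun t : R => \sum_(j < n) second_quotient (F \+ G) y j t) =
   (fun t => \sum_(j < n) second_quotient F y j t + \sum_(j < n) second_quotient G y j t).
  apply/funext => t; rewrite -big_split/=; apply: eq_bigr => j _.
  by rewrite /second_quotient/= -[RHS]mulrDl; congr (_ * _); ring.
exact: cvgD.
Qed.

Lemma difflapZ F y c a : difflap F y a -> difflap (fun z => c * F z) y (c * a).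
Proof.
move=> Fa; rewrite /difflap.
have -> : (fun t : R => \sum_(j < n) second_quotient (fun z => c * F z) y j t) =
   (fun t => c * \sum_(j < n) second_quotient F y j t).
  apply/funext => t; rewrite mulr_sumr; apply: eq_bigr => j _.
  by rewrite /second_quotient/= [RHS]mulrA; congr (_ * _); ring.
apply: cvgM; [exact: cvg_cst|exact: Fa].
Qed.

(** The barriers: separable quadratic polynomials, with one linear term. *)
Definition quad (c p : 'I_n -> R) (b : R) (i : 'I_n) (y : V) : R :=
  \sum_k c k * (y 0 k - p k) ^+ 2 + b * y 0 i.

Lemma quad_continuous c p b i : continuous (quad c p b i).
Proof.
move=> y0; pose y : V := y0; rewrite -[y0]/y.
have H k : (fun z : V => z 0 k) @ y --> y 0 k := @coord_continuous R 1 n 0 k y.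
have A : (fun z : V => \sum_k c k * (z 0 k - p k) ^+ 2) @ y -->
    \sum_k c k * (y 0 k - p k) ^+ 2.
  apply: (@cvg_sumr R V 'I_n (nbhs (y : V))) => k.
  have Hp : (fun z : V => z 0 k - p k) @ y --> y 0 k - p k.
    exact: (@cvgB _ R _ (nbhs y) _ (fun z : V => z 0 k) (fun=> p k) _ _ (H k) (cvg_cst _)).
  by apply: cvgM; [exact: cvg_cst|exact: cvgM].
by apply: (cvgD A); apply: cvgM; [exact: cvg_cst|exact: H].
Qed.

Lemma quad_difflap c p b i y : difflap (quad c p b i) y (2 * \sum_k c k).
Proof.
apply/cvgrPdist_lt => d d0; near=> t.
have t0 : 0 < t by near: t; exact: nbhs_right_gt.
suff -> : \sum_(j < n) second_quotient (quad c p b i) y j t = 2 * \sum_k c k.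
  by rewrite subrr normr0.
rewrite mulr_sumr; apply: eq_bigr => j _; rewrite /second_quotient /quad.
apply: (@mulIf _ (t ^+ 2)); first by rewrite expf_neq0// gt_eqF.
rewrite divfK ?expf_neq0 ?gt_eqF//.
have -> : forall a a' a'' b b' b'' : R,
  a + b + (a' + b') - 2 * (a'' + b'') = (a + a' - 2 * a'') + (b + b' - 2 * b'').
  by move=> *; ring.
have -> : b * (y + t *: e j) 0 i + b * (y - t *: e j) 0 i - 2 * (b * y 0 i) = 0.
  by rewrite !mxE; ring.
rewrite addr0 mulr_sumr -big_split/= -sumrB (bigD1 j)//= !mxE !eqxx big1 ?addr0.
  by rewrite /=; ring.
move=> k kj; rewrite !mxE eqxx (negbTE kj) /=; ring.
Unshelve. all: by end_near. Qed.

Lemma difflap_ge0_at_min F y L r : 0 < r -> (forall z, cube y r z -> F y <= F z) ->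
  difflap F y L -> 0 <= L.
Proof.
move=> r0 Fy FL.
apply: (closed_cvg (fun x : R => 0 <= x) (@closed_ge _ 0) _ L FL).
near=> t.
have t0 : 0 < t by near: t; exact: nbhs_right_gt.
have tr : t < r by near: t; exact: nbhs_right_lt.
apply: sumr_ge0 => j _; rewrite /second_quotient; apply: divr_ge0; last by rewrite exprn_ge0 ?ltW.
have H1 : F y <= F (y + t *: e j).
  apply: Fy; rewrite /cube/= addrAC subrr add0r.
  by apply: le_lt_trans (norm_delta_row _ _) _; rewrite gtr0_norm.
have H2 : F y <= F (y - t *: e j).
  apply: Fy; rewrite /cube/= addrAC subrr add0r normrN.
  by apply: le_lt_trans (norm_delta_row _ _) _; rewrite gtr0_norm.
lra.
Unshelve. all: by end_near. Qed.

(** Along each axis, second_difference_cvg applies. *)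
Lemma difflap_C2 U u y : open U -> Ck 2 U u -> U y -> difflap u y (laplacian u y).
Proof.
move=> oU [_ du] Uy; apply: cvg_sumr => j.
have [r [r0 rU]] := open_closed_cube oU Uy.
have Hr (s : R) : `|s| < r -> U (y + s *: e j).
  move=> sr; apply: rU; rewrite /closed_cube/= addrAC subrr add0r.
  by rewrite (le_trans (norm_delta_row _ _))// ltW.
have D1 (s : R) : `|s| < r ->
    is_derive s (1 : R) (fun s => u (y + s *: e j)) (pder [:: j] u (y + s *: e j)).
  move=> sr; apply: is_derive_line; apply: derivableP.
  by apply: (du [::]) => //; exact: Hr.
have D2 : is_derive (0 : R) (1 : R) (fun s => pder [:: j] u (y + s *: e j))
    (pder [:: j; j] u y).
  apply: is_derive_line; rewrite scale0r addr0; apply: derivableP.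
  exact: (du [:: j]).
have := second_difference_cvg r0 D1 D2.
rewrite /second_quotient scale0r addr0.
by under eq_fun do rewrite scaleNr.
Qed.

End rows.

(** * The maximum principle *)

Section maximum_principle.
Context {R : realType} {n : nat}.
Notation V := 'rV[R]_n.
Implicit Types (x y z : V) (U K O : set V) (F v w : V -> R).
Notation e j := (delta_mx 0 j : V).

Lemma compact_min K F : compact K -> K !=set0 ->
  (forall y, K y -> {for y, continuous F}) ->
  exists2 c, K c & forall y, K y -> F c <= F y.
Proof.
move=> cK K0 cF.
have cF' : {in K, continuous F} by move=> y; rewrite inE => /cF.
have [c Kc H] := EVT_min_rV K0 cK (continuous_in_subspaceT cF').
exists c; first by rewrite inE in Kc.
by move=> y Ky; apply: H; rewrite inE.
Qed.

(** The minimum is not attained in O, where the second differences would have to be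
    nonnegative in the limit. *)
Lemma minimum_principle K O F : compact K -> open O -> O `<=` K ->
  (forall y, K y -> {for y, continuous F}) ->
  (forall y, O y -> exists2 L, L < 0 & difflap F y L) ->
  (forall y, K y -> ~ O y -> 0 <= F y) ->
  forall y, K y -> 0 <= F y.
Proof.
move=> cK oO OK cF FL Fb y Ky.
have [c Kc Fc] := compact_min cK (ex_intro _ y Ky) cF.
apply: le_trans (Fc _ Ky).
have [Oc|nOc] := pselect (O c); last exact: Fb.
have [r [r0 rO]] := open_closed_cube oO Oc.
have [L L0 FL'] := FL _ Oc.
have := difflap_ge0_at_min r0 _ FL'; rewrite leNgt L0 => H.
suff : false by [].
by apply: H => z /cube_sub /rO /OK; exact: Fc.
Qed.

Lemma closed_cube_boundary x y r : 0 < r -> closed_cube x r y -> ~ cube x r y ->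
  exists2 k, `|y 0 k - x 0 k| = r & forall j, `|y 0 j - x 0 j| <= r.
Proof.
move=> r0 yr nyr.
have yE : `|y - x| = r.
  by apply/eqP; rewrite eq_le yr/= leNgt; apply/negP => /nyr.
have [k Hk] := row_norm_eq r0 yE.
exists k; first by rewrite -Hk !mxE.
by move=> j; have := row_norm_coord (y - x) j; rewrite yE !mxE.
Qed.

(** The barrier (2 eta / r^2) |y - x|^2 is at least 2 eta on the boundary of the cube,
    so that its sum with w is at least eta > 0 > w x there, and its minimum is
    attained at an interior point y. The second differences at y are nonnegative,
    which bounds - beta (w y / eps) by h y plus the Laplacian of the barrier. As
    w y <= w x, the monotonicity of beta transfers the bound from y to x. *)
Lemma penalty_bound (beta : R -> R) (h w : V -> R) x r eps eta H :
  {homo beta : s t / s <= t} -> 0 < eps -> 0 < r -> 0 < eta ->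
  (forall y, closed_cube x r y -> {for y, continuous w}) ->
  (forall y, closed_cube x r y -> - eta <= w y) ->
  (forall y, cube x r y -> h y <= H) ->
  (forall y, cube x r y -> w y < 0 -> difflap w y (h y + beta (w y / eps))) ->
  w x < 0 ->
  - beta (w x / eps) <= H + 4 * n%:R * eta / r ^+ 2.
Proof.
move=> mb eps0 r0 eta0 cw weta hH slw wx.
have [n0|n0] := posnP n.
  (* there is no room for a barrier, but the point x is itself a minimum of w *)
  have L := slw x _ wx.
  have xx : cube x r x by rewrite /cube/= subrr normr0.
  have /(difflap_ge0_at_min r0) H0 : difflap w x (h x + beta (w x / eps)) by exact: L.
  have : 0 <= h x + beta (w x / eps).
    apply: H0 => z _; suff -> : z = x by [].
    by apply/rowP => i; have := leq_trans (ltn_ord i) (eq_leq n0).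
  have := hH _ xx; rewrite [in 4 * _]n0 mulr0 !mul0r addr0; lra.
pose i0 := Ordinal n0.
pose c := 2 * eta / r ^+ 2.
have r20 : 0 < r ^+ 2 by rewrite exprn_gt0.
have c0 : 0 < c by rewrite divr_gt0// mulr_gt0.
pose q := quad (fun=> c) (fun k => x 0 k) 0 i0.
have qE y : q y = \sum_k c * (y 0 k - x 0 k) ^+ 2 by rewrite /q /quad mul0r addr0.
have q0 y : 0 <= q y.
  by rewrite qE; apply: sumr_ge0 => k _; rewrite mulr_ge0 ?sqr_ge0// ltW.
have qx : q x = 0 by rewrite qE big1// => k _; rewrite subrr expr0n mulr0.
have Kx : closed_cube x r x by rewrite /closed_cube/= subrr normr0 ltW.
have cF y : closed_cube x r y -> {for y, continuous (w \+ q)}.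
  move=> /cw cwy; apply: (@continuousD _ _ _ w q) => //; exact: quad_continuous.
have [y Ky Fy] := compact_min (@compact_closed_cube R n x r) (ex_intro _ x Kx) cF.
have Fyx := Fy _ Kx; rewrite /= qx addr0 in Fyx.
have Oy : cube x r y.
  apply: contrapT => nOy.
  have [k kr _] := closed_cube_boundary r0 Ky nOy.
  have : 2 * eta <= q y.
    rewrite qE (bigD1 k)//= -real_normK ?num_real// kr /c divfK ?gt_eqF//.
    by rewrite lerDl; apply: sumr_ge0 => j _; rewrite mulr_ge0 ?sqr_ge0// ltW.
  have := weta _ Ky; lra.
have wyx : w y <= w x by have := q0 y; lra.
have wy : w y < 0 by lra.
have := difflapD (slw _ Oy wy) (@quad_difflap R n (fun=> c) (fun k => x 0 k) 0 i0 y).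
have [d [d0 dO]] := open_closed_cube (@open_cube _ _ x r) Oy.
move/(difflap_ge0_at_min d0) => H0.
have {}H0 : 0 <= h y + beta (w y / eps) + 2 * \sum_(k < n) c.
  by apply: H0 => z /cube_sub /dO /cube_sub; exact: Fy.
rewrite sumr_const card_ord -mulr_natr in H0.
have := hH _ Oy.
have := mb (w y / eps) (w x / eps).
rewrite ler_pM2r ?invr_gt0// => /(_ wyx).
have -> : 4 * n%:R * eta / r ^+ 2 = 2 * (c * n%:R) by rewrite /c; ring.
lra.
Qed.

(** The hyperplane of reflection consists of the points y with y_i = x_i. *)
Definition reflection x i y : V := y - (2 * (y 0 i - x 0 i)) *: e i.

Lemma reflection_coord x i y k :
  reflection x i y 0 k = if k == i then 2 * x 0 i - y 0 i else y 0 k.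
Proof.
rewrite !mxE eqxx /=; case: eqVneq => [->|_]; rewrite ?mulr1 ?mulr0 ?subr0//.
by ring.
Qed.

Lemma reflection_closed_cube x i r y : 0 <= r -> closed_cube x r y ->
  closed_cube x r (reflection x i y).
Proof.
move=> r0 yr; apply: row_norm_le => // k; rewrite !(mxE, reflection_coord).
have H j : `|y 0 j - x 0 j| <= r.
  by apply: le_trans yr; have := row_norm_coord (y - x) j; rewrite !mxE.
have := H k; rewrite eqxx /=; case: eqVneq => [->|_] Hk.
  by rewrite mulr1 distrC; apply: le_trans Hk; rewrite le_eqVlt; apply/orP; left;
    apply/eqP; congr `|_|; ring.
by rewrite mulr0 subr0.
Qed.

Lemma reflection_continuous x i : continuous (reflection x i).
Proof.
move=> y0; pose y : V := y0; rewrite -[y0]/y.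
have H : (fun z : V => z 0 i) @ y --> y 0 i := @coord_continuous R 1 n 0 i y.
apply: (@cvgB _ V _ (nbhs y) _ id); first exact: cvg_id.
apply: (@cvgZl _ V _ (nbhs y)).
apply: (@cvgM _ _ (nbhs y)); first exact: cvg_cst.
by apply: (@cvgB _ R _ (nbhs y)); [exact: H|exact: cvg_cst].
Qed.

(** A reflection exchanges the two outer points of the second difference along the
    axis i and carries the other second differences along. *)
Lemma difflap_reflection v x i y L : difflap v (reflection x i y) L ->
  difflap (v \o reflection x i) y L.
Proof.
rewrite /difflap => H; suff -> :
  (fun t : R => \sum_(j < n) second_quotient (v \o reflection x i) y j t) =
  (fun t => \sum_(j < n) second_quotient v (reflection x i y) j t) by [].
apply/funext => t; apply: eq_bigr => j _; rewrite /second_quotient /=.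
have Ej s : reflection x i (y + s *: e j) =
    if j == i then reflection x i y - s *: e j else reflection x i y + s *: e j.
  apply/rowP => k; rewrite reflection_coord; case: (eqVneq j i) => [->|ji].
    rewrite [in RHS]mxE reflection_coord; case: (eqVneq k i) => [->|ki].
      by rewrite !mxE !eqxx /= mulr1; ring.
    by rewrite !mxE eqxx /= (negbTE ki) !mulr0 subr0 addr0.
  rewrite [in RHS]mxE reflection_coord; case: (eqVneq k i) => [->|ki].
    by rewrite !mxE eqxx /= eq_sym (negbTE ji) mulr0 !addr0.
  by rewrite !mxE.
have := Ej (- t); rewrite scaleNr => ->; rewrite Ej; case: eqVneq => // ->.
by rewrite opprK; congr (_ / _); ring.
Qed.

Lemma difflap_cst (a : R) y : difflap (fun=> a) y 0.
Proof.
rewrite /difflap; have -> : (fun t : R => \sum_(j < n) second_quotient (fun=> a) y j t) =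
  (fun=> 0).
  by apply/funext => t; rewrite big1// => j _;
    rewrite /second_quotient -mulr2n mulr_natl subrr mul0r.
exact: cvg_cst.
Qed.

Lemma row_coord_cvg i y : (fun z : V => z 0 i) @ y --> y 0 i.
Proof. exact: (@coord_continuous R 1 n 0 i y). Qed.

(** The odd part of v under the reflection is harmonic, vanishes on the hyperplane
    and is bounded by M. With s = y_i - x_i, it is dominated in the half cube s >= 0
    by the barrier
      (M / r^2) (sum_(k != i) (y_k - x_k)^2 + s ((n + 1) r - n s)),
    which is nonnegative, at least M on the rest of the boundary, and has Laplacian
    - 2 M / r^2 < 0. On the axis s = t through x the barrier is at most
    (n + 1) (M / r) t. *)
Lemma harmonic_difference v x (i : 'I_n) (r M t : R) :
  0 < r -> 0 < M ->
  (forall y, closed_cube x r y -> {for y, continuous v}) ->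
  (forall y, closed_cube x r y -> difflap v y 0) ->
  (forall y, closed_cube x r y -> `|v y| <= M) ->
  0 <= t <= r ->
  v (x + t *: e i) - v (x - t *: e i) <= 2 * (M / r * n.+1%:R) * t.
Proof.
move=> r0 M0 cv sv vM /andP[t0 tr].
pose c (k : 'I_n) : R := if k == i then - n%:R else 1.
pose q := quad c (fun k => x 0 k) (n.+1%:R * r) i.
pose psi y := M / r ^+ 2 * (q y + - (n.+1%:R * r * x 0 i)).
have sumc : \sum_k c k = -1.
  rewrite (bigD1 i)//= /c eqxx (eq_bigr (fun=> 1)); last first.
    by move=> k ki; rewrite (negbTE ki).
  rewrite sumr_const; have -> : #|[pred k | k != i]| = n.-1.
    by rewrite cardC1 card_ord.
  have n0 : (0 < n)%N by apply: leq_ltn_trans (ltn_ord i).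
  by rewrite -[in - _](prednK n0) -[n.-1.+1]addn1 natrD; ring.
have r20 : 0 < r ^+ 2 by rewrite exprn_gt0.
have Mr : 0 < M / r ^+ 2 by rewrite divr_gt0.
have slq y : difflap psi y (M / r ^+ 2 * (2 * -1)).
  apply: difflapZ; rewrite -[2 * -1]addr0 -sumc.
  by apply: difflapD; [exact: quad_difflap|exact: difflap_cst].
have psiE y : psi y = M / r ^+ 2 * (\sum_(k | k != i) (y 0 k - x 0 k) ^+ 2 +
    (y 0 i - x 0 i) * (n.+1%:R * r - n%:R * (y 0 i - x 0 i))).
  rewrite /psi /q /quad (bigD1 i)//= {1}/c eqxx; congr (_ * _).
  rewrite (eq_bigr (fun k => (y 0 k - x 0 k) ^+ 2)); first by ring.
  by move=> k ki; rewrite /c (negbTE ki) mul1r.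
(* the strict sign of the Laplacian of the barrier is what makes the
   minimum principle applicable *)
pose Phi y := psi y + (- 2^-1) * (v y + -1 * v (reflection x i y)).
pose K := closed_cube x r `&` [set y : V | x 0 i <= y 0 i].
pose O := cube x r `&` [set y : V | x 0 i < y 0 i].
have cK : compact K.
  apply: compact_closedI; first exact: compact_closed_cube.
  have H : {in ~` ((fun y : V => y 0 i) @^-1` [set s | x 0 i <= s]),
      continuous (fun y : V => y 0 i)}.
    by move=> y _; exact: row_coord_cvg.
  exact: (preimage_closed H (@closed_ge _ (x 0 i))).
have oO : open O.
  apply: openI; first exact: open_cube.
  by apply: (@open_comp _ _ (fun y : V => y 0 i) [set s | x 0 i < s]) => [y _|];
    [exact: row_coord_cvg|exact: open_gt].
have OK : O `<=` K.
  by move=> y [/cube_sub ? /ltW].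
have Phi0 y : K y -> 0 <= Phi y.
  apply: (minimum_principle cK oO OK).
  - move=> {}y [Ky _].
    have cv1 := cv _ Ky.
    have cv2 : {for y, continuous (v \o reflection x i)}.
      apply: continuous_comp; first exact: reflection_continuous.
      by apply: cv; apply: reflection_closed_cube => //; exact: ltW.
    have cq : {for y, continuous q} by exact: quad_continuous.
    apply: (@cvgD _ R _ (nbhs y)).
      apply: (@cvgM _ _ (nbhs y)); first exact: cvg_cst.
      by apply: (@cvgD _ R _ (nbhs y)); [exact: cq|exact: cvg_cst].
    apply: (@cvgM _ _ (nbhs y)); first exact: cvg_cst.
    apply: (@cvgD _ R _ (nbhs y)); first exact: cv1.
    by apply: (@cvgM _ _ (nbhs y)); [exact: cvg_cst|exact: cv2].
  - move=> {}y Oy; exists (M / r ^+ 2 * (2 * -1) + (- 2^-1) * (0 + -1 * 0)).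
      by have := Mr; lra.
    have [Ky _] := OK _ Oy.
    apply: difflapD => //; apply: difflapZ; apply: difflapD; first exact: sv.
    apply: difflapZ; apply: difflap_reflection; apply: sv; apply: reflection_closed_cube => //;
      exact: ltW.
  - move=> {}y [Ky xy] nOy.
    have Kr := reflection_closed_cube i (ltW r0) Ky.
    have sum0 (P : pred 'I_n) : 0 <= \sum_(k | P k) (y 0 k - x 0 k) ^+ 2.
      by apply: sumr_ge0 => k _; exact: sqr_ge0.
    (* the boundary of the half cube: first the flat face, where the odd part
       vanishes, then the faces of the cube, where the barrier is at least M *)
    have [xyi|xyi] := eqVneq (x 0 i) (y 0 i).
      have -> : Phi y = psi y.
        rewrite /Phi; suff -> : reflection x i y = y by ring.
        by rewrite /reflection xyi subrr mulr0 scale0r subr0.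
      by rewrite psiE xyi subrr mul0r addr0 mulr_ge0// ltW.
    have xyl : x 0 i < y 0 i by rewrite lt_neqAle xyi.
    have [k kr Hle] := closed_cube_boundary r0 Ky (fun Oy => nOy (conj Oy xyl)).
    have s0 : 0 <= y 0 i - x 0 i by rewrite subr_ge0.
    have sr : y 0 i - x 0 i <= r by rewrite -(ger0_norm s0).
    suff : M <= psi y.
      have := vM _ Ky; have := vM _ Kr; rewrite !ler_norml /Phi => /andP[] + + /andP[].
      lra.
    rewrite psiE.
    suff H : r ^+ 2 <= \sum_(k0 | k0 != i) (y 0 k0 - x 0 k0) ^+ 2 +
       (y 0 i - x 0 i) * (n.+1%:R * r - n%:R * (y 0 i - x 0 i)).
      by rewrite -{1}[M](divfK (lt0r_neq0 r20)) ler_pM2l.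
    have rest : 0 <= n.+1%:R * r - n%:R * (y 0 i - x 0 i).
      rewrite subr_ge0; apply: ler_pM => //; first by rewrite ler_nat.
    case: (eqVneq k i) => [ki|ki].
      have -> : y 0 i - x 0 i = r by rewrite -kr ki ger0_norm.
      by rewrite -mulrBl -natrB// subSnn mul1r -expr2 lerDr.
    rewrite (bigD1 k)//= -{1}kr real_normK ?num_real// -addrA lerDl.
    by rewrite addr_ge0 ?mulr_ge0//; apply: sum0.
pose y := x + t *: e i.
have yk k : y 0 k - x 0 k = if k == i then t else 0.
  rewrite /y !mxE eqxx /=; case: eqVneq => _; rewrite ?mulr1 ?mulr0; ring.
have Ky : K y.
  split; last by have := yk i; rewrite eqxx /=; lra.
  rewrite /closed_cube/= /y addrAC subrr add0r (le_trans (norm_delta_row _ _))//.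
  by rewrite ger0_norm.
have := Phi0 _ Ky; rewrite /Phi psiE big1; last first.
  by move=> k ki; rewrite yk (negbTE ki) expr0n.
have -> : reflection x i y = x - t *: e i.
  by apply/rowP => k; rewrite /reflection yk eqxx /y !mxE; ring.
rewrite yk eqxx add0r => H.
have : M / r ^+ 2 * (t * (n.+1%:R * r - n%:R * t)) <= M / r * n.+1%:R * t.
  have -> : M / r * n.+1%:R * t = M / r ^+ 2 * (t * (n.+1%:R * r)).
    by field; rewrite gt_eqF.
  rewrite ler_pM2l// ler_wpM2l// lerBlDr lerDl mulr_ge0//.
by move: H; rewrite /y; lra.
Qed.
End maximum_principle.

(** * Calculus of iterated partial derivatives *)

Section iterated_partials.
Context {R : realType} {n : nat}.
Notation V := 'rV[R]_n.
Implicit Types (x y z : V) (U : set V) (f g : V -> R) (s : seq 'I_n).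
Notation e j := (delta_mx 0 j : V).

Lemma eq_on_open_derive U f g x (v : V) : open U -> {in U, f =1 g} -> U x ->
  'D_v f x = 'D_v g x.
Proof.
move=> oU fg Ux; have H : \near x, f x = g x.
  by near=> y; apply: fg; rewrite inE; near: y; exact: open_nbhs_nbhs.
have [-> | v0] := eqVneq v 0; first by rewrite !derive0.
exact: near_eq_derive.
Unshelve. all: by end_near. Qed.

Lemma eq_on_open_derivable U f g x (v : V) : open U -> {in U, f =1 g} -> U x ->
  derivable f x v -> derivable g x v.
Proof.
move=> oU fg Ux; have H : \near x, f x = g x.
  by near=> y; apply: fg; rewrite inE; near: y; exact: open_nbhs_nbhs.
have [-> | v0] := eqVneq v 0; first by move=> _; exact: derivable0.
exact: near_eq_derivable.
Unshelve. all: by end_near. Qed.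

Lemma eq_on_open_continuous U f g x : open U -> {in U, f =1 g} -> U x ->
  {for x, continuous f} -> {for x, continuous g}.
Proof.
move=> oU fg Ux cf; rewrite /prop_for /continuous_at -(fg _ (mem_set Ux)).
have H : {near nbhs (x : V), f =1 g}.
  by near=> y; apply: fg; rewrite inE; near: y; exact: open_nbhs_nbhs.
exact: (cvg_trans (near_eq_cvg H) cf).
Unshelve. all: by end_near. Qed.

Lemma pder_eq_on_open U s f g : open U -> {in U, f =1 g} ->
  {in U, pder s f =1 pder s g}.
Proof.
move=> oU fg; elim: s => //= i s IH x; rewrite inE => Ux.
exact: (eq_on_open_derive _ oU IH Ux).
Qed.

(** The definition of pder peels off the outermost derivative; here the innermost
    one comes off. *)
Lemma pder_rcons s i f : pder (rcons s i) f = pder s (pder [:: i] f).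
Proof. by rewrite /pder foldr_rcons. Qed.

Lemma Ck_le k l U f : (k <= l)%N -> Ck l U f -> Ck k U f.
Proof.
move=> kl [cf df]; split=> [s x sk|s i x sk]; first by apply: cf; exact: leq_trans kl.
by apply: df; exact: leq_trans kl.
Qed.

Lemma Ck_eq k U f g : open U -> {in U, f =1 g} -> Ck k U f -> Ck k U g.
Proof.
move=> oU fg [cf df]; split=> [s x sk Ux|s i x sk Ux].
  have H := @pder_eq_on_open U s f g oU fg.
  exact: (eq_on_open_continuous oU H Ux (cf _ _ sk Ux)).
have H := @pder_eq_on_open U s f g oU fg.
exact: (eq_on_open_derivable oU H Ux (df _ _ _ sk Ux)).
Qed.

Lemma Ck0P U f : Ck 0 U f <-> forall x, U x -> {for x, continuous f}.
Proof.
split=> [[cf _] x Ux|cf]; first exact: (cf [::]).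
split=> [s x|s i x]; last by rewrite ltn0.
by rewrite leqn0 => /nilP -> /cf.
Qed.

(** The recursive description of C^k. It gives stability under products by induction
    on k, the first derivatives of a product being sums of products of functions of
    class C^k. *)
Lemma CkSP k U f : Ck k.+1 U f <->
  [/\ forall x, U x -> {for x, continuous f},
      forall i x, U x -> derivable f x (e i) &
      forall i, Ck k U (pder [:: i] f)].
Proof.
split=> [[cf df]|[cf df Hi]].
  split=> [x Ux|i x Ux|i]; [exact: (cf [::])|exact: (df [::])|].
  split=> [s x sk Ux|s j x sk Ux]; rewrite -pder_rcons.
    by apply: cf => //; rewrite size_rcons.
  by apply: df => //; rewrite size_rcons.
split=> [s x|s j x]; elim/last_ind: s => [|s i _] //.
- by move=> _; exact: cf.
- rewrite size_rcons ltnS pder_rcons => sk Ux; exact: (Hi i).1.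
- by move=> _; exact: df.
- rewrite size_rcons ltnS pder_rcons => sk Ux; exact: (Hi i).2.
Qed.

Lemma CkD k U f g : open U -> Ck k U f -> Ck k U g -> Ck k U (f \+ g).
Proof.
move=> oU; elim: k f g => [|k IH] f g.
  move=> /Ck0P cf /Ck0P cg; apply/Ck0P => x Ux.
  by apply: (@continuousD _ _ _ f g); [exact: cf|exact: cg].
move=> /CkSP[cf df Hf] /CkSP[cg dg Hg]; apply/CkSP; split => [x Ux|i x Ux|i].
- by apply: (@continuousD _ _ _ f g); [exact: cf|exact: cg].
- by apply: (@derivableD _ _ _ f g); [exact: df|exact: dg].
- apply: (Ck_eq oU _ (IH _ _ (Hf i) (Hg i))) => x; rewrite inE => Ux /=.
  by rewrite -deriveD//; [exact: df|exact: dg].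
Qed.

Lemma CkM k U f g : open U -> Ck k U f -> Ck k U g -> Ck k U (f \* g).
Proof.
move=> oU; elim: k f g => [|k IH] f g.
  move=> /Ck0P cf /Ck0P cg; apply/Ck0P => x Ux.
  by apply: (@continuousM _ _ f g); [exact: cf|exact: cg].
move=> Cf Cg; have Cf' := Ck_le (leqnSn k) Cf; have Cg' := Ck_le (leqnSn k) Cg.
move: Cf Cg => /CkSP[cf df Hf] /CkSP[cg dg Hg]; apply/CkSP; split => [x Ux|i x Ux|i].
- by apply: (@continuousM _ _ f g); [exact: cf|exact: cg].
- by apply: (@derivableM _ _ f g); [exact: df|exact: dg].
- apply: (Ck_eq oU _ (CkD oU (IH _ _ Cf' (Hg i)) (IH _ _ Cg' (Hf i)))) => x.
  rewrite inE => Ux /=.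
  by rewrite -[LHS]deriveM//; [exact: df|exact: dg].
Qed.

Lemma pder_cst s (c : R) x : pder s (fun=> c) x = if s is [::] then c else 0.
Proof.
elim/last_ind: s x => [|s i IH] x //.
rewrite pder_rcons; have -> : pder [:: i] (fun=> c : R) = (fun=> 0).
  by apply/funext => y /=; exact: derive_cst.
have -> : pder s (fun=> 0 : R) x = 0; last by case: s {IH}.
elim: s {IH} x => //= j s IH x.
have -> : pder s (fun=> 0 : R) = (fun=> 0) by apply/funext.
exact: derive_cst.
Qed.

Lemma Ck_cst k U (c : R) : Ck k U (fun=> c).
Proof.
have E s : exists d, pder s (fun=> c : R) = (fun=> d : R).
  by case: s => [|i s]; [exists c|exists 0]; apply/funext => x; rewrite pder_cst.
split=> [s x _ _|s i x _ _]; have [d ->] := E s; [exact: cst_continuous|exact: derivable_cst].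
Qed.

Lemma Ck_scale k U f (c : R) : open U -> Ck k U f -> Ck k U (fun x => c * f x).
Proof. by move=> oU Cf; exact: (CkM oU (Ck_cst k U c) Cf). Qed.

Lemma CkB k U f g : open U -> Ck k U f -> Ck k U g -> Ck k U (f \- g).
Proof.
move=> oU Cf Cg; have := CkD oU Cf (Ck_scale (-1) oU Cg).
by apply: Ck_eq => // x _ /=; rewrite mulN1r.
Qed.

Lemma pderB k U f g s x : open U -> Ck k U f -> Ck k U g -> (size s <= k)%N -> U x ->
  pder s (f \- g) x = pder s f x - pder s g x.
Proof.
move=> oU Cf Cg; elim: s x => //= i s IH x sk Ux.
rewrite -[RHS]deriveB; last 2 first.
- exact: Cf.2.
- exact: Cg.2.
apply: (eq_on_open_derive _ oU _ Ux) => y; rewrite inE => Uy.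
by apply: IH => //; exact: ltnW.
Qed.

Lemma pderD k U f g s x : open U -> Ck k U f -> Ck k U g -> (size s <= k)%N -> U x ->
  pder s (f \+ g) x = pder s f x + pder s g x.
Proof.
move=> oU Cf Cg; elim: s x => //= i s IH x sk Ux.
rewrite -[RHS]deriveD; last 2 first.
- exact: Cf.2.
- exact: Cg.2.
apply: (eq_on_open_derive _ oU _ Ux) => y; rewrite inE => Uy.
by apply: IH => //; exact: ltnW.
Qed.

Lemma laplacianD U f g x : open U -> Ck 2 U f -> Ck 2 U g -> U x ->
  laplacian (f \+ g) x = laplacian f x + laplacian g x.
Proof.
move=> oU Cf Cg Ux; rewrite /laplacian -big_split; apply: eq_bigr => i _.
exact: (pderD oU Cf Cg).
Qed.

Lemma laplacianB U f g x : open U -> Ck 2 U f -> Ck 2 U g -> U x ->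
  laplacian (f \- g) x = laplacian f x - laplacian g x.
Proof.
move=> oU Cf Cg Ux; rewrite /laplacian -sumrB; apply: eq_bigr => i _.
exact: (pderB oU Cf Cg).
Qed.

End iterated_partials.

(** * Interior estimates for harmonic functions *)

Section interior_estimates.
Context {R : realType} {n : nat}.
Notation V := 'rV[R]_n.
Implicit Types (x y z : V) (U : set V).
Notation e j := (delta_mx 0 j : V).

Lemma difference_le_derive (k : R -> R) (d C r : R) :
  0 < r -> is_derive (0 : R) (1 : R) k d -> k 0 = 0 ->
  (forall t, 0 <= t <= r -> k t <= C * t) -> d <= C.
Proof.
move=> r0 [dk <-] k0 kC; rewrite /derivable in dk; rewrite /derive.
have H : (fun h : R => h^-1 *: ((k \o shift 0) (h *: (1 : R)) - k 0)) @ 0^'+ -->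
   lim ((fun h : R => h^-1 *: ((k \o shift 0) (h *: (1 : R)) - k 0)) @ 0^').
  exact: cvg_dnbhs_at_right.
apply: (closed_cvg (fun x : R => x <= C) (@closed_le _ C) _ _ H).
near=> t.
have t0 : 0 < t by near: t; exact: nbhs_right_gt.
have tr : t < r by near: t; exact: nbhs_right_lt.
rewrite /= addr0 k0 subr0 [t *: 1]mulr1 -[_ *: _]/(_ * _) mulrC ler_pdivrMr//.
by apply: kC; rewrite ltW//= ltW.
Unshelve. all: by end_near. Qed.

(** The bound on v (x + t e_i) - v (x - t e_i), applied to v and to - v, is divided by
    2 t before t tends to 0. *)
Lemma harmonic_gradient (v : V -> R) x (i : 'I_n) (r M : R) :
  0 < r -> 0 < M ->
  (forall y, closed_cube x r y -> {for y, continuous v}) ->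
  (forall y, closed_cube x r y -> difflap v y 0) ->
  (forall y, closed_cube x r y -> `|v y| <= M) ->
  derivable v x (e i) ->
  `|pder [:: i] v x| <= M / r * n.+1%:R.
Proof.
move=> r0 M0 cv sv vM dv.
have half (w : V -> R) :
  (forall y, closed_cube x r y -> {for y, continuous w}) ->
  (forall y, closed_cube x r y -> difflap w y 0) ->
  (forall y, closed_cube x r y -> `|w y| <= M) ->
  derivable w x (e i) -> 'D_(e i) w x <= M / r * n.+1%:R.
  move=> cw sw wM dw.
  have D1 : is_derive (0 : R) (1 : R) (fun s => w (x + s *: e i)) ('D_(e i) w x).
    by apply: is_derive_line; rewrite scale0r addr0; exact: derivableP.
  have D1' : is_derive (- 0 : R) (1 : R) (fun s => w (x + s *: e i)) ('D_(e i) w x).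
    by rewrite oppr0.
  have D2 := is_derive1_comp D1' (is_deriveN (is_derive_id (0 : R) (1 : R))).
  have D3 := is_deriveB D1 D2.
  rewrite mulrN1 opprK in D3.
  suff : 'D_(e i) w x + 'D_(e i) w x <= 2 * (M / r * n.+1%:R) by lra.
  apply: (difference_le_derive r0 D3).
    by rewrite !fctE /= oppr0 subrr.
  move=> t tr; rewrite !fctE /= scaleNr; exact: (harmonic_difference i r0 M0 cw sw wM tr).
rewrite ler_norml; apply/andP; split; last exact: half.
rewrite lerNl -[X in X <= _]/(- 'D_(e i) v x) -deriveN//.
apply: half.
- by move=> y /cv cvy; apply: (@cvgN _ R _ (nbhs y)).
- move=> y /sv /(difflapZ (c := -1)); rewrite mulr0.
  by have -> : (fun z => -1 * v z) = - v by apply/funext => z; rewrite mulN1r.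
- by move=> y /vM; rewrite fctE normrN.
- exact: derivableN.
Qed.

Lemma is_derive_translate (f : V -> R) (x a v : V) (df : R) :
  is_derive (x + a) v f df -> is_derive x v (fun z => f (z + a)) df.
Proof.
move=> [dfx <-].
have E : (fun h : R => h^-1 *: (((fun z => f (z + a)) \o shift x) (h *: v) -
             f (x + a))) =
  (fun h => h^-1 *: ((f \o shift (x + a)) (h *: v) - f (x + a))).
  by apply/funext => h /=; rewrite addrA.
by constructor; rewrite /derivable /derive /= E.
Qed.

Lemma difflap_translate (f : V -> R) x a L :
  difflap f (x + a) L -> difflap (fun z => f (z + a)) x L.
Proof.
rewrite /difflap; have -> // : (fun t : R => \sum_(j < n) second_quotient f (x + a) j t) =
  (fun t => \sum_(j < n) second_quotient (fun z => f (z + a)) x j t).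
apply/funext => t; apply: eq_bigr => j _; rewrite /second_quotient.
by rewrite [x + a + _]addrAC [x + a - _]addrAC.
Qed.

(** Harmonic functions of class C^2 are not known to have third derivatives, so the
    gradient estimate does not apply to d_i v. It applies to the difference quotients
    of v in the direction i, which are harmonic, and bounded by the supremum of
    |d_i v| thanks to the mean value theorem; then the step tends to 0. *)
Lemma harmonic_second (v : V -> R) U x (i j : 'I_n) (r M : R) : open U ->
  0 < r -> 0 < M -> closed_cube x (2 * r) `<=` U -> Ck 2 U v ->
  (forall y, U y -> laplacian v y = 0) ->
  (forall y, closed_cube x (2 * r) y -> `|pder [:: i] v y| <= M) ->
  `|pder [:: i; j] v x| <= M / r * n.+1%:R.
Proof.
move=> oU r0 M0 xU Cv lv dM.
have Kx y : closed_cube x r y -> forall t : R, `|t| <= r -> closed_cube x (2 * r) (y + t *: e i).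
  move=> yx t tr; rewrite /closed_cube/= addrAC (le_trans (ler_normD _ _))//.
  by have := norm_delta_row t i; move: yx; rewrite /closed_cube/=; lra.
have Ux : U x by apply: xU; rewrite /closed_cube/= subrr normr0; lra.
have xx : closed_cube x r x by rewrite /closed_cube/= subrr normr0 ltW.
have Kx0 y : closed_cube x r y -> U y.
  by move=> /Kx /(_ 0); rewrite normr0 scale0r addr0 => /(_ (ltW r0)) /xU.
have D1 y : U y -> is_derive y (e i) v (pder [:: i] v y).
  by move=> Uy; apply: derivableP; exact: (Cv.2 [::]).
have Dj y : U y -> is_derive y (e j) v (pder [:: j] v y).
  by move=> Uy; apply: derivableP; exact: (Cv.2 [::]).
have Dji : is_derive x (e i) (pder [:: j] v) (pder [:: i; j] v x).
  by apply: derivableP; exact: (Cv.2 [:: j]).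
have Kt y t : closed_cube x r y -> 0 <= t <= r -> closed_cube x (2 * r) (y + t *: e i).
  by move=> /Kx + /andP[t0 tr]; apply; rewrite ger0_norm.
(* the gradient estimate for the difference quotient q of step t *)
have Dq t : 0 < t <= r ->
    `|t^-1 * (pder [:: j] v (x + t *: e i) - pder [:: j] v x)| <= M / r * n.+1%:R.
  move=> /andP[t0 tr]; have t0r : 0 <= t <= r by rewrite ltW.
  pose q : V -> R := t^-1 *: ((fun z => v (z + t *: e i)) - v).
  have Hq : is_derive x (e j) q
      (t^-1 *: (pder [:: j] v (x + t *: e i) - pder [:: j] v x)).
    apply: is_deriveZ; apply: is_deriveB; last exact: Dj.
    by apply: is_derive_translate; apply: Dj; apply: xU; exact: Kt.
  have dq : derivable q x (e j) by case: Hq.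
  have <- : pder [:: j] q x = t^-1 * (pder [:: j] v (x + t *: e i) - pder [:: j] v x).
    by rewrite /= (@derive_val _ _ _ _ _ _ _ Hq).
  apply: (harmonic_gradient r0 M0 _ _ _ dq).
  - move=> y Ky; apply: (@cvgZ _ R _ (nbhs y)); first exact: cvg_cst.
    apply: (@cvgB _ R _ (nbhs y)); last by apply: (Cv.1 [::]) => //; exact: Kx0.
    apply: (@continuous_comp _ _ _ (fun z : V => z + t *: e i) v y).
      by apply: (@cvgD _ V _ (nbhs y)); [exact: cvg_id|exact: cvg_cst].
    by apply: (Cv.1 [::]) => //; apply: xU; exact: Kt.
  - move=> y Ky; rewrite -[X in difflap _ _ X](mulr0 t^-1).
    apply: (difflapZ (F := fun z => v (z + t *: e i) - v z)).
    have slv z : U z -> difflap v z 0.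
      by move=> Uz; rewrite -(lv _ Uz); exact: (difflap_C2 oU).
    have := difflapD (difflap_translate (slv _ (xU _ (Kt _ _ Ky t0r))))
                  (difflapZ (c := -1) (slv _ (Kx0 _ Ky))).
    rewrite mulr0 addr0; have -> // : (fun z => v (z + t *: e i)) \+ (fun z => -1 * v z) =
      (fun z => v (z + t *: e i) - v z).
    by apply/funext => z /=; rewrite mulN1r.
  - move=> y Ky.
    have Hd (s : R) : 0 <= s <= t ->
      is_derive s (1 : R) (fun s => v (y + s *: e i)) (pder [:: i] v (y + s *: e i)).
      move=> /andP[s0 st]; apply: is_derive_line; apply: D1; apply: xU; apply: Kt => //.
      by rewrite s0 (le_trans st).
    have [||c cI] := MVT t0 (f := fun s => v (y + s *: e i))
      (df := fun s => pder [:: i] v (y + s *: e i)).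
    + by move=> s; rewrite in_itv/= => /andP[s0 st]; apply: Hd; rewrite !ltW.
    + apply: derivable_within_continuous => s; rewrite in_itv/= => st.
      by have [] := Hd _ st.
    move: cI; rewrite in_itv/= => /andP[c0 ct].
    rewrite scale0r addr0 subr0 => E.
    have -> : q y = pder [:: i] v (y + c *: e i).
      rewrite /q /= -[LHS]/(t^-1 * (v (y + t *: e i) - v y)) E mulrC mulfK// gt_eqF//.
    by apply: dM; apply: Kt => //; rewrite ltW//= (le_trans (ltW ct)).
pose k (s : R) := pder [:: j] v (x + s *: e i) - pder [:: j] v x.
have dk : is_derive (0 : R) (1 : R) k (pder [:: i; j] v x).
  rewrite -[X in is_derive _ _ _ X]subr0; apply: is_deriveB.
  by apply: is_derive_line; rewrite scale0r addr0.
have k0 : k 0 = 0 by rewrite /k scale0r addr0 subrr.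
have kt t : 0 <= t <= r -> `|k t| <= M / r * n.+1%:R * t.
  rewrite le_eqVlt => /andP[/orP[/eqP <-|t0] tr]; first by rewrite k0 normr0 mulr0.
  have := Dq t; rewrite t0 tr => /(_ isT).
  by rewrite normrM gtr0_norm ?invr_gt0// mulrC ler_pdivrMr.
rewrite ler_norml; apply/andP; split; last first.
  by apply: (difference_le_derive r0 dk k0) => t /kt; apply: le_trans; exact: ler_norm.
rewrite lerNl; apply: (difference_le_derive r0 (is_deriveN dk)).
  by rewrite fctE k0 oppr0.
by move=> t /kt; apply: le_trans; rewrite fctE -normrN; exact: ler_norm.
Qed.
End interior_estimates.

(** * Limits of solutions of the Poisson equation *)

Section C2_limits.
Context {R : realType} {n : nat}.
Notation V := 'rV[R]_n.
Implicit Types (x y z : V) (U : set V).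
Notation e j := (delta_mx 0 j : V).

Lemma real_cauchy_cvg (a : nat -> R) :
  (forall d : R, 0 < d -> exists N, forall m l, (N <= m)%N -> (N <= l)%N -> `|a m - a l| <= d) ->
  exists l : R, a @ \oo --> l.
Proof.
move=> Ha; suff /cauchy_cvg ca : cauchy (a @ \oo) by exists (lim (a @ \oo)); exact: ca.
apply: cauchy_exP => d d0; have [|N HN] := Ha (d / 2); first by rewrite divr_gt0.
exists (a N); exists N => // m /= Nm; rewrite /ball/=.
apply: le_lt_trans (HN _ _ (leqnn N) Nm) _.
by rewrite ltr_pdivrMr// ltr_pMr// ltr1n.
Qed.

Lemma lim_dist_le (a : nat -> R) (l b d : R) N : a @ \oo --> l ->
  (forall m, (N <= m)%N -> `|b - a m| <= d) -> `|b - l| <= d.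
Proof.
move=> al H.
have bal : (fun m => `|b - a m|) @ \oo --> `|b - l|.
  by apply: cvg_norm; apply: cvgB => //; exact: cvg_cst.
by apply: (closed_cvg (fun x : R => x <= d) (@closed_le _ d) _ _ bal); exists N.
Qed.

Lemma uniform_limit_continuous (G_ : nat -> V -> R) (G : V -> R) x r : 0 < r ->
  (forall m, {for x, continuous (G_ m)}) ->
  (forall d : R, 0 < d -> exists N, forall m y, (N <= m)%N -> closed_cube x r y ->
    `|G_ m y - G y| <= d) ->
  {for x, continuous G}.
Proof.
move=> r0 cG GG; apply/(@cvgrPdist_le _ _ _ (nbhs x)) => d d0.
have d30 : 0 < d / 3 by rewrite divr_gt0.
have [N HN] := GG _ d30.
have /cvgrPdist_le/(_ _ d30) := cG N; move=> H.
near=> y.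
have Kx : closed_cube x r x by rewrite /closed_cube/= subrr normr0 ltW.
have Ky : closed_cube x r y.
  by apply: cube_sub; near: y; exact: cube_nbhs.
have H1 := HN N x (leqnn _) Kx.
have H2 := HN N y (leqnn _) Ky.
have H3 : `|G_ N x - G_ N y| <= d / 3 by near: y; exact: H.
have -> : G x - G y = (G_ N x - G_ N y) - (G_ N x - G x) + (G_ N y - G y) by ring.
apply: le_trans (ler_normD _ _) _; apply: le_trans (lerD (ler_normB _ _) (lexx _)) _.
lra.
Unshelve. all: by end_near. Qed.

(** By the mean value theorem the difference quotients of F_ m are values of G_ m near
    x, hence close to G x uniformly in m; so are those of the limit. *)
Lemma uniform_limit_derive (F_ G_ : nat -> V -> R) (F G : V -> R) (i : 'I_n) x r :
  0 < r ->
  (forall m y, closed_cube x r y -> is_derive y (e i) (F_ m) (G_ m y)) ->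
  (forall m, {for x, continuous (G_ m)}) ->
  (forall y, closed_cube x r y -> F_ m y @[m --> \oo] --> F y) ->
  (forall d : R, 0 < d -> exists N, forall m y, (N <= m)%N -> closed_cube x r y ->
    `|G_ m y - G y| <= d) ->
  is_derive x (e i) F (G x).
Proof.
move=> r0 dF cG FF GG.
have cGx := uniform_limit_continuous r0 cG GG.
have Kx : closed_cube x r x by rewrite /closed_cube/= subrr normr0 ltW.
have Kt (t : R) : `|t| <= r -> closed_cube x r (x + t *: e i).
  by move=> tr; rewrite /closed_cube/= addrAC subrr add0r (le_trans (norm_delta_row _ _)).
suff H : h^-1 *: (F (h *: e i + x) - F x) @[h --> 0^'] --> G x.
  by constructor; [apply/cvg_ex; exists (G x)|exact: cvg_lim].
apply/cvgrPdist_le => d d0.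
have d20 : 0 < d / 2 by rewrite divr_gt0.
have [N HN] := GG _ d20.
have /(@cvgrPdist_le _ _ _ (nbhs x))/(_ _ d20) := cGx.
move=> /nbhs_ballP[r' /= r'0 Hr'].
near=> t.
have t0 : t != 0 by near: t; exact: nbhs_dnbhs_neq.
have tr : `|t| < r by near: t; apply: dnbhs0_lt.
have tr' : `|t| < r' by near: t; apply: dnbhs0_lt.
have Ht (s : R) : `|s| <= `|t| -> `|G x - G (x + s *: e i)| <= d / 2.
  move=> st; apply: Hr'; rewrite -cubeE /cube/= addrAC subrr add0r.
  by apply: le_lt_trans (norm_delta_row _ _) _; exact: le_lt_trans tr'.
suff H m : (N <= m)%N -> `|t * G x - (F_ m (x + t *: e i) - F_ m x)| <= d * `|t|.
  have lF : F_ m (x + t *: e i) - F_ m x @[m --> \oo] --> F (x + t *: e i) - F x.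
    by apply: cvgB; apply: FF => //; exact/Kt/ltW.
  have := lim_dist_le lF H.
  rewrite -ler_pdivrMr ?normr_gt0// -normfV -normrM.
  suff <- : (t * G x - (F (x + t *: e i) - F x)) / t =
      G x - t^-1 *: (F (t *: e i + x) - F x) by [].
  by rewrite [t *: e i + x]addrC -[t^-1 *: _]/(_ * _); field.
move=> Nm.
(* the sign of t decides on which interval the mean value theorem applies *)
have Hd (s : R) : `|s| <= `|t| ->
  is_derive s (1 : R) (fun s => F_ m (x + s *: e i)) (G_ m (x + s *: e i)).
  by move=> st; apply: is_derive_line; apply: dF; apply: Kt; apply: (le_trans st); exact: ltW.
have [c ct cE] : exists2 c : R, `|c| <= `|t| &
    F_ m (x + t *: e i) - F_ m x = G_ m (x + c *: e i) * t.
  have [t_lt0|t_gt0|t_eq0] := ltgtP t 0; last by rewrite t_eq0 eqxx in t0.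
  - have [||c] := MVT t_lt0 (f := fun s => F_ m (x + s *: e i))
    (df := fun s => G_ m (x + s *: e i)).
    + by move=> s; rewrite in_itv/= => /andP[ts s0]; apply: Hd; rewrite !ltr0_norm// lerN2 ltW.
    + apply: derivable_within_continuous => s; rewrite in_itv/= => /andP[ts s0].
      by have [] // := Hd s _; rewrite (ltr0_norm t_lt0) ler0_norm// lerN2.
    rewrite in_itv/= => /andP[tc c0] E; exists c.
      by rewrite !ltr0_norm// lerN2 ltW.
    by move: E; rewrite scale0r addr0 sub0r => E; rewrite -[LHS]opprB E; ring.
  - have [||c] := MVT t_gt0 (f := fun s => F_ m (x + s *: e i))
    (df := fun s => G_ m (x + s *: e i)).
    + by move=> s; rewrite in_itv/= => /andP[s0 st]; apply: Hd; rewrite !gtr0_norm// ltW.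
    + apply: derivable_within_continuous => s; rewrite in_itv/= => /andP[s0 st].
      by have [] // := Hd s _; rewrite (gtr0_norm t_gt0) ger0_norm.
    rewrite in_itv/= => /andP[c0 ct] E; exists c.
      by rewrite !gtr0_norm// ltW.
    by move: E; rewrite scale0r addr0 subr0.
rewrite cE mulrC -mulrBl normrM ler_wpM2r//.
have H1 := HN m (x + c *: e i) Nm (Kt _ (le_trans ct (ltW tr))).
have H2 := Ht _ ct.
have -> : G x - G_ m (x + c *: e i) =
  (G x - G (x + c *: e i)) - (G_ m (x + c *: e i) - G (x + c *: e i)) by ring.
apply: le_trans (ler_normB _ _) _; lra.
Unshelve. all: by end_near. Qed.

(** The differences u_ m - u_ l are harmonic and their first derivatives are uniformly
    small; by the interior estimate their second derivatives are locally uniformly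
    small. So the second derivatives converge locally uniformly, and their limits are
    the second derivatives of u0. *)
Lemma poisson_C2_limit U (u_ : nat -> V -> R) (u0 f : V -> R) (M : nat) : open U ->
  (forall m, Ck 2 U (u_ m)) -> Ck 1 U u0 ->
  (forall i (d : R), 0 < d -> exists N, forall m y, (N <= m)%N -> U y ->
     `|pder [:: i] (u_ m) y - pder [:: i] u0 y| <= d) ->
  (forall m y, (M <= m)%N -> U y -> laplacian (u_ m) y = f y) ->
  Ck 2 U u0 /\ forall y, U y -> laplacian u0 y = f y.
Proof.
move=> oU Cu Cu0 uu0 lu.
have loc_cauchy x : U x -> exists2 r, 0 < r & closed_cube x r `<=` U /\
    forall i j (d : R), 0 < d -> exists N, forall m l y, (N <= m)%N -> (N <= l)%N ->
      closed_cube x r y -> `|pder [:: i; j] (u_ m) y - pder [:: i; j] (u_ l) y| <= d.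
  move=> Ux; have [r [r0 rU]] := open_closed_cube oU Ux.
  have r30 : 0 < r / 3 by rewrite divr_gt0.
  exists (r / 3) => //.
  have sub y : closed_cube x (r / 3) y -> closed_cube y (2 * (r / 3)) `<=` U.
    move=> yx z zy; apply: rU; rewrite /closed_cube/= -[z](subrK y) -addrA.
    by apply: le_trans (ler_normD _ _) _; move: yx zy; rewrite /closed_cube/=; lra.
  split=> [y|i j d d0].
    by move=> yx; apply: (sub _ yx); rewrite /closed_cube/= subrr normr0; lra.
  pose C : R := n.+1%:R / (r / 3).
  have C0 : 0 < C by rewrite divr_gt0// ltr0n.
  have dC0 : 0 < d / C / 2 by rewrite !divr_gt0.
  have [N HN] := uu0 i _ dC0.
  exists (maxn M N) => m l y; rewrite !geq_max => /andP[Mm Nm] /andP[Ml Nl] yx.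
  have Uy : U y by apply: (sub _ yx); rewrite /closed_cube/= subrr normr0; lra.
  rewrite -(pderB (s := [:: i; j]) oU (Cu m) (Cu l))//.
  have -> : d = d / C / (r / 3) * n.+1%:R.
    by rewrite /C; field; rewrite !lt0r_neq0//= ?ltr0n// divr_gt0.
  apply: (@harmonic_second R n (u_ m \- u_ l) U y i j (r / 3) (d / C) oU r30 (divr_gt0 d0 C0)
    (sub _ yx)).
  - exact: CkB.
  - move=> z Uz; rewrite (laplacianB oU (Cu m) (Cu l))//.
    by rewrite !lu// subrr.
  - move=> z /(sub _ yx) Uz; rewrite (pderB oU (Cu m) (Cu l))//.
    have := HN _ _ Nm Uz; have := HN _ _ Nl Uz; rewrite !ler_norml.
    by move=> /andP[? ?] /andP[? ?]; apply/andP; split; lra.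
(* pointwise limits of the second derivatives; the convergence is locally
   uniform by GU below *)
pose G i j y := lim (pder [:: i; j] (u_ m) y @[m --> \oo]).
have GP i j y : U y -> pder [:: i; j] (u_ m) y @[m --> \oo] --> G i j y.
  move=> Uy; have [r r0 [rU H]] := loc_cauchy _ Uy.
  suff [l Hl] : exists l : R, pder [:: i; j] (u_ m) y @[m --> \oo] --> l.
    by rewrite /G (cvg_lim _ Hl).
  apply: real_cauchy_cvg => d d0; have [N HN] := H i j d d0.
  by exists N => m l Nm Nl; apply: HN => //; rewrite /closed_cube/= subrr normr0 ltW.
have GU x : U x -> exists2 r, 0 < r & closed_cube x r `<=` U /\
    forall i j (d : R), 0 < d -> exists N, forall m y, (N <= m)%N ->
      closed_cube x r y -> `|pder [:: i; j] (u_ m) y - G i j y| <= d.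
  move=> Ux; have [r r0 [rU H]] := loc_cauchy _ Ux.
  exists r => //; split=> // i j d d0; have [N HN] := H i j d d0.
  exists N => m y Nm yx; apply: (lim_dist_le (N := N) (GP i j y (rU _ yx))) => l Nl.
  exact: HN.
have Gder i j x : U x -> is_derive x (e i) (pder [:: j] u0) (G i j x).
  move=> Ux; have [r r0 [rU H]] := GU _ Ux.
  apply: (uniform_limit_derive (F_ := fun m => pder [:: j] (u_ m))
    (G_ := fun m => pder [:: i; j] (u_ m)) r0).
  - by move=> m y yx; apply: derivableP; apply: ((Cu m).2 [:: j]) => //; exact: rU.
  - by move=> m; exact: ((Cu m).1 [:: i; j]).
  - move=> y yx; apply/cvgrPdist_le => d d0; have [N HN] := uu0 j d d0.
    by exists N => // m Nm; rewrite distrC; apply: HN => //; exact: rU.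
  - exact: H.
have GE i j : {in U, pder [:: i; j] u0 =1 G i j}.
  by move=> x; rewrite inE => Ux; have [_] := Gder i j x Ux.
split.
  have cG i j x : U x -> {for x, continuous (G i j)}.
    move=> Ux; have [r r0 [rU H]] := GU _ Ux.
    by apply: (uniform_limit_continuous r0 _ (H i j)) => m; exact: ((Cu m).1 [:: i; j]).
  have [c0 d0 _] := (CkSP 0 U u0).1 Cu0.
  apply/CkSP; split; [exact: c0|exact: d0|move=> j].
  apply/CkSP; split => [x Ux|i x Ux|i].
  - exact: (Cu0.1 [:: j]).
  - by case: (Gder i j x Ux).
  - apply/Ck0P => x Ux.
    by apply: (eq_on_open_continuous oU _ Ux (cG i j x Ux)) => y Uy; rewrite [RHS]GE.
move=> y Uy.
have H : laplacian (u_ m) y @[m --> \oo] --> laplacian u0 y.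
  by apply: cvg_sumr => i; rewrite GE ?inE//; exact: GP.
have H' : laplacian (u_ m) y @[m --> \oo] --> f y.
  apply: cvg_near_cst; by exists M => // m Mm; exact: lu.
exact: (cvg_unique _ H H').
Qed.

End C2_limits.

(** * Translation invariance and local null sets *)

Section image_measure.
Context {R : realType} d1 d2 (T1 : measurableType d1) (T2 : measurableType d2).
Context (m : {measure set T1 -> \bar R}) (f : T1 -> T2).
Context (mf : measurable_fun [set: T1] f).

(** The measurability of f is an argument, so that the measure structure below can be
    found from the term alone. *)
Definition image_measure of measurable_fun [set: T1] f : set T2 -> \bar R :=
  pushforward m f.

HB.instance Definition _ := isMeasure.Build _ _ _ (image_measure mf)
  (pushforward0 _ _) (pushforward_ge0 _ _) (pushforward_sigma_additive mf).

End image_measure.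

Section translation_invariance.
Context {R : realType}.
Notation mR := (measurableTypeR R).

(** The Lebesgue measure is determined by its values on intervals. *)
Lemma lebesgue_measure_shift (a : R) (A : set mR) : measurable A ->
  lebesgue_measure ((fun x => a + x) @^-1` A) = lebesgue_measure A.
Proof.
move=> mA.
have ma : measurable_fun [set: mR] ((fun x => a + x) : mR -> mR).
  by apply: measurable_funD => //; exact: measurable_cst.
pose nu : {measure set mR -> \bar R} :=
  image_measure (@lebesgue_measure R) ma.
rewrite -[LHS]/(nu A); apply/esym/lebesgue_measure_unique => //= _ [[b c]] _ <-.
rewrite /nu /pushforward /=.
have -> : (fun x => a + x) @^-1` [set` `]b, c] ] = [set` `]b - a, c - a] ].
  by apply/seteqP; split => x /=; rewrite !in_itv/= ltrBlDl lerBrDl.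
rewrite !lebesgue_measure_itv/= !lte_fin ltrD2r; case: ifP => // _.
by rewrite -!EFinB; congr EFin; ring.
Qed.

Definition shift_tuple n (a t : n.-tuple mR) : n.-tuple mR :=
  [tuple tnth a i + tnth t i | i < n].

Lemma measurable_shift_tuple n (a : n.-tuple mR) :
  measurable_fun [set: n.-tuple mR] (shift_tuple a).
Proof.
apply/measurable_fun_tnthP => i; rewrite /comp.
under eq_fun do rewrite tnth_mktuple.
by apply: measurable_funD; [exact: measurable_cst|exact: measurable_tnth].
Qed.

(** Induction on the dimension: the translated measure takes the right values on
    rectangles, and the product measure is unique. *)
Lemma power_measure_shift n (a : n.-tuple mR) (A : set (n.-tuple mR)) :
  measurable A ->
  power_measure (@lebesgue_measure R) n (shift_tuple a @^-1` A) =
  power_measure (@lebesgue_measure R) n A.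
Proof.
elim: n a A => [|n IH] a A mA.
  have E t : shift_tuple a t = t by rewrite [RHS]tuple0 [LHS]tuple0.
  by rewrite (_ : shift_tuple a @^-1` A = A)//; apply/seteqP; split=> t /=; rewrite E.
pose a0 := thead a; pose a' : n.-tuple mR := [tuple of behead a].
pose S (p : mR * n.-tuple mR) : mR * n.-tuple mR := (a0 + p.1, shift_tuple a' p.2).
have mS : measurable_fun [set: mR * n.-tuple mR] S.
  apply/measurable_fun_pairP; split.
    by apply: measurable_funD; [exact: measurable_cst|exact: measurable_fst].
  by apply: (measurableT_comp (measurable_shift_tuple a')); exact: measurable_snd.
have SE p : shift_tuple a (tcons p) = tcons (S p).
  apply/eq_from_tnth => i; rewrite tnth_mktuple.
  have aE : a = tcons (a0, a') by apply: val_inj; rewrite [in LHS](tuple_eta a).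
  rewrite [in LHS]aE.
  case: (unliftP ord0 i) => [j|] ->; last by rewrite !tnth0.
  rewrite /tcons /S /=.
  have E (x : mR) (t : n.-tuple mR) : tnth [tuple of x :: t] (lift ord0 j) = tnth t j.
    by rewrite !(tnth_nth point).
  by rewrite !E tnth_mktuple.
pose m := @lebesgue_measure R.
pose mu : {sigma_finite_measure set (n.-tuple mR) -> \bar R} := power_measure m n.
pose nu : {measure set (mR * n.-tuple mR) -> \bar R} := image_measure (m \x mu)%E mS.
have mB : measurable (@tcons _ mR n @^-1` A).
  by rewrite -[X in measurable X]setTI; exact: measurable_tcons.
rewrite /= -[LHS]/((m \x mu)%E (@tcons _ mR n @^-1` (shift_tuple a @^-1` A))).
have -> : @tcons _ mR n @^-1` (shift_tuple a @^-1` A) = S @^-1` (@tcons _ mR n @^-1` A).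
  by apply/seteqP; split => p /=; rewrite SE.
rewrite -[LHS]/(nu (@tcons _ mR n @^-1` A)); apply/esym.
apply: product_measure_unique => // B C mB' mC.
rewrite -[LHS]/((m \x mu)%E (S @^-1` (B `*` C))).
have -> : S @^-1` (B `*` C) = ((fun x => a0 + x) @^-1` B) `*` (shift_tuple a' @^-1` C).
  by [].
rewrite product_measure1E.
- by congr (_ * _)%E; [exact: lebesgue_measure_shift|exact: IH].
- have ma : measurable_fun [set: mR] ((fun x => a0 + x) : mR -> mR).
    by apply: measurable_funD => //; exact: measurable_cst.
  by rewrite -[X in measurable X]setTI; exact: ma.
- by rewrite -[X in measurable X]setTI; exact: measurable_shift_tuple.
Qed.

Context {n : nat}.
Notation V := 'rV[R]_n.
Notation mu := (@lebesgue_row R n).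

Lemma measurable_coord (i : 'I_n) : measurable_fun [set: V] ((fun x : V => x 0 i) : V -> mR).
Proof.
have -> : (fun x : V => x 0 i : mR) = (fun x => tnth (tuple_of_row x) i).
  by apply/funext => x; rewrite tnth_mktuple.
by apply: (measurableT_comp (measurable_tnth i)); exact: measurable_tuple_of_row.
Qed.

Lemma measurable_row_shift (a : V) : measurable_fun [set: V] (fun x : V => x + a).
Proof.
have -> : (fun x : V => x + a) = row_of_tuple \o shift_tuple (tuple_of_row a) \o tuple_of_row.
  apply/funext => x; apply/rowP => i.
  by rewrite !mxE /= tnth_mktuple !tnth_mktuple addrC.
apply: measurableT_comp; last exact: measurable_tuple_of_row.
by apply: measurableT_comp; [exact: measurable_row_of_tuple|exact: measurable_shift_tuple].
Qed.

Lemma lebesgue_row_shift (a : V) (A : set V) : measurable A ->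
  mu ((fun x => x + a) @^-1` A) = mu A.
Proof.
move=> mA; rewrite /lebesgue_row /pushforward.
have mB : measurable (@row_of_tuple R n @^-1` A).
  by rewrite -[X in measurable X]setTI; exact: measurable_row_of_tuple.
rewrite -[RHS](power_measure_shift (tuple_of_row a) mB); congr (power_measure _ _ _).
apply/seteqP; split=> t /=.
  have -> // : row_of_tuple (shift_tuple (tuple_of_row a) t) = row_of_tuple t + a.
  by apply/rowP => i; rewrite !mxE !tnth_mktuple addrC.
have -> // : row_of_tuple (shift_tuple (tuple_of_row a) t) = row_of_tuple t + a.
by apply/rowP => i; rewrite !mxE !tnth_mktuple addrC.
Qed.

End translation_invariance.

Section cubes_measure.
Context {R : realType} {n : nat}.
Notation V := 'rV[R]_n.
Notation mu := (@lebesgue_row R n).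
Notation mR := (measurableTypeR R).
Implicit Types (x y : V) (A U K : set V).

Lemma cubeP x r y : 0 < r -> (cube x r y <-> forall i, `|y 0 i - x 0 i| < r).
Proof.
move=> r0; rewrite /cube /= (row_normP _ r0).
by split=> H i; have := H i; rewrite !mxE.
Qed.

Lemma measurable_cube x r : measurable (cube x r).
Proof.
have [r0|r0] := ltP 0 r; last first.
  rewrite (_ : cube x r = set0) ?measurable0//.
  by apply/seteqP; split => // y /= /(le_lt_trans (normr_ge0 _)); rewrite ltNge r0.
rewrite (_ : cube x r = \bigcap_(i in [set: 'I_n])
    ((fun y : V => y 0 i : mR) @^-1` [set t | `|t - x 0 i| < r])).
  apply: fin_bigcap_measurable => [|i _]; first exact: finite_finset.
  rewrite -[X in measurable X]setTI; apply: measurable_coord => //.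
  rewrite (_ : [set t | `|t - x 0 i| < r] = ball (x 0 i) r).
    exact: measurable_ball.
  by apply/seteqP; split => t; rewrite /ball/= distrC.
apply/seteqP; split => y.
  by move=> /(cubeP _ _ r0) H i _; exact: H.
by move=> H; apply/(cubeP _ _ r0) => i; exact: H.
Qed.

Definition rational_cube (c : 'rV[rat]_n * nat) : set V := cube (map_mx ratr c.1) c.2.+1%:R^-1.

Lemma rational_cube_basis x r : 0 < r -> exists2 c, rational_cube c x &
  rational_cube c `<=` cube x r.
Proof.
move=> r0; have r20 : 0 < r / 2 by rewrite divr_gt0.
have [k /= kr] : exists k, k.+1%:R^-1 < r / 2 :> R.
  have [k _ Hk] := near_infty_natSinv_lt (PosNum r20).
  by exists k; exact: Hk k (leqnn k).
have k0 : 0 < k.+1%:R^-1 :> R by rewrite invr_gt0 ltr0n.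
have /choice[q Hq] : forall i : 'I_n, exists q : rat, `|x 0 i - ratr q| < k.+1%:R^-1.
  move=> i; have : x 0 i - k.+1%:R^-1 < x 0 i + k.+1%:R^-1.
    by rewrite ltrBlDr -addrA ltrDl addr_gt0.
  move=> /rat_in_itvoo[q]; rewrite in_itv/= => /andP[q1 q2]; exists q.
  by rewrite ltr_distlC q1 q2.
have xc : cube (map_mx ratr (\row_i q i)) k.+1%:R^-1 x.
  by apply/(cubeP _ _ k0) => i; rewrite !mxE.
exists (\row_i q i, k) => //.
move=> y; move: xc; rewrite /rational_cube /cube/= => xc yc.
rewrite -[y](subrK (map_mx ratr (\row_i q i))) -addrA.
apply: le_lt_trans (ler_normD _ _) _; rewrite [X in _ + X]distrC [ltRHS]splitr.
by apply: ltrD; apply: lt_trans kr.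
Qed.

(** Rational cubes form a countable base, and measurability here refers to the
    sigma-algebra generated by the coordinates. *)
Lemma measurable_open U : open U -> measurable U.
Proof.
move=> oU; pose F k : set V := if unpickle k is Some c then
  (if `[< rational_cube c `<=` U >] then rational_cube c else set0) else set0.
rewrite (_ : U = \bigcup_k F k).
  apply: bigcupT_measurable => k; rewrite /F; case: unpickle => [c|]; last exact: measurable0.
  by case: ifP => _; [exact: measurable_cube|exact: measurable0].
apply/seteqP; split=> x.
  move=> Ux; have [r [r0 rU]] := open_closed_cube oU Ux.
  have [c cx cr] := rational_cube_basis x r0.
  exists (pickle c) => //; rewrite /F pickleK; case: ifPn => // /asboolPn; case.
  by move=> y /cr /cube_sub /rU.
move=> [k _]; rewrite /F; case: unpickle => // c.
by case: ifPn => // /asboolP; apply.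
Qed.

(** Countably many rational cubes cover A and meet it in null sets. *)
Lemma negligible_local A :
  (forall x, A x -> exists2 r, 0 < r & mu.-negligible (A `&` cube x r)) ->
  mu.-negligible A.
Proof.
move=> HA; pose F k : set V := if unpickle k is Some c then
  (if `[< mu.-negligible (A `&` rational_cube c) >] then A `&` rational_cube c else set0) else
    set0.
apply: (@negligibleS _ _ _ _ (\bigcup_k F k)); last first.
  apply: negligible_bigcup => k; rewrite /F; case: unpickle => [c|]; last exact: negligible_set0.
  by case: ifPn => [/asboolP|_] //; exact: negligible_set0.
move=> x Ax; have [r r0 Nr] := HA _ Ax.
have [c cx cr] := rational_cube_basis x r0.
exists (pickle c) => //; rewrite /F pickleK; case: ifPn => // /asboolPn; case.
by apply: negligibleS Nr => y [Ay /cr].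
Qed.

Lemma measurable_compact K : compact K -> measurable K.
Proof.
move=> cK; have clK : closed K by apply: compact_closed => //; exact: norm_hausdorff.
rewrite -[K]setCK; apply: measurableC; apply: measurable_open.
exact: closed_openC.
Qed.

Lemma measurable_fun_continuous_on U (f : V -> R) : open U ->
  (forall x, U x -> {for x, continuous f}) -> measurable_fun U f.
Proof.
move=> oU cf; apply: (measurability _ (RGenOpens.measurableE R)) => //.
move=> _ [B [a [b EB]] <-].
have oB : open B by rewrite EB; exact: interval_open.
suff oUB : open (U `&` f @^-1` B) by exact: measurable_open oUB.
rewrite openE => x [Ux Bx].
have fB : nbhs (x : V) (f @^-1` B) by apply: cf => //; exact: open_nbhs_nbhs.
exact: (filterI (open_nbhs_nbhs (conj oU Ux)) fB).
Qed.

Lemma lebesgue_cube_fin x r : (mu (cube x r) < +oo)%E.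
Proof.
pose B := [set t : n.-tuple mR | forall i, `|tnth t i - x 0 i| < r].
have [r0|r0] := ltP 0 r; last first.
  rewrite (_ : cube x r = set0) ?measure0//.
  by apply/seteqP; split => // y /= /(le_lt_trans (normr_ge0 _)); rewrite ltNge r0.
rewrite /lebesgue_row /pushforward.
have -> : @row_of_tuple R n @^-1` cube x r = B.
  apply/seteqP; split=> t /=; first by move=> /(cubeP _ _ r0) H i; have := H i; rewrite mxE.
  by move=> H; apply/(cubeP _ _ r0) => i; rewrite mxE.
pose c := tuple_of_row x.
have -> : B = [set t | forall i, `|tnth t i - tnth c i| < r].
  by apply/seteqP; split=> t H i; have := H i; rewrite /c tnth_mktuple.
move: c => {x B}; elim: n => [|k IH] c.
  by rewrite /= /power0 diracE; apply: ltry.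
rewrite /= /power_step /pushforward.
set mk : {sigma_finite_measure set (k.-tuple mR) -> \bar R} := power_measure _ k.
pose C := [set t : k.-tuple mR | forall i, `|tnth t i - tnth [tuple of behead c] i| < r].
have mB1 : measurable (ball (thead c) r : set mR) by exact: measurable_ball.
have mC : measurable C.
  rewrite (_ : C = \bigcap_(i in [set: 'I_k]) ((fun t : k.-tuple mR => tnth t i) @^-1`
      ball (tnth [tuple of behead c] i) r)).
    apply: fin_bigcap_measurable => [|i _]; first exact: finite_finset.
    by rewrite -[X in measurable X]setTI; apply: measurable_tnth => //; exact: measurable_ball.
  apply/seteqP; split=> t H i; first by move=> _; rewrite /ball/= distrC; exact: H.
  by have := H i I; rewrite /ball/= distrC.
have tnthS (x : mR) (t : k.-tuple mR) j : tnth [tuple of x :: t] (lift ord0 j) = tnth t j.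
  by rewrite !(tnth_nth point).
have cS j : tnth c (lift ord0 j) = tnth [tuple of behead c] j.
  by rewrite [in LHS](tuple_eta c) tnthS.
have -> : @tcons _ mR k @^-1` [set t | forall i, `|tnth t i - tnth c i| < r] =
  ball (thead c) r `*` C.
  apply/seteqP; split => -[y t] /=.
    move=> H; split => /=; first by have := H ord0; rewrite /ball/= distrC !tnth0.
    by move=> i; have := H (lift ord0 i); rewrite cS /tcons tnthS.
  move=> [/= yc H] i; case: (unliftP ord0 i) => [j|] ->; last by rewrite tnth0 distrC.
  by rewrite cS /tcons tnthS; exact: H.
rewrite product_measure1E//.
apply: lte_mul_pinfty => //.
  have := @lebesgue_measure_ball R (thead c) r (ltW r0).
  by move=> E; rewrite [X in X \is a fin_num]E.
exact: IH.
Qed.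

End cubes_measure.

(** * Integrals of compactly supported functions *)

Section integration.
Context {R : realType} {n : nat}.
Notation V := 'rV[R]_n.
Notation mu := (@lebesgue_row R n).
Notation e j := (delta_mx 0 j : V).
Implicit Types (x y : V) (U K Om : set V) (f g h u : V -> R).

Lemma compact_sub_closed_cube K : compact K -> exists2 r, 0 < r & K `<=` closed_cube 0 r.
Proof.
move=> /compact_bounded [M [_ HM]]; exists (`|M| + 1); first by rewrite ltr_wpDl.
move=> x Kx; rewrite /closed_cube/= subr0; apply: HM => //.
by rewrite (le_lt_trans (ler_norm M))// ltrDl.
Qed.

Lemma lebesgue_compact_fin K : compact K -> (mu K < +oo)%E.
Proof.
move=> cK; have [r r0 Kr] := compact_sub_closed_cube cK.
apply: le_lt_trans (lebesgue_cube_fin (0 : V) (r + 1)).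
apply: le_measure; rewrite ?inE; first exact: measurable_compact.
  exact: measurable_cube.
by move=> x /Kr; rewrite /cube /closed_cube/= => /le_lt_trans; apply; rewrite ltrDl.
Qed.

Lemma compact_norm_bound K f : compact K -> (forall x, K x -> {for x, continuous f}) ->
  exists2 M, 0 < M & forall x, K x -> `|f x| <= M.
Proof.
move=> cK cf; have [K0|nK0] := pselect (K !=set0); last first.
  by exists 1 => // x Kx; case: nK0; exists x.
have cnf x : K x -> {for x, continuous (fun y => - `|f y|)}.
  by move=> /cf cx; apply: (@cvgN _ R _ (nbhs (x : V))); apply: (@cvg_norm _ _ _ (nbhs (x : V))).
have [c _ Hc] := compact_min cK K0 cnf.
exists (`|f c| + 1); first by rewrite ltr_wpDl.
by move=> x /Hc; lra.
Qed.

Lemma integrable_compact U K f : open U -> compact K -> K `<=` U ->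
  (forall x, U x -> {for x, continuous f}) -> mu.-integrable K (EFin \o f).
Proof.
move=> oU cK KU cf; apply: measurable_bounded_integrable.
- exact: measurable_compact.
- exact: lebesgue_compact_fin.
- apply: (measurable_funS (measurable_open oU) KU).
  exact: measurable_fun_continuous_on.
- have [M M0 HM] := compact_norm_bound cK (fun x Kx => cf x (KU x Kx)).
  by exists M; split; [exact: num_real|move=> N MN x /= /HM Hx; apply: (le_trans Hx); exact: ltW].
Qed.

Lemma integrable_support U K f : open U -> compact K -> K `<=` U ->
  (forall x, U x -> {for x, continuous f}) -> (forall x, ~ K x -> f x = 0) ->
  mu.-integrable [set: V] (EFin \o f).
Proof.
move=> oU cK KU cf f0.
have -> : EFin \o f = (EFin \o f) \_ K.
  apply/funext => x; rewrite patchE; case: ifPn => // xK.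
  by rewrite /= f0// => Kx; rewrite (mem_set Kx) in xK.
apply/(integrable_mkcond _ (measurable_compact cK)).
exact: integrable_compact oU cK KU cf.
Qed.

Lemma Rintegral_support (D K : set V) f : K `<=` D -> (forall x, ~ K x -> f x = 0) ->
  \int[mu]_(x in D) f x = \int[mu]_x f x.
Proof.
move=> KD f0; rewrite Rintegral_mkcond; congr (Rintegral _ _ _).
apply/funext => x; rewrite patchE; case: ifPn => // xD.
by rewrite f0// => /KD Dx; rewrite (mem_set Dx) in xD.
Qed.

(** Change of variables for the image of the measure under the translation, which is
    the measure itself. *)
Lemma Rintegral_shift h (p a : V) r : (forall x, {for x, continuous h}) ->
  (forall x, ~ closed_cube p r x -> h x = 0) ->
  \int[mu]_x h (x + a) = \int[mu]_x h x.
Proof.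
move=> ch h0.
have mh : measurable_fun [set: V] h by apply: measurable_fun_continuous_on => //; exact: openT.
rewrite /Rintegral; congr fine.
have csh : mu.-integrable [set: V] (EFin \o (fun x => h (x + a))).
  apply: (@integrable_support setT (closed_cube (p - a) r)) => //.
  - exact: openT.
  - exact: compact_closed_cube.
  - move=> x _; apply: (@continuous_comp _ _ _ (fun z : V => z + a) h x).
      by apply: (@cvgD _ V _ (nbhs x)); [exact: cvg_id|exact: cvg_cst].
    exact: ch.
  - move=> x nx; apply: h0 => hx; apply: nx; move: hx; rewrite /closed_cube/=.
    by rewrite opprB addrA.
have := @integral_pushforward _ _ V V R (fun x => x + a) (measurable_row_shift a) mu setT
  (EFin \o h).
rewrite preimage_setT => <- //; last first.
  exact/measurable_EFinP.
rewrite -[in LHS]/(image_measure mu (measurable_row_shift a)).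
apply: eq_measure_integral => A mA _; exact: lebesgue_row_shift.
Qed.

End integration.

(** * Integration by parts *)

Section integration_by_parts.
Context {R : realType} {n : nat}.
Notation V := 'rV[R]_n.
Notation mu := (@lebesgue_row R n).
Notation e j := (delta_mx 0 j : V).
Implicit Types (x y : V) (U K Om : set V) (f g h u phi : V -> R).

Lemma MVT_coordinate (G : V -> R) (i : 'I_n) x (t : R) : 0 < t ->
  (forall y, derivable G y (e i)) ->
  exists c : R, G (x + t *: e i) - G x = pder [:: i] G (x + c *: e i) * t.
Proof.
move=> t0 dG.
have Hd (s : R) : is_derive s (1 : R) (fun s => G (x + s *: e i)) (pder [:: i] G (x + s *: e i)).
  by apply: is_derive_line; exact: derivableP.
have [|c _] := MVT t0 (f := fun s => G (x + s *: e i))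
  (df := fun s => pder [:: i] G (x + s *: e i)).
  by apply: derivable_within_continuous => s _; have [] := Hd s.
by rewrite scale0r addr0 subr0 => E; exists c.
Qed.

Lemma derive_zero_off K (G : V -> R) (v : V) : compact K -> (forall x, ~ K x -> G x = 0) ->
  forall x, ~ K x -> 'D_v G x = 0 :> R.
Proof.
move=> cK G0 x Kx.
have oC : open (~` K).
  by apply: closed_openC; apply: compact_closed => //; exact: norm_hausdorff.
rewrite (@eq_on_open_derive _ _ (~` K) G (fun=> 0) x v oC) ?derive_cst//.
by move=> y; rewrite inE => /G0.
Qed.

(** By translation invariance the difference quotients of G have integral 0. They are
    bounded by sup |d_i G| and vanish off one compact set as long as the step is at
    most 1, so that dominated convergence applies. *)
Lemma Rintegral_partial0 K (G : V -> R) (i : 'I_n) : compact K ->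
  (forall x, {for x, continuous G}) -> (forall x, derivable G x (e i)) ->
  (forall x, {for x, continuous (pder [:: i] G)}) ->
  (forall x, ~ K x -> G x = 0) ->
  \int[mu]_x pder [:: i] G x = 0.
Proof.
move=> cK cG dG cdG G0.
have [r r0 Kr] := compact_sub_closed_cube cK.
set dg := pder [:: i] G in cdG *.
have dg0 x : ~ K x -> dg x = 0 by exact: derive_zero_off.
have [M M0 HM] := compact_norm_bound cK (fun x _ => cdG x).
have {}HM x : `|dg x| <= M.
  by have [/HM//|/dg0 ->] := pselect (K x); rewrite normr0 ltW.
pose B : set V := closed_cube 0 (r + 1).
have cB : compact B by exact: compact_closed_cube.
have mB := measurable_compact cB.
have KB : K `<=` B by move=> x /Kr; rewrite /B /closed_cube/= => /le_trans; apply; rewrite lerDl.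
pose t_ k : R := k.+1%:R^-1.
have t0 k : 0 < t_ k by rewrite invr_gt0 ltr0n.
have t1 k : t_ k <= 1 by rewrite invf_le1 ?ltr0n// ler1n.
pose Q k x := (t_ k)^-1 * (G (x + t_ k *: e i) - G x).
have cGs k x : {for x, continuous (fun z : V => G (z + t_ k *: e i))}.
  apply: (@continuous_comp _ _ _ (fun z : V => z + t_ k *: e i) G x); last exact: cG.
  by apply: (@cvgD _ V _ (nbhs x)); [exact: cvg_id|exact: cvg_cst].
have cQ k x : {for x, continuous (Q k)}.
  apply: (@cvgM _ _ (nbhs x)); first exact: cvg_cst.
  by apply: (@cvgB _ R _ (nbhs x)); [exact: cGs|exact: cG].
have Gs0 k x : ~ B x -> G (x + t_ k *: e i) = 0.
  move=> nB; apply: G0 => /Kr; rewrite /closed_cube/= subr0 => H; apply: nB.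
  rewrite /B /closed_cube/= subr0 -[x](addrK (t_ k *: e i)).
  apply: le_trans (ler_normB _ _) _; apply: lerD => //.
  by apply: le_trans (norm_delta_row _ _) _; rewrite gtr0_norm.
have Q0 k x : ~ B x -> Q k x = 0.
  by move=> nB; rewrite /Q Gs0// G0 ?subrr ?mulr0// => /KB.
have iG : mu.-integrable [set: V] (EFin \o G).
  by apply: (@integrable_support R n setT K) => //; exact: openT.
have iGs k : mu.-integrable [set: V] (EFin \o (fun z : V => G (z + t_ k *: e i))).
  by apply: (@integrable_support R n setT B) => //; [exact: openT|exact: Gs0].
have intQ k : \int[mu]_x Q k x = 0.
  rewrite /Q RintegralZl//; last first.
    apply: (@integrable_support R n setT B) => //; first exact: openT.
      by move=> x _; apply: (@cvgB _ R _ (nbhs x)); [exact: cGs|exact: cG].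
    by move=> x nB; rewrite Gs0// G0 ?subrr// => /KB.
  rewrite RintegralB// (@Rintegral_shift _ _ G 0 _ r) ?subrr ?mulr0//.
  by move=> x nx; apply: G0 => /Kr.
have iQB k : mu.-integrable B (EFin \o Q k).
  by apply: (@integrable_compact R n setT) => //; exact: openT.
have intQB k : (\int[mu]_(x in B) (Q k x)%:E = 0)%E.
  rewrite -[LHS]fineK; last exact: (integrable_fin_num mB (iQB k)).
  by congr EFin; rewrite -[LHS]/(\int[mu]_(x in B) Q k x)
    (Rintegral_support (@subset_refl _ B) (Q0 k)).
have Qcvg x : (fun k => Q k x) @ \oo --> dg x.
  have := dG x; rewrite /derivable => dGx.
  have /cvgrPdist_lt H : (fun h : R => h^-1 *: ((G \o shift x) (h *: e i) - G x)) @ 0^' --> dg x.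
    exact: dGx.
  apply/cvgrPdist_lt => d /H; rewrite near_withinE => -[a /= a0 Ha].
  have [N _ HN] := near_infty_natSinv_lt (PosNum a0).
  exists N => // k /= Nk.
  have := Ha (t_ k); rewrite /= sub0r normrN gtr0_norm// => /(_ (HN k Nk)).
  rewrite gt_eqF// => /(_ isT).
  by rewrite /Q [t_ k *: _ + x]addrC.
have DC : (fun k => \int[mu]_(x in B) (Q k x)%:E)%E @ \oo --> (\int[mu]_(x in B) (dg x)%:E)%E.
  apply: (@dominated_cvg _ _ _ mu B mB _ _ (cst M%:E)).
  - by move=> k; apply: measurable_int (iQB k).
  - by move=> x _; apply: cvg_EFin; [exact: nearW|exact: Qcvg].
  - by [].
  - apply: (@integrable_compact R n setT _ (cst M)) => //; first exact: openT.
    by move=> x _; exact: cst_continuous.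
  - move=> k x _; rewrite /= lee_fin /Q.
    have [c ->] := MVT_coordinate x (t0 k) dG.
    by rewrite mulrC mulfK ?gt_eqF//; exact: HM.
have E0 : (\int[mu]_(x in B) (dg x)%:E = 0)%E.
  have : (fun k => \int[mu]_(x in B) (Q k x)%:E)%E @ \oo --> (0%R : \bar R).
    by under eq_fun do rewrite intQB; exact: cvg_cst.
  by move/(cvg_unique _ DC); apply.
rewrite -(Rintegral_support (K := K) (D := B))//.
by rewrite /Rintegral E0.
Qed.

Lemma continuous_support Om K h : compact K -> K `<=` Om ->
  (forall x, Om x -> {for x, continuous h}) -> (forall x, ~ K x -> h x = 0) ->
  forall x, {for x, continuous h}.
Proof.
move=> cK KOm ch h0 x; have [/KOm/ch//|nK] := pselect (K x).
have oC : open (~` K).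
  by apply: closed_openC; apply: compact_closed => //; exact: norm_hausdorff.
apply: (@eq_on_open_continuous _ _ (~` K) (fun=> 0 : R) h x oC) => //.
  by move=> y; rewrite inE => /h0 ->.
exact: cst_continuous.
Qed.

(** The product u phi, which vanishes off K, is regular on the whole space although u
    is only regular in Om; its partial derivative has integral 0. *)
Lemma Rintegral_by_parts Om K u phi (i : 'I_n) : open Om -> compact K -> K `<=` Om ->
  Ck 1 Om u -> Ck 1 setT phi -> (forall x, ~ K x -> phi x = 0) ->
  \int[mu]_x (u x * pder [:: i] phi x) = - \int[mu]_x (pder [:: i] u x * phi x).
Proof.
move=> oOm cK KOm Cu Cp p0.
have dp0 x : ~ K x -> pder [:: i] phi x = 0 by exact: derive_zero_off.
have oC : open (~` K).
  by apply: closed_openC; apply: compact_closed => //; exact: norm_hausdorff.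
have cu := (Cu.1 [::]); have cdu := (Cu.1 [:: i]); have du := (Cu.2 [::] i).
have cp x := (Cp.1 [::] x isT I); have cdp x := (Cp.1 [:: i] x isT I).
have dp x := (Cp.2 [::] i x isT I).
pose F1 x := u x * pder [:: i] phi x; pose F2 x := pder [:: i] u x * phi x.
have cF1 x : Om x -> {for x, continuous F1}.
  by move=> Ox; apply: (@cvgM _ _ (nbhs x)); [exact: cu|exact: cdp].
have cF2 x : Om x -> {for x, continuous F2}.
  by move=> Ox; apply: (@cvgM _ _ (nbhs x)); [exact: cdu|exact: cp].
have F10 x : ~ K x -> F1 x = 0 by move=> /dp0; rewrite /F1 => ->; rewrite mulr0.
have F20 x : ~ K x -> F2 x = 0 by move=> /p0; rewrite /F2 => ->; rewrite mulr0.
pose G : V -> R := u \* phi.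
have G0 x : ~ K x -> G x = 0 by move=> /p0; rewrite /G/= => ->; rewrite mulr0.
have cG : forall x, {for x, continuous G}.
  apply: (continuous_support cK KOm _ G0) => x Ox.
  by apply: (@cvgM _ _ (nbhs x)); [exact: cu|exact: cp].
have dG x : derivable G x (e i).
  have [/KOm Ox|nK] := pselect (K x).
    by apply: (@derivableM _ _ u phi); [exact: du|exact: dp].
  apply: (@eq_on_open_derivable _ _ (~` K) (fun=> 0) G x _ oC) => //.
  by move=> y; rewrite inE => /G0 ->.
have dGE : pder [:: i] G = F1 \+ F2.
  apply/funext => x; have [/KOm Ox|nK] := pselect (K x).
    rewrite -[LHS]/('D_(e i) (u * phi) x) deriveM; [|exact: du|exact: dp].
    by rewrite /F1 /F2/= -![_ *: _]/(_ * _) [phi x * _]mulrC.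
  rewrite /= F10// F20// addr0.
  exact: (derive_zero_off (e i) cK G0).
have cdG x : {for x, continuous (pder [:: i] G)}.
  rewrite dGE; apply: (@continuous_support Om K) => // [y Oy|y nK].
    by apply: (@cvgD _ R _ (nbhs y)); [exact: cF1|exact: cF2].
  by rewrite /= F10// F20// addr0.
have := Rintegral_partial0 cK cG dG cdG G0; rewrite dGE RintegralD//; last 2 first.
- exact: (@integrable_support R n Om K).
- exact: (@integrable_support R n Om K).
by move/eqP; rewrite addr_eq0 => /eqP.
Qed.

Lemma Rintegral_by_parts2 Om K u phi (i : 'I_n) : open Om -> compact K -> K `<=` Om ->
  Ck 2 Om u -> Ck 2 setT phi -> (forall x, ~ K x -> phi x = 0) ->
  \int[mu]_x (u x * pder [:: i; i] phi x) = \int[mu]_x (pder [:: i; i] u x * phi x).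
Proof.
move=> oOm cK KOm Cu Cp p0.
have dp0 x : ~ K x -> pder [:: i] phi x = 0 by exact: derive_zero_off.
have [_ _ Cdu] := (CkSP 1 Om u).1 Cu; have [_ _ Cdp] := (CkSP 1 setT phi).1 Cp.
rewrite (Rintegral_by_parts i oOm cK KOm (Ck_le _ Cu) (Cdp i) dp0)//.
rewrite (Rintegral_by_parts i oOm cK KOm (Cdu i) (Ck_le _ Cp) p0)//.
by rewrite opprK.
Qed.

End integration_by_parts.

(** * Smooth bumps *)

Section bumps.
Context {R : realType} {n : nat}.
Notation V := 'rV[R]_n.
Notation e j := (delta_mx 0 j : V).
Implicit Types (x y : V) (U K Q : set V) (f g h u phi psi : V -> R).

Lemma is_derive_of_line (f : V -> R) x (v : V) (df : R) :
  is_derive (0 : R) (1 : R) (fun s => f (x + s *: v)) df -> is_derive x v f df.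
Proof.
move=> [dfx <-].
have E : (fun h : R => h^-1 *: (((fun s => f (x + s *: v)) \o shift 0) (h *: (1 : R)) -
             f (x + 0 *: v))) =
  (fun h : R => h^-1 *: ((f \o shift x) (h *: v) - f x)).
  by apply/funext => h /=; rewrite addr0 [h *: 1]mulr1 scale0r addr0 [x + _]addrC.
by rewrite /derivable /derive E in dfx *; constructor.
Qed.

(** The induction on k covers all smooth theta at once: the partial derivatives are
    multiples of the same expression with derive1 theta in place of theta. *)
Lemma Ck_coord k (theta : R -> R) :
  (forall l s, derivable (derive1n l theta) s (1 : R)) ->
  forall (a b : R) (i : 'I_n), Ck k setT (fun x => theta (a * x 0 i + b)).
Proof.
elim: k theta => [|k IH] theta dth a b i.
all: have caff y : {for y, continuous (fun x : V => theta (a * x 0 i + b))}.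
1,3: apply: (@continuous_comp _ _ _ (fun x : V => a * x 0 i + b) theta y);
  [ apply: (@cvgD _ R _ (nbhs y)); last exact: cvg_cst;
    by apply: (@cvgM _ _ (nbhs y)); [exact: cvg_cst|exact: row_coord_cvg]
  | by apply: differentiable_continuous; apply/derivable1_diffP; exact: (dth 0%N)].
  by apply/Ck0P => x _; exact: caff.
have D x j : is_derive x (e j) (fun x => theta (a * x 0 i + b))
    ((a * (i == j)%:R) * derive1 theta (a * x 0 i + b)).
  apply: is_derive_of_line.
  have -> : (fun s : R => theta (a * (x + s *: e j) 0 i + b)) =
      theta \o (fun s : R => (a * (i == j)%:R) * s + (a * x 0 i + b)).
    by apply/funext => s /=; congr theta; rewrite !mxE eqxx /=; ring.
  rewrite [X in is_derive _ _ _ X]mulrC.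
  apply: is_derive1_comp.
    have Dt (s : R) : is_derive s (1 : R) theta (derive1 theta s).
      by rewrite derive1E; apply: derivableP; exact: (dth 0%N).
    by rewrite /= mulr0 add0r; exact: Dt.
  have := is_deriveD (is_deriveZ (a * (i == j)%:R) (is_derive_id (0 : R) (1 : R)))
    (is_derive_cst (a * x 0 i + b) (0 : R) (1 : R)).
  by rewrite addr0 -[_ *: _]/(_ * _) mulr1.
apply/CkSP; split => [x _|j x _|j]; first exact: caff.
  by have [] := D x j.
have -> : pder [:: j] (fun x : V => theta (a * x 0 i + b)) =
   (fun x => (a * (i == j)%:R) * derive1 theta (a * x 0 i + b)).
  by apply/funext => x; have [_ ] := D x j.
apply: Ck_scale; first exact: openT.
by apply: IH => l s; rewrite -derive1Sn; exact: dth.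
Qed.

(** Values in [0, 1] make bumps behave like indicators: phi (1 - psi),
    1 - (1 - phi) (1 - psi) and 1 - (1 - phi)^k mimic the difference, the union and
    the k-fold union of a set with itself. *)
Definition bump Q phi := [/\ Csmooth setT phi, (forall x, 0 <= phi x <= 1) &
  forall x, ~ Q x -> phi x = 0].

Lemma bump0 Q : bump Q (fun=> 0).
Proof. by split => // [k|x]; [exact: Ck_cst|rewrite lexx ler01]. Qed.

Lemma bump_diff Q phi psi : bump Q phi -> bump Q psi ->
  bump Q (fun x => phi x * (1 - psi x)).
Proof.
move=> [Cp p01 p0] [Cq q01 q0]; split => [k|x|x /p0 /= ->]; last by rewrite mul0r.
  apply: (CkM (g := (fun=> 1) \- psi) openT (Cp k)).
  by apply: CkB; [exact: openT|exact: Ck_cst|exact: Cq].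
have /andP[? ?] := p01 x; have /andP[? ?] := q01 x.
by rewrite /= mulr_ge0 ?subr_ge0// mulr_ile1 ?subr_ge0// lerBlDr lerDl.
Qed.

Lemma bumpU Q phi psi : bump Q phi -> bump Q psi ->
  bump Q (fun x => 1 - (1 - phi x) * (1 - psi x)).
Proof.
move=> bp bq; have [Cp p01 p0] := bp; have [Cq q01 q0] := bq.
have -> : (fun x => 1 - (1 - phi x) * (1 - psi x)) = phi \+ (fun x => psi x * (1 - phi x)).
  by apply/funext => x /=; ring.
have [C _ z] := bump_diff bq bp.
split => [k|x|x nQ]; last by rewrite /= z// p0// addr0.
  by apply: CkD; [exact: openT|exact: Cp|exact: C].
have /andP[? ?] := p01 x; have /andP[? ?] := q01 x.
have -> : (phi \+ (fun x => psi x * (1 - phi x))) x = 1 - (1 - phi x) * (1 - psi x).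
  by rewrite /=; ring.
rewrite subr_ge0 mulr_ile1 ?subr_ge0 ?lerBlDr ?lerDl//=.
by rewrite mulr_ge0 ?subr_ge0.
Qed.

Lemma bump_iter Q phi k : bump Q phi -> bump Q (fun x => 1 - (1 - phi x) ^+ k).
Proof.
move=> bp; elim: k => [|k IH].
  have -> : (fun x => 1 - (1 - phi x) ^+ 0) = (fun=> 0) by apply/funext => x; rewrite expr0 subrr.
  exact: bump0.
have := bumpU bp IH; set a := (X in bump Q X); set b := (X in _ -> bump Q X).
have -> // : a = b; apply/funext => x; rewrite /a /b exprS; ring.
Qed.

End bumps.

(** * The fundamental lemma of the calculus of variations *)

Section fundamental_lemma.
Context {R : realType} {n : nat}.
Notation V := 'rV[R]_n.
Notation mu := (@lebesgue_row R n).
Notation mR := (measurableTypeR R).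
Notation e j := (delta_mx 0 j : V).
Implicit Types (x y : V) (U K A : set V) (f h u phi psi : V -> R).

(** A smooth function that is positive exactly on the positive half-line; all bumps
    are built from it. *)
Variable theta : R -> R.
Hypothesis theta_smooth : forall l s, derivable (derive1n l theta) s (1 : R).
Hypothesis theta_le0 : forall s, s <= 0 -> theta s = 0.
Hypothesis theta_gt0 : forall s, 0 < s -> 0 < theta s.

Let theta_ge0 s : 0 <= theta s.
Proof. by have [/theta_le0 ->|/theta_gt0/ltW] := leP s 0. Qed.

Lemma Csmooth_prod (I : Type) (r : seq I) (F : I -> V -> R) :
  (forall i, Csmooth setT (F i)) -> Csmooth setT (fun x => \prod_(i <- r) F i x).
Proof.
move=> CF k; elim: r => [|i r IH].
  by under eq_fun do rewrite big_nil; exact: Ck_cst.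
under eq_fun do rewrite big_cons.
by apply: CkM; [exact: openT|exact: CF|exact: IH].
Qed.

Lemma bump_normalize (p : V) r h : Csmooth setT h -> (forall x, 0 <= h x) ->
  (forall x, ~ cube p r x -> h x = 0) ->
  exists2 c : R, 0 < c & bump (cube p r) (fun x => c * h x).
Proof.
move=> Ch h0 hz.
have ch x : {for x, continuous h} by exact: ((Ch 0%N).1 [::]).
have [M M0 HM] := compact_norm_bound (@compact_closed_cube R n p r) (fun x _ => ch x).
exists M^-1; first by rewrite invr_gt0.
split => [k|x|x /hz ->]; last by rewrite mulr0.
  by apply: Ck_scale; [exact: openT|exact: Ch].
apply/andP; split; first by rewrite mulr_ge0// invr_ge0 ltW.
have [px|/hz ->] := pselect (cube p r x); last by rewrite mulr0.
by rewrite mulrC ler_pdivrMr// mul1r (le_trans (ler_norm _))// HM//; exact: cube_sub.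
Qed.

(** For r > 0 the zero set of this product is the complement of the cube, since each factor
    vanishes exactly off one of the half-spaces whose intersection is the cube. *)
Definition cube_product (p : V) (r : R) x : R :=
  \prod_(i < n) (theta (1 * x 0 i + (r - p 0 i)) * theta (-1 * x 0 i + (r + p 0 i))).

Lemma cube_product_smooth p r : Csmooth setT (cube_product p r).
Proof.
apply: Csmooth_prod => i k.
by apply: CkM; [exact: openT|exact: Ck_coord|exact: Ck_coord].
Qed.

Lemma cube_product_ge0 p r x : 0 <= cube_product p r x.
Proof. by apply: prodr_ge0 => i _; rewrite mulr_ge0. Qed.

Lemma cube_product_gt0 p r x : cube p r x -> 0 < cube_product p r x.
Proof.
move=> px; have r0 : 0 < r by apply: le_lt_trans px.
apply: prodr_gt0 => i _; have := (cubeP p x r0).1 px i.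
rewrite ltr_norml => /andP[H1 H2].
by rewrite mulr_gt0// theta_gt0//; lra.
Qed.

Lemma cube_product_eq0 p r x : 0 < r -> ~ cube p r x -> cube_product p r x = 0.
Proof.
move=> r0 nx; apply/eqP; rewrite prodf_seq_eq0; apply/hasP.
have [i Hi] : exists i, r <= `|x 0 i - p 0 i|.
  apply: contrapT => /forallNP H; apply: nx; apply/(cubeP _ _ r0) => i.
  by rewrite ltNge; apply/negP; exact: H.
exists i; first by rewrite mem_index_enum.
rewrite /= mulf_eq0; move: Hi; rewrite ler_normr => /orP[H|H]; apply/orP; [right|left];
  apply/eqP; apply: theta_le0; lra.
Qed.

Variables (p : V) (r : R).
Hypothesis r0 : 0 < r.
Notation Q := (cube p r).

Lemma cube_bump : exists2 eta, bump Q eta & forall x, Q x -> 0 < eta x.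
Proof.
have [c c0 bc] := bump_normalize (@cube_product_smooth p r)
  (@cube_product_ge0 p r)
  (fun x => @cube_product_eq0 p r x r0).
by exists (fun x => c * cube_product p r x) => // x Qx; rewrite mulr_gt0// cube_product_gt0.
Qed.

Lemma halfspace_bump (i : 'I_n) (b : R) :
  exists2 chi, bump Q chi & forall x, Q x -> (0 < chi x) = (b < x 0 i).
Proof.
pose h x := cube_product p r x * theta (1 * x 0 i + - b).
have Ch : Csmooth setT h.
  by move=> k; apply: CkM; [exact: openT|exact: cube_product_smooth|exact: Ck_coord].
have h0 x : 0 <= h x.
  by rewrite mulr_ge0// cube_product_ge0.
have [c c0 bc] := bump_normalize (p := p) (r := r) Ch h0
  (fun x nx => etrans (congr1 (fun t => t * _) (cube_product_eq0 r0 nx)) (mul0r _)).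
exists (fun x => c * h x) => // x Qx.
rewrite pmulr_rgt0// /h pmulr_rgt0 ?cube_product_gt0//.
have [bx|xb] := ltP b (x 0 i); first by rewrite theta_gt0//; lra.
by rewrite theta_le0 ?ltxx//; lra.
Qed.

Lemma bump_measurable phi : bump Q phi -> measurable_fun [set: V] phi.
Proof.
move=> [Cp _ _]; apply: measurable_fun_continuous_on; first exact: openT.
by move=> x _; exact: ((Cp 0%N).1 [::]).
Qed.

Variable g : V -> R.
Hypothesis ig : mu.-integrable Q (EFin \o g).

Let mQ : measurable Q. Proof. exact: measurable_cube. Qed.

Let mg : measurable_fun Q g.
Proof. by apply/measurable_EFinP; exact: measurable_int ig. Qed.

Definition weighted_integral h : \bar R := (\int[mu]_(x in Q) (`|g x| * `|h x|)%:E)%E.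

Let mw h : measurable_fun Q h -> measurable_fun Q (fun x => (`|g x| * `|h x|)%:E).
Proof.
move=> mh; apply/measurable_EFinP; apply: measurable_funM.
  by apply: measurableT_comp.
by apply: measurableT_comp.
Qed.

Lemma weighted_integral_le h h1 h2 : measurable_fun Q h -> measurable_fun Q h1 ->
  measurable_fun Q h2 ->
  (forall x, Q x -> `|h x| <= `|h1 x| + `|h2 x|) ->
    (weighted_integral h <= weighted_integral h1 + weighted_integral h2)%E.
Proof.
move=> mh m1 m2 H; rewrite /weighted_integral -ge0_integralD//; last 2 first.
- exact: mw.
- exact: mw.
apply: ge0_le_integral => //.
- exact: mw.
- by apply: emeasurable_funD; exact: mw.
- by move=> x Qx; rewrite -EFinD lee_fin -mulrDr ler_wpM2l// H.
Qed.

Lemma weighted_integral_cvg0 (h_ : nat -> V -> R) : (forall k, measurable_fun Q (h_ k)) ->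
  (forall k x, Q x -> `|h_ k x| <= 1) ->
  (forall x, Q x -> (fun k => h_ k x) @ \oo --> (0 : R)) ->
  forall eps : R, 0 < eps -> exists k, (weighted_integral (h_ k) < eps%:E)%E.
Proof.
move=> mh h1 hc eps eps0.
have H : (fun k => weighted_integral (h_ k)) @ \oo --> (\int[mu]_(x in Q) cst 0 x)%E.
  apply: (@dominated_cvg _ _ _ mu Q mQ _ _ (fun x => `|(g x)%:E|%E)).
  - by move=> k; exact: mw.
  - move=> x Qx; apply: cvg_EFin; first exact: nearW.
    rewrite -[0](mulr0 `|g x|) -(@normr0 _ R).
    apply: cvgM; first exact: cvg_cst.
    by apply: cvg_norm; exact: hc.
  - by [].
  - exact: integrable_abse.
  - move=> k x Qx /=; rewrite lee_fin ger0_norm ?mulr_ge0// ler_piMr//; exact: h1.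
rewrite integral_cst// mul0e in H.
have /fine_cvgP[[N1 _ HN1] /cvgrPdist_lt/(_ _ eps0)[N2 _ HN2]] := H.
exists (maxn N1 N2).
have := HN2 _ (leq_maxr N1 N2); have := HN1 _ (leq_maxl N1 N2).
rewrite /= sub0r normrN => fin lt.
by rewrite -(fineK fin) lte_fin (le_lt_trans (ler_norm _)).
Qed.

Local Notation ind A := (@indic V R A).

Definition weighted_distance h1 h2 : \bar R := weighted_integral (fun x => h1 x - h2 x).

(** Approximation of the indicator by bumps in L^1(Q, |g| dmu). The sets with this
    property form a sigma-algebra containing the coordinate half-spaces, hence all
    measurable sets. *)
Definition bump_approximable A : Prop := measurable A /\ forall eps : R, 0 < eps ->
  exists2 phi, bump Q phi & (weighted_distance (ind A) phi < eps%:E)%E.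

Let mdiff A phi : measurable A -> bump Q phi -> measurable_fun Q (fun x => ind A x - phi x : R).
Proof.
move=> mA bp; apply: measurable_funB; first exact: measurable_indic.
by apply: measurable_funTS; exact: bump_measurable.
Qed.

(** The bumps 1 - (1 - chi)^k converge boundedly to the indicator of the set where chi
    is positive. *)
Lemma bump_approximable_positivity A chi : measurable A -> bump Q chi ->
  (forall x, Q x -> (0 < chi x) = (x \in A)) -> bump_approximable A.
Proof.
move=> mA bchi chiA; split=> // eps eps0.
have [_ chi01 _] := bchi.
have mk k : measurable_fun Q (fun x => ind A x - (1 - (1 - chi x) ^+ k) : R).
  by apply: mdiff => //; exact: bump_iter.
have [|x Qx|k Hk] := weighted_integral_cvg0 mk _ _ eps0.
- move=> k x Qx; have [_ b01 _] := bump_iter k bchi.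
  move: (b01 x); set t := 1 - _ => /andP[b0 b1].
  by rewrite indicE; case: (x \in A) => /=; rewrite ?mulr1n ?mulr0n ler_norml;
    apply/andP; split; lra.
- rewrite indicE -(chiA _ Qx); have /andP[c0 c1] := chi01 x.
  have [x0|x0] := ltP 0 (chi x).
    under eq_fun do rewrite opprB addrC subrK.
    by apply: cvg_expr; rewrite ger0_norm ?subr_ge0// ltrBlDr ltrDl.
  have -> : chi x = 0 by apply/eqP; rewrite eq_le x0 c0.
  by under eq_fun do rewrite subr0 expr1n subrr subr0; exact: cvg_cst.
by exists (fun x => 1 - (1 - chi x) ^+ k) => //; exact: bump_iter.
Qed.

Lemma bump_approximableT : bump_approximable setT.
Proof.
have [eta beta eta0] := cube_bump; apply: (bump_approximable_positivity measurableT beta) => x Qx.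
by rewrite in_setT eta0.
Qed.

Lemma bump_approximable_halfspace (i : 'I_n) (b : R) : bump_approximable [set x : V | b < x 0 i].
Proof.
have [chi bchi chiE] := halfspace_bump i b.
apply: (bump_approximable_positivity _ bchi) => [|x Qx].
  rewrite -[X in measurable X]setTI.
  apply: (@measurable_coord R n i measurableT [set t : R | b < t]).
  by rewrite -set_itvoy; exact: measurable_itv.
by rewrite chiE//; apply/idP/idP; rewrite inE.
Qed.

Lemma bump_approximableC A : bump_approximable A -> bump_approximable (~` A).
Proof.
move=> [mA HA]; split; first exact: measurableC.
move=> eps eps0; have eps20 : 0 < eps / 2 by rewrite divr_gt0.
have [phi bp Hp] := HA _ eps20; have [_ /(_ _ eps20)[eta be He]] := bump_approximableT.
(* 1 - phi itself is not a bump, as it does not vanish off Q; eta is close to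
   the indicator of Q *)
exists (fun x => eta x * (1 - phi x)); first exact: bump_diff.
apply: (@le_lt_trans _ _ (weighted_distance (ind setT) eta + weighted_distance (ind A) phi)%E).
  apply: weighted_integral_le.
  - by apply: mdiff; [exact: measurableC|exact: bump_diff].
  - exact: mdiff.
  - exact: mdiff.
  move=> x _; have [_ p01 _] := bp; have /andP[p0 p1] := p01 x.
  have -> : ind (~` A) x - eta x * (1 - phi x) =
     (ind setT x - eta x) * (1 - phi x) - (ind A x - phi x) :> R.
    by rewrite !indicE in_setT in_setC; case: (x \in A) => /=; ring.
  apply: le_trans (ler_normB _ _) _; rewrite lerD2r normrM ler_piMr//.
  by rewrite ger0_norm ?subr_ge0// lerBlDr lerDl.
by rewrite [eps]splitr EFinD; exact: lteD.
Qed.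

Lemma bump_approximableU A B : bump_approximable A -> bump_approximable B ->
  bump_approximable (A `|` B).
Proof.
move=> [mA HA] [mB HB]; split; first exact: measurableU.
move=> eps eps0; have eps20 : 0 < eps / 2 by rewrite divr_gt0.
have [phi bp Hp] := HA _ eps20; have [psi bq Hq] := HB _ eps20.
exists (fun x => 1 - (1 - phi x) * (1 - psi x)); first exact: bumpU.
apply: (@le_lt_trans _ _ (weighted_distance (ind A) phi + weighted_distance (ind B) psi)%E).
  apply: weighted_integral_le.
  - by apply: mdiff; [exact: measurableU|exact: bumpU].
  - exact: mdiff.
  - exact: mdiff.
  move=> x _; have [_ p01 _] := bp; have /andP[p0 p1] := p01 x.
  have [_ q01 _] := bq; have /andP[q0 q1] := q01 x.
  have -> : ind (A `|` B) x - (1 - (1 - phi x) * (1 - psi x)) =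
     (1 - ind B x) * (ind A x - phi x) + (1 - phi x) * (ind B x - psi x) :> R.
    by rewrite !indicE in_setU; case: (x \in A); case: (x \in B) => /=; ring.
  apply: le_trans (ler_normD _ _) _; rewrite !normrM; apply: lerD; rewrite ler_piMl//.
    by rewrite indicE; case: (x \in B); rewrite ?subrr ?subr0 ?normr0 ?normr1.
  by rewrite ger0_norm ?subr_ge0// lerBlDr lerDl.
by rewrite [eps]splitr EFinD; exact: lteD.
Qed.

Lemma bump_approximable0 : bump_approximable set0.
Proof. by rewrite -setCT; apply: bump_approximableC; exact: bump_approximableT. Qed.

Lemma bump_approximable_bigcup (F : nat -> set V) : (forall k, bump_approximable (F k)) ->
  bump_approximable (\bigcup_k F k).
Proof.
move=> HF; have mF k := (HF k).1.
pose G k := \big[setU/set0]_(i < k) F i.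
have aG k : bump_approximable (G k).
  by rewrite /G; elim: k => [|k IH]; rewrite ?big_ord0 ?big_ord_recr/=;
    [exact: bump_approximable0|exact: bump_approximableU].
have mU : measurable (\bigcup_k F k) by exact: bigcupT_measurable.
split=> // eps eps0; have eps20 : 0 < eps / 2 by rewrite divr_gt0.
have GU k : G k `<=` \bigcup_k F k.
  by rewrite /G -bigcup_mkord => x [i _ Fx]; exists i.
have mk k : measurable_fun Q (fun x => ind (\bigcup_k F k) x - ind (G k) x : R).
  by apply: measurable_funB; apply: measurable_indic => //; exact: (aG k).1.
have [|x Qx|k Hk] := weighted_integral_cvg0 mk _ _ eps20.
- move=> k x _; rewrite !indicE.
  by case: (x \in _); case: (x \in _); rewrite ?subrr ?subr0 ?sub0r ?normrN ?normr0 ?normr1.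
- have [[N _ Fx]|nFx] := pselect ((\bigcup_k F k) x); last first.
    have E k : ind (\bigcup_k F k) x - ind (G k) x = 0 :> R.
      by rewrite !indicE !memNset ?subrr// => /GU.
    by under eq_fun do rewrite E; exact: cvg_cst.
  apply: cvg_near_cst.
  exists N.+1 => // k /= Nk; rewrite !indicE !mem_set ?subrr//; last by exists N.
  by rewrite /G -bigcup_mkord; exists N.
have [phi bp Hp] := (aG k).2 _ eps20.
exists phi => //.
apply: (@le_lt_trans _ _ (weighted_distance (ind (\bigcup_k F k)) (ind (G k)) +
   weighted_distance (ind (G k)) phi)%E).
  apply: weighted_integral_le => //; first exact: mdiff.
    by apply: mdiff => //; exact: (aG k).1.
  move=> x _; apply: le_trans (ler_normD _ _); rewrite le_eqVlt; apply/orP; left.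
  by apply/eqP; congr `|_|; ring.
by rewrite [eps]splitr EFinD; exact: lteD.
Qed.

(** Measurable sets of row vectors are generated by the preimages of Borel sets of
    reals under the coordinates, and these by half-spaces. *)
Lemma bump_approximable_measurable A : measurable A -> bump_approximable A.
Proof.
have coord (i : 'I_n) (C : set mR) : measurable C -> bump_approximable [set x : V | C (x 0 i)].
  rewrite -[measurable]/((@ocitv R).-sigma.-measurable) RGenOInfty.measurableE.
  apply: (@smallest_sub _ (sigma_algebra setT) _
    [set C | bump_approximable [set x : V | C (x 0 i)]]).
    split=> [|C' HC|F HF]; first exact: bump_approximable0.
      by rewrite setTD; exact: (bump_approximableC HC).
    exact: (bump_approximable_bigcup HF).
  move=> _ [b ->] /=.
  have -> : [set x : V | `]b, +oo[%classic (x 0 i)] = [set x : V | b < x 0 i].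
    by apply/seteqP; split=> x /=; rewrite in_itv/= andbT.
  exact: bump_approximable_halfspace.
move=> [B mB <-]; rewrite setTI.
move: B mB.
apply: (@smallest_sub _ (sigma_algebra setT) _
  [set B | bump_approximable (tuple_of_row @^-1` B)]).
  split=> [|C' HC|F HF]; first exact: bump_approximable0.
    by rewrite setTD; exact: (bump_approximableC HC).
  exact: (bump_approximable_bigcup HF).
move=> B; rewrite -bigcup_seq => -[i _ [C mC <-]] /=; rewrite setTI.
have -> : tuple_of_row @^-1` (tnth (T:=mR) ^~ i @^-1` C) = [set x : V | C (x 0 i)].
  by apply/seteqP; split=> x /=; rewrite tnth_mktuple.
exact: coord.
Qed.

(** Let N be the part of Q where g is negative and phi a bump close to the indicator of
    N. Pointwise |g| 1_N + g phi <= |g| |1_N - phi|; as g phi has a nonnegative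
    integral, the integral of |g| over N is arbitrarily small. *)
Lemma nonneg_of_bumps : (forall phi, bump Q phi -> 0 <= \int[mu]_(x in Q) (g x * phi x)) ->
  mu.-negligible (Q `&` [set x | g x < 0]).
Proof.
move=> Hg; set N := Q `&` _.
have mN : measurable N.
  rewrite /N -[X in _ `&` X]/(g @^-1` [set t : R | t < 0]); apply: mg => //.
  by rewrite -set_itvNyo; exact: measurable_itv.
have [_ aN] := bump_approximable_measurable mN.
have m1 : measurable_fun Q (ind N) by exact: measurable_indic.
have le0 : (weighted_integral (ind N) <= 0)%E.
  apply/lee_addgt0Pr => eps eps0; rewrite add0e.
  have [phi bp Hp] := aN _ eps0.
  have [_ p01 _] := bp.
  have mphi : measurable_fun Q phi by apply: measurable_funTS; exact: bump_measurable bp.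
  have iphi : mu.-integrable Q (EFin \o (fun x => g x * phi x)).
    apply: (le_integrable mQ _ _ ig).
      by apply/measurable_EFinP; exact: measurable_funM.
    move=> x _; rewrite /= lee_fin normrM ler_piMr//.
    by have /andP[h1 h2] := p01 x; rewrite ger0_norm.
  have iw h : measurable_fun Q h -> (forall x, Q x -> `|h x| <= 1) ->
      mu.-integrable Q (fun x => (`|g x| * `|h x|)%:E).
    move=> mh h1; apply: (le_integrable mQ (mw mh) _ ig) => x Qx.
    by rewrite /= lee_fin ger0_norm ?mulr_ge0// ler_piMr// h1.
  have iN : mu.-integrable Q (fun x => (`|g x| * `|ind N x|)%:E).
    by apply: iw => // x _; rewrite indicE; case: (x \in N); rewrite ?normr0 ?normr1.
  have id : mu.-integrable Q (fun x => (`|g x| * `|ind N x - phi x|)%:E).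
    apply: iw => [|x _]; first exact: mdiff.
    have /andP[h1 h2] := p01 x.
    by rewrite indicE; case: (x \in N) => /=; rewrite ?mulr1n ?mulr0n ler_norml; apply/andP;
      split; lra.
  apply: (@le_trans _ _ (weighted_distance (ind N) phi)); last exact: ltW.
  apply: (@le_trans _ _ (\int[mu]_(x in Q) ((`|g x| * `|ind N x|)%:E + (g x * phi x)%:E))%E).
    rewrite integralD// leeDl// -[X in (_ <= X)%E]fineK; last exact: (integrable_fin_num mQ iphi).
    by rewrite lee_fin; exact: Hg.
  apply: le_integral => //; first exact: integrableD.
  move=> x Qx; rewrite -EFinD lee_fin; have /andP[h1 h2] := p01 (x : V).
  rewrite inE in Qx; rewrite indicE; have [xN|xN] := boolP (x \in N).
    have gx : g x < 0 by move: xN; rewrite inE => -[].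
    rewrite (ltr0_norm gx) normr1 ger0_norm ?subr_ge0//.
    by rewrite le_eqVlt; apply/orP; left; apply/eqP; rewrite /= ?mulr1n; ring.
  rewrite normr0 mulr0 add0r sub0r normrN (ger0_norm h1).
  by rewrite ler_wpM2r// ler_norm.
have eq0 : (\int[mu]_(x in Q) `|(`|g x| * `|ind N x|)%:E| = 0)%E.
  apply/eqP; rewrite eq_le; apply/andP; split; last exact: integral_ge0.
  rewrite (eq_integral (fun x => (`|g x| * `|ind N x|)%:E)) // => x _.
  by rewrite /= ger0_norm// mulr_ge0.
have /(ae_eq_integral_abs mu mQ (mw m1)) := eq0.
move=> H; apply: negligibleS H => x [Qx gx] /= /(_ Qx).
move=> [] /eqP; rewrite mulf_eq0 !normr_eq0 indicE mem_set//= oner_eq0 orbF.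
by rewrite lt_eqF.
Qed.

End fundamental_lemma.

(** * Contact sets are flat almost everywhere *)

Section null_contact.
Context {R : realType} {n : nat}.
Notation V := 'rV[R]_n.
Notation mu := (@lebesgue_row R n).
Notation e j := (delta_mx 0 j : V).
Implicit Types (x y : V) (U K A Om : set V) (F : V -> R).

Lemma pder_min_eq0 Om F y (i : 'I_n) : open Om -> Ck 1 Om F -> Om y ->
  (forall x, Om x -> F y <= F x) -> pder [:: i] F y = 0.
Proof.
move=> oOm CF Oy Fy; have [d [d0 dO]] := open_closed_cube oOm Oy.
have Os (s : R) : `|s| <= d -> Om (y + s *: e i).
  by move=> sd; apply: dO; rewrite /closed_cube/=
    addrAC subrr add0r (le_trans (norm_delta_row _ _)).
have Hd (s : R) : `|s| <= d ->
  is_derive s (1 : R) (fun s => F (y + s *: e i)) (pder [:: i] F (y + s *: e i)).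
  move=> sd; apply: is_derive_line; apply: derivableP.
  by apply: (CF.2 [::]) => //; exact: Os.
have dd : - d <= d by lra.
have D0 : is_derive (0 : R) (1 : R) (fun s => F (y + s *: e i)) 0.
  apply: (derive1_at_min dd).
  - move=> t; rewrite in_itv/= => /andP[t1 t2].
    by have [] // := Hd t _; rewrite ler_norml !ltW.
  - by rewrite in_itv/=; apply/andP; split; lra.
  - move=> t; rewrite in_itv/= => /andP[t1 t2]; rewrite scale0r addr0; apply: Fy.
    by apply: Os; rewrite ler_norml !ltW.
have D1 : is_derive (0 : R) (1 : R) (fun s => F (y + s *: e i)) (pder [:: i] F y).
  by have := Hd 0; rewrite scale0r addr0; apply; rewrite normr0 ltW.
by rewrite -(@derive_val _ _ _ _ _ _ _ D1) (@derive_val _ _ _ _ _ _ _ D0).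
Qed.

(** The translates of B by the vectors t_k e_i, with t_k = 1 / (k + 1), are infinitely
    many disjoint sets of the same measure in a cube, whose measure is finite. *)
Lemma null_by_translates (B : set V) (x : V) (r : R) (i : 'I_n) : measurable B ->
  B `<=` cube x r ->
  (forall y (t : R), 0 < t -> B y -> ~ B (y + t *: e i)) -> mu B = 0%E.
Proof.
move=> mB Bx Bt.
pose t_ k : R := k.+1%:R^-1.
have t0 k : 0 < t_ k by rewrite invr_gt0 ltr0n.
have t1 k : t_ k <= 1 by rewrite invf_le1 ?ltr0n// ler1n.
pose S k : set V := (fun y => y + (- t_ k) *: e i) @^-1` B.
have mS k : measurable (S k).
  by rewrite -[X in measurable X]setTI; apply: measurable_row_shift.
have muS k : mu (S k) = mu B by exact: lebesgue_row_shift.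
have tS : trivIset [set: nat] S.
  have dis k l : (k < l)%N -> S k `&` S l = set0.
    move=> kl; apply/seteqP; split=> y // [Bk Bl].
    have tkl : 0 < t_ k - t_ l by rewrite subr_gt0 ltf_pV2 ?posrE ?ltr0n// ltr_nat ltnS.
    apply: (Bt _ _ tkl Bk).
    suff -> : y + - t_ k *: e i + (t_ k - t_ l) *: e i = y + - t_ l *: e i by [].
    by rewrite -addrA -scalerDl; congr (_ + _ *: _); ring.
  apply/trivIsetP => k l _ _; rewrite neq_ltn => /orP[|] /dis //.
  by rewrite setIC.
have fin := lebesgue_cube_fin x (r + 1).
have SB N : \big[setU/set0]_(k < N) S k `<=` cube x (r + 1).
  rewrite -bigcup_mkord => y [k _ /Bx]; rewrite /cube/= => H.
  have -> : y - x = (y + - t_ k *: e i - x) + t_ k *: e i.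
    by apply/rowP => l; rewrite !mxE; ring.
  apply: le_lt_trans (ler_normD _ _) _; apply: ltr_leD => //.
  by apply: le_trans (norm_delta_row _ _) _; rewrite gtr0_norm.
have bound N : ((mu B *+ N)%R <= mu (cube x (r + 1)%R))%E.
  have E := measure_bigsetU mu mS tS N.
  rewrite (eq_bigr (fun=> mu B)) ?sumr_const ?card_ord in E; last by move=> k _; exact: muS.
  rewrite -E; apply: le_measure; rewrite ?inE//; last exact: measurable_cube.
  by apply: bigsetU_measurable => k _; exact: mS.
have Bfin : (mu B < +oo)%E.
  apply: le_lt_trans (lebesgue_cube_fin x r); apply: le_measure; rewrite ?inE//.
  exact: measurable_cube.
apply/eqP; rewrite eq_le measure_ge0 andbT leNgt; apply/negP => B0.
have Bf : mu B \is a fin_num by rewrite ge0_fin_numE.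
have Cf : mu (cube x (r + 1)) \is a fin_num by rewrite ge0_fin_numE.
pose b := fine (mu B); pose c := fine (mu (cube x (r + 1))).
have b0 : 0 < b by rewrite -lte_fin fineK.
have bE N : b *+ N <= c.
  have := bound N; rewrite -(fineK Bf) -(fineK Cf) -/b -/c.
  have -> : (b%:E *+ N)%R = (b *+ N)%:E.
    by elim: (N) => // k IH; rewrite !mulrS IH.
  by rewrite lee_fin.
have [N Hb] : exists N : nat, c / b < N%:R.
  by exists (Num.truncn (c / b)).+1; exact: truncnS_gt.
have := bE N; rewrite leNgt -mulr_natl -ltr_pdivrMr// => /negP; exact.
Qed.

(** The zeros of F are minima, so d_i F vanishes there. By the theorem of Rolle, between
    two zeros on a segment in the direction i the derivative d_i d_i F would vanish
    somewhere. Locally it does not, by continuity, so the zeros near such a point are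
    disjoint from their translates in the direction i. *)
Lemma null_nonflat_contact Om F (i : 'I_n) : open Om -> Ck 2 Om F ->
  (forall x, Om x -> 0 <= F x) ->
  mu.-negligible [set x | [/\ Om x, F x = 0 & pder [:: i; i] F x != 0]].
Proof.
move=> oOm CF F0; set A := [set x | _].
apply: negligible_local => x [Ox Fx D2x].
have cD2 : {for x, continuous (pder [:: i; i] F)} by exact: (CF.1 [:: i; i]).
have mOm := measurable_open oOm.
have mF : measurable_fun Om F.
  exact: (measurable_fun_continuous_on oOm (fun y => CF.1 [::] y isT)).
have mD : measurable_fun Om (pder [:: i; i] F).
  exact: (measurable_fun_continuous_on oOm (fun y => CF.1 [:: i; i] y isT)).
have mA : measurable A.
  have -> : A = (Om `&` F @^-1` [set 0]) `&` (Om `&` pder [:: i; i] F @^-1` (~` [set 0])).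
    apply/seteqP; split=> y /=; first by move=> [? ? /eqP].
    by move=> [[? ?] [_ /eqP]].
  apply: measurableI; first exact: (mF mOm _ (measurable_set1 0)).
  exact: (mD mOm _ (measurableC (measurable_set1 0))).
have [r r0 [rO rD]] : exists2 r, 0 < r & cube x r `<=` Om /\ forall y, cube x r y ->
  pder [:: i; i] F y != 0.
  have H : nbhs (x : V) [set y | pder [:: i; i] F y != 0].
    have oN : open [set t : R | t != 0].
      rewrite (_ : [set t : R | t != 0] = ~` [set 0]); last first.
        by apply/seteqP; split=> t /= /eqP.
      by apply: closed_openC; exact: closed_eq.
    exact: (cD2 [set t : R | t != 0] (open_nbhs_nbhs (conj oN D2x))).
  have NB : nbhs (x : V) (Om `&` [set y | pder [:: i; i] F y != 0]).
    exact: filterI (open_nbhs_nbhs (conj oOm Ox)) H.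
  move/nbhs_ballP: NB => [r /= r0 Hr].
  exists r; first exact: r0.
  rewrite cubeE; split; first by move=> y /Hr[].
  move=> y /Hr[_ Dy]; exact: Dy.
have mAx := measurableI _ _ mA (measurable_cube x r).
exists r; first exact: r0.
apply/negligibleP; first exact: mAx.
apply: (@null_by_translates _ x r i).
- exact: mAx.
- by move=> y [].
move=> y t t0 [[Oy Fy _] xy] [[Ot Ft _] xt].
have min0 z : Om z -> F z = 0 -> pder [:: i] F z = 0.
  move=> Oz Fz; apply: (pder_min_eq0 i oOm (Ck_le _ CF) Oz) => // z' Oz'.
  by rewrite Fz F0.
have seg (s : R) : 0 <= s <= t -> cube x r (y + s *: e i).
  move=> /andP[s0 st]; apply/(cubeP _ _ r0) => k.
  have := (cubeP _ _ r0).1 xy k; have := (cubeP _ _ r0).1 xt k.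
  rewrite !mxE eqxx /= !ltr_norml => /andP[a1 a2] /andP[a3 a4].
  by case: (k == i) a1 a2; rewrite ?mulr1 ?mulr0 => a1 a2; apply/andP; split; lra.
have Hd (s : R) : 0 <= s <= t ->
  is_derive s (1 : R) (fun s => pder [:: i] F (y + s *: e i)) (pder [:: i; i] F (y + s *: e i)).
  move=> st; apply: is_derive_line; apply: derivableP.
  by apply: (CF.2 [:: i]) => //; exact/rO/seg.
have [||| c] := @Rolle R (fun s => pder [:: i] F (y + s *: e i)) 0 t t0.
- move=> s; rewrite in_itv/= => /andP[s0 st].
  by have [] // := Hd s _; rewrite !ltW.
- apply: derivable_within_continuous => s; rewrite in_itv/= => st.
  by have [] // := Hd s _.
- by rewrite scale0r addr0 !min0.
rewrite in_itv/= => /andP[c0 ct] Dc.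
have ct' : 0 <= c <= t by rewrite !ltW.
have Dc' := Hd c ct'.
have := rD _ (seg _ ct').
by rewrite -(@derive_val _ _ _ _ _ _ _ Dc') (@derive_val _ _ _ _ _ _ _ Dc) eqxx.
Qed.

End null_contact.

(** * Weak Laplacians of uniform limits *)

Section weak_limits.
Context {R : realType} {n : nat}.
Notation V := 'rV[R]_n.
Notation mu := (@lebesgue_row R n).
Implicit Types (x y : V) (K Om : set V) (f h c phi psi : V -> R).

Lemma Rintegral_sumr (I : Type) (s : seq I) (D : set V) (F : I -> V -> R) : measurable D ->
  (forall i, mu.-integrable D (EFin \o F i)) ->
  mu.-integrable D (EFin \o (fun x => \sum_(i <- s) F i x)) /\
  \int[mu]_(x in D) (\sum_(i <- s) F i x) = \sum_(i <- s) \int[mu]_(x in D) F i x.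
Proof.
move=> mD iF; elim: s => [|i s [IH1 IH2]].
  under eq_fun do rewrite big_nil; rewrite big_nil; split.
    by apply: (eq_integrable mD (cst 0%E)) => //; exact: integrable0.
  by rewrite /Rintegral integral0.
under eq_fun do rewrite big_cons; rewrite big_cons.
split; first by have := integrableD mD (iF i) IH1; apply: eq_integrable.
by rewrite RintegralD// IH2.
Qed.

Lemma Rintegral_uniform_cvg Om K (u_ : nat -> V -> R) (u0 : V -> R) psi : open Om ->
  compact K -> K `<=` Om ->
  (forall m x, Om x -> {for x, continuous (u_ m)}) ->
  (forall x, Om x -> {for x, continuous u0}) ->
  (forall x, {for x, continuous psi}) ->
  (forall d : R, 0 < d -> exists N, forall m y, (N <= m)%N -> Om y -> `|u_ m y - u0 y| <= d) ->
  (fun m => \int[mu]_(x in K) (u_ m x * psi x)) @ \oo --> \int[mu]_(x in K) (u0 x * psi x).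
Proof.
move=> oOm cK KOm cu cu0 cpsi uu; have mK := measurable_compact cK.
have iK f : (forall x, Om x -> {for x, continuous f}) -> mu.-integrable K (EFin \o f).
  exact: (@integrable_compact R n Om).
have ip : mu.-integrable K (EFin \o (fun x => `|psi x|)).
  by apply: iK => x _; apply: (@cvg_norm _ _ _ (nbhs (x : V))); exact: cpsi.
pose C := \int[mu]_(x in K) `|psi x|.
have C0 : 0 <= C by apply: Rintegral_ge0.
apply/cvgrPdist_le => d d0.
have d10 : 0 < d / (C + 1) by rewrite divr_gt0// ltr_wpDl.
have [N HN] := uu _ d10; exists N => // m /= Nm.
have c1 x : Om x -> {for x, continuous (fun x => u_ m x * psi x)}.
  by move=> Ox; apply: (@cvgM _ _ (nbhs (x : V))); [exact: cu|exact: cpsi].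
have c0 x : Om x -> {for x, continuous (fun x => u0 x * psi x)}.
  by move=> Ox; apply: (@cvgM _ _ (nbhs (x : V))); [exact: cu0|exact: cpsi].
have cB x : Om x -> {for x, continuous (fun x => u0 x * psi x - u_ m x * psi x)}.
  by move=> Ox; apply: (@cvgB _ R _ (nbhs (x : V))); [exact: c0|exact: c1].
rewrite -RintegralB; [|exact: mK|exact: iK|exact: iK].
apply: (le_trans (le_normr_Rintegral mK (iK _ cB))).
apply: (@le_trans _ _ (\int[mu]_(x in K) (d / (C + 1) * `|psi x|))).
  apply: le_Rintegral => //.
  - by apply: iK => x Ox; apply: (@cvg_norm _ _ _ (nbhs (x : V))); exact: cB.
  - apply: iK => x _; apply: (@cvgM _ _ (nbhs (x : V))); first exact: cvg_cst.
    by apply: (@cvg_norm _ _ _ (nbhs (x : V))); exact: cpsi.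
  - move=> x /KOm Ox; rewrite -mulrBl normrM ler_wpM2r// distrC.
    exact: HN.
rewrite RintegralZl// -/C mulrAC ler_pdivrMr ?ltr_wpDl// mulrDr mulr1 lerDl.
exact: ltW.
Qed.

Variable theta : R -> R.
Hypothesis theta_smooth : forall l s, derivable (derive1n l theta) s (1 : R).
Hypothesis theta_le0 : forall s, s <= 0 -> theta s = 0.
Hypothesis theta_gt0 : forall s, 0 < s -> 0 < theta s.

(** Pointwise inequalities on classical Laplacians pass to the limit although only the
    functions themselves converge: tested against a bump, two integrations by parts
    turn each Laplacian into an integral of the function. *)
Lemma weak_limit_nonneg Om (u_ : nat -> V -> R) (u0 c : V -> R) (s : R) (p : V) (r : R)
  (N0 : nat) :
  open Om -> 0 < r -> closed_cube p r `<=` Om ->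
  (forall m, Ck 2 Om (u_ m)) -> (forall x, Om x -> {for x, continuous u0}) ->
  (forall d : R, 0 < d -> exists N, forall m y, (N <= m)%N -> Om y -> `|u_ m y - u0 y| <= d) ->
  (forall i, weak_der Om [:: i; i] u0 (wder Om [:: i; i] u0)) ->
  (forall x, Om x -> {for x, continuous c}) ->
  (forall m y, (N0 <= m)%N -> cube p r y -> 0 <= c y + s * laplacian (u_ m) y) ->
  mu.-negligible (cube p r `&` [set x | c x + s * weak_laplacian Om u0 x < 0]).
Proof.
move=> oOm r0 KOm Cu cu0 uu wd cc nonneg.
set K := closed_cube p r in KOm; set Q := cube p r.
have cK : compact K by exact: compact_closed_cube.
have mK := measurable_compact cK.
have mQ : measurable Q by exact: measurable_cube.
have QK : Q `<=` K by exact: cube_sub.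
pose w i := wder Om [:: i; i] u0.
have iw i : mu.-integrable K (EFin \o w i) by have [_ H _] := wd i; exact: H.
have iK f : (forall x, Om x -> {for x, continuous f}) -> mu.-integrable K (EFin \o f).
  exact: (@integrable_compact R n Om).
have [isw _] := Rintegral_sumr (index_enum 'I_n) mK iw.
have ig : mu.-integrable K (EFin \o (fun x => c x + s * weak_laplacian Om u0 x)).
  have H := integrableD mK (iK _ cc) (integrableZl mK s isw).
  by apply: eq_integrable H.
have igQ := integrableS mK mQ QK ig.
apply: (nonneg_of_bumps theta_smooth theta_le0 theta_gt0 r0 igQ) => phi bp.
have [Cphi phi01 phi0] := bp.
have phiK x : ~ K x -> phi x = 0 by move=> nK; apply: phi0 => /QK.
have cphi x : {for x, continuous phi} by exact: ((Cphi 0%N).1 [::]).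
have dphi0 i x : ~ K x -> pder [:: i] phi x = 0 by exact: derive_zero_off.
have ddphi0 i x : ~ K x -> pder [:: i; i] phi x = 0 by exact: (derive_zero_off _ cK (dphi0 i)).
have tphi : test_function Om phi.
  have sK : closure [set x | phi x != 0] `<=` K.
    have clK : closed K by apply: compact_closed => //; exact: norm_hausdorff.
    rewrite [X in _ `<=` X]((closure_id K).1 clK); apply: closureS => x /= nx.
    by apply: contrapT => /phiK /eqP; exact/negP.
  split=> //; last by apply: subset_trans KOm.
  by apply: (subclosed_compact _ cK) => //; exact: closed_closure.
have iphi f : measurable_fun K f -> mu.-integrable K (EFin \o f) ->
    mu.-integrable K (EFin \o (fun x => f x * phi x)).
  move=> mf If; apply: (le_integrable mK _ _ If).
    apply/measurable_EFinP; apply: measurable_funM => //.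
    by apply: measurable_funTS; exact: bump_measurable bp.
  move=> x _; rewrite /= lee_fin normrM ler_piMr//.
  by have /andP[? ?] := phi01 x; rewrite ger0_norm.
have miK f : mu.-integrable K (EFin \o f) -> measurable_fun K f.
  by move=> If; apply/measurable_EFinP; exact: measurable_int If.
have iwp i := iphi _ (miK _ (iw i)) (iw i).
have icp := iphi _ (miK _ (iK _ cc)) (iK _ cc).
(* both the weak and the classical derivatives are moved to phi, where only the
   uniform convergence of u_ matters *)
have lim_i i : (fun m => \int[mu]_(x in K) (pder [:: i; i] (u_ m) x * phi x)) @ \oo -->
    \int[mu]_(x in K) (w i x * phi x).
  have -> : \int[mu]_(x in K) (w i x * phi x) = \int[mu]_(x in K) (u0 x * pder [:: i; i] phi x).
    have [_ _ /(_ _ tphi)] := wd i.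
    rewrite /= expr2 mulrNN mulr1 mul1r -/(w i).
    have z1 x : ~ K x -> u0 x * pder [:: i; i] phi x = 0 by move=> /(ddphi0 i) ->; rewrite mulr0.
    have z2 x : ~ K x -> w i x * phi x = 0 by move=> /phiK ->; rewrite mulr0.
    rewrite (Rintegral_support KOm z1) (Rintegral_support KOm z2).
    by rewrite (Rintegral_support (@subset_refl _ K) z1)
      (Rintegral_support (@subset_refl _ K) z2).
  have -> : (fun m => \int[mu]_(x in K) (pder [:: i; i] (u_ m) x * phi x)) =
      (fun m => \int[mu]_(x in K) (u_ m x * pder [:: i; i] phi x)).
    apply/funext => m; rewrite [RHS](Rintegral_support (@subset_refl _ K)); last first.
      by move=> x /(ddphi0 i) ->; rewrite mulr0.
    rewrite [LHS](Rintegral_support (@subset_refl _ K)); last by move=> x /phiK ->; rewrite mulr0.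
    by rewrite (@Rintegral_by_parts2 R n Om K (u_ m) phi i oOm cK KOm (Cu m) (Cphi 2) phiK).
  apply: (Rintegral_uniform_cvg oOm cK KOm) => //.
  - by move=> m x Ox; exact: ((Cu m).1 [::]).
  - by move=> x; exact: ((Cphi 2).1 [:: i; i]).
have lim_all : (fun m => \int[mu]_(x in K) (c x * phi x) +
     s * \sum_(i < n) \int[mu]_(x in K) (pder [:: i; i] (u_ m) x * phi x)) @ \oo -->
   \int[mu]_(x in K) (c x * phi x) + s * \sum_(i < n) \int[mu]_(x in K) (w i x * phi x).
  apply: cvgD; first exact: cvg_cst.
  apply: cvgM; first exact: cvg_cst.
  exact: cvg_sumr.
have expand (F : 'I_n -> V -> R) : (forall i, mu.-integrable K (EFin \o F i)) ->
    \int[mu]_(x in K) ((c x + s * \sum_(i < n) F i x) * phi x) =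
    \int[mu]_(x in K) (c x * phi x) + s * \sum_(i < n) \int[mu]_(x in K) (F i x * phi x).
  move=> iF; have iFp i := iphi _ (miK _ (iF i)) (iF i).
  have [iS ES] := Rintegral_sumr (index_enum 'I_n) mK iFp.
  rewrite -ES -RintegralZl// -RintegralD//; last first.
    by have := integrableZl mK s iS; apply: eq_integrable.
  by apply: eq_Rintegral => x _; rewrite mulrDl -mulrA mulr_suml.
have gE : \int[mu]_(x in Q) ((c x + s * weak_laplacian Om u0 x) * phi x) =
   \int[mu]_(x in K) (c x * phi x) + s * \sum_(i < n) \int[mu]_(x in K) (w i x * phi x).
  rewrite -expand// (Rintegral_support (@subset_refl _ Q)); last first.
    by move=> x /phi0 ->; rewrite mulr0.
  by rewrite [RHS](Rintegral_support (@subset_refl _ K))// => x /phiK ->; rewrite mulr0.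
have lE m : \int[mu]_(x in K) ((c x + s * laplacian (u_ m) x) * phi x) =
   \int[mu]_(x in K) (c x * phi x) + s * \sum_(i < n) \int[mu]_(x in K)
     (pder [:: i; i] (u_ m) x * phi x).
  rewrite -expand// => i; apply: iK => x Ox; exact: ((Cu m).1 [:: i; i]).
rewrite gE.
apply: (closed_cvg (fun t : R => 0 <= t) (@closed_ge _ 0) _ _ lim_all).
exists N0 => // m /= Nm; rewrite -lE; apply: Rintegral_ge0 => x Kx.
have [Qx|nQ] := pselect (Q x); last by rewrite phi0// mulr0.
by rewrite mulr_ge0 ?nonneg//; have /andP[] := phi01 x.
Qed.

End weak_limits.

(** * The penalized obstacle problem *)

Section penalty_facts.
Context {R : realType}.
Variable beta : R -> R.
Hypothesis pb : penalty beta.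

Lemma penalty_le0 s : beta s <= 0.
Proof.
have [_ b0 bneg _] := pb; have [s0|s0] := leP 0 s; first by rewrite b0.
by apply: ltW; have [] := bneg s s0.
Qed.

Lemma penalty_mono : {homo beta : s t / s <= t}.
Proof.
have [db b0 bneg _] := pb; move=> s t st.
have [t0|t0] := leP 0 t; first by rewrite (b0 t)// penalty_le0.
have Hd (x : R) : is_derive x (1 : R) beta (derive1 beta x).
  by rewrite derive1E; apply: derivableP; exact: (db 0%N).
have [|c] := MVT_segment st (fun x _ => Hd x).
  by apply: derivable_within_continuous => x _; exact: (db 0%N).
rewrite in_itv/= => /andP[_ ct] E; rewrite -subr_ge0 E mulr_ge0 ?subr_ge0//.
by have [_ /andP[/ltW]] := bneg c (le_lt_trans ct t0).
Qed.

(** As beta tends to -oo at -oo, a bound on the penalty confines its argument. *)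
Lemma penalty_lower (K : R) : exists2 a, 0 < a & forall s, - beta s <= K -> - a <= s.
Proof.
have [_ _ _ /cvgrNy_lt/(_ (- K))[M [_ HM]]] := pb.
exists (`|M| + 1); first by rewrite ltr_wpDl.
move=> s sK; rewrite leNgt; apply/negP => sM.
have : s < M by have := ler_norm (- M); rewrite normrN; lra.
by move=> /HM; lra.
Qed.

End penalty_facts.

Section obstacle_core.
Context {R : realType} {n : nat}.
Notation V := 'rV[R]_n.
Notation mu := (@lebesgue_row R n).
Implicit Types (x y : V).

Variables (Om : set V) (beta : R -> R) (f1 f2 psi1 psi2 : V -> R).
Variables (v1 v2 : nat -> V -> R) (eps : nat -> R) (v10 v20 : V -> R).
Hypotheses (oOm : open Om) (pb : penalty beta).
Hypotheses (cf1 : forall x, Om x -> {for x, continuous f1})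
           (cf2 : forall x, Om x -> {for x, continuous f2}).
Hypothesis (Cpsi1 : Ck 2 Om psi1).
Hypothesis psi_ge0 : forall x, Om x -> 0 <= psi1 x + psi2 x.
Hypotheses (Cv1 : forall m, Ck 2 Om (v1 m)) (Cv2 : forall m, Ck 2 Om (v2 m)).
Hypotheses (Cv10 : Ck 1 Om v10) (Cv20 : Ck 1 Om v20).
Hypotheses (eps_gt0 : forall m, 0 < eps m) (eps_cvg0 : eps @ \oo --> (0 : R)).
Hypothesis eq1 : forall m x, Om x ->
  - laplacian (v1 m) x + f1 x + beta ((v1 m x - v2 m x + psi1 x) / eps m) = 0.
Hypothesis eq2 : forall m x, Om x ->
  - laplacian (v2 m) x + f2 x + beta ((v2 m x - v1 m x + psi2 x) / eps m) = 0.
Hypothesis cvg1 : forall d : R, 0 < d ->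
  exists N, forall m y, (N <= m)%N -> Om y -> `|v1 m y - v10 y| <= d.
Hypothesis cvg2 : forall d : R, 0 < d ->
  exists N, forall m y, (N <= m)%N -> Om y -> `|v2 m y - v20 y| <= d.
Hypothesis dcvg1 : forall i (d : R), 0 < d ->
  exists N, forall m y, (N <= m)%N -> Om y -> `|pder [:: i] (v1 m) y - pder [:: i] v10 y| <= d.

Let w m : V -> R := (v1 m \- v2 m) \+ psi1.
Let w0 : V -> R := (v10 \- v20) \+ psi1.
Let h x : R := f1 x - f2 x + laplacian psi1 x.
(** The reaction that the first obstacle adds to the equation of v1. *)
Let reaction m x := - beta (w m x / eps m).

Let Cw m : Ck 2 Om (w m).
Proof. exact: (CkD oOm (CkB oOm (Cv1 m) (Cv2 m)) Cpsi1). Qed.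

Let wc m x : Om x -> {for x, continuous (w m)}.
Proof. by move=> Ox; exact: ((Cw m).1 [::]). Qed.

Let w0c x : Om x -> {for x, continuous w0}.
Proof.
have C : Ck 1 Om w0 := CkD oOm (CkB oOm Cv10 Cv20) (@Ck_le _ _ 1 2 Om psi1 isT Cpsi1).
by move=> Ox; exact: (C.1 [::]).
Qed.

Let hc x : Om x -> {for x, continuous h}.
Proof.
move=> Ox; apply: (@cvgD _ R _ (nbhs x)).
  by apply: (@cvgB _ R _ (nbhs x)); [exact: cf1|exact: cf2].
by apply: cvg_sumr => i; exact: (Cpsi1.1 [:: i; i]).
Qed.

Let lap1 m x : Om x -> laplacian (v1 m) x = f1 x - reaction m x.
Proof.
move=> Ox; have : - laplacian (v1 m) x + f1 x + beta (w m x / eps m) = 0 := eq1 m Ox.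
by rewrite /reaction; move: (beta _) (laplacian _ _) => *; lra.
Qed.

Let reaction_ge0 m x : 0 <= reaction m x.
Proof. by rewrite /reaction oppr_ge0 penalty_le0. Qed.

Let reaction_eq0 m x : 0 <= w m x -> reaction m x = 0.
Proof.
move=> wx; have [_ b0 _ _] := pb; rewrite /reaction b0 ?oppr0//.
by rewrite divr_ge0// ltW.
Qed.

(** Where w is negative, psi1 + psi2 >= 0 makes the argument of the other penalty
    nonnegative, so that the reaction of the second obstacle vanishes. *)
Let difflap_w m y : Om y -> w m y < 0 -> difflap (w m) y (h y + beta (w m y / eps m)).
Proof.
move=> Oy wy.
have -> : h y + beta (w m y / eps m) = laplacian (w m) y.
  have -> : laplacian (w m) y = laplacian (v1 m) y - laplacian (v2 m) y + laplacian psi1 y.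
    rewrite -(laplacianB oOm (Cv1 m) (Cv2 m) Oy).
    exact: (laplacianD oOm (CkB oOm (Cv1 m) (Cv2 m)) Cpsi1 Oy).
  have E1 : - laplacian (v1 m) y + f1 y + beta (w m y / eps m) = 0 := eq1 m Oy.
  have E2 := eq2 m Oy; have [_ b0 _ _] := pb.
  rewrite b0 in E2; last first.
    apply: divr_ge0; last exact: ltW.
    by have := psi_ge0 Oy; move: wy; rewrite /w /=; lra.
  rewrite /h; move: E1 E2; move: (beta _) (laplacian (v1 m) y) (laplacian (v2 m) y).
  by move: (laplacian psi1 y) => *; lra.
exact: (difflap_C2 oOm (Cw m) Oy).
Qed.

Let wcvg (d : R) : 0 < d -> exists N, forall m y, (N <= m)%N -> Om y -> `|w m y - w0 y| <= d.
Proof.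
move=> d0; have d20 : 0 < d / 2 by rewrite divr_gt0.
have [N1 H1] := cvg1 d20; have [N2 H2] := cvg2 d20.
exists (maxn N1 N2) => m y; rewrite geq_max => /andP[Nm1 Nm2] Oy.
have := H1 _ _ Nm1 Oy; have := H2 _ _ Nm2 Oy; rewrite /w /w0 /= !ler_norml.
by move=> /andP[? ?] /andP[? ?]; apply/andP; split; lra.
Qed.

Let reaction_bound m x r eta H : 0 < r -> 0 < eta -> closed_cube x r `<=` Om ->
  (forall y, closed_cube x r y -> - eta <= w m y) ->
  (forall y, closed_cube x r y -> h y <= H) -> w m x < 0 ->
  reaction m x <= H + 4 * n%:R * eta / r ^+ 2.
Proof.
move=> r0 eta0 xO weta hH wx.
apply: (@penalty_bound R n beta h (w m) x r (eps m) eta H _ (eps_gt0 m) r0 eta0 _ weta _ _ wx).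
- exact: penalty_mono.
- by move=> y /xO; exact: wc.
- by move=> y /cube_sub; exact: hH.
- by move=> y /cube_sub /xO; exact: difflap_w.
Qed.

(** The functions w m are locally bounded, uniformly in m, hence so are the reactions at
    points where w is negative. A bounded reaction means that w m x / eps m stays
    bounded below by some - a, so that w m x >= - a eps m, which tends to 0. *)
Lemma obstacle_ge0 x : Om x -> 0 <= w0 x.
Proof.
move=> Ox; rewrite leNgt; apply/negP => wx.
have [r [r0 rO]] := open_closed_cube oOm Ox.
have cK := @compact_closed_cube R n x r.
have [C C0 HC] := compact_norm_bound cK (fun y Ky => w0c (rO y Ky)).
have [H H0 HH] := compact_norm_bound cK (fun y Ky => hc (rO y Ky)).
have [N1 HN1] := wcvg ltr01.
have wx2 : 0 < - w0 x / 2 by rewrite divr_gt0// oppr_gt0.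
have [N2 HN2] := wcvg wx2.
have eta0 : 0 < C + 1 by lra.
have [a a0 Ha] := penalty_lower pb (H + 4 * n%:R * (C + 1) / r ^+ 2).
have ea : 0 < - w0 x / 2 / a by rewrite divr_gt0.
have /cvgrPdist_lt/(_ _ ea)[N3 _ HN3] := eps_cvg0.
pose m := maxn N1 (maxn N2 N3).
have m1 : (N1 <= m)%N by rewrite leq_maxl.
have m2 : (N2 <= m)%N by rewrite /m maxnCA leq_maxl.
have m3 : (N3 <= m)%N by rewrite /m maxnA leq_maxr.
have := HN2 m x m2 Ox; rewrite ler_norml => /andP[w1 w2].
have wm0 : w m x < 0 by lra.
have : reaction m x <= H + 4 * n%:R * (C + 1) / r ^+ 2.
  apply: reaction_bound => // y Ky.
    have := HN1 m y m1 (rO _ Ky); have := HC y Ky; rewrite !ler_norml.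
    by move=> /andP[? ?] /andP[? ?]; lra.
  exact: le_trans (ler_norm _) (HH y Ky).
move=> /Ha; rewrite ler_pdivlMr// => Hw.
have := HN3 m m3; rewrite /= sub0r normrN gtr0_norm// ltr_pdivlMr// mulrC.
lra.
Qed.

(** Since the limit of w is nonnegative, w m >= - eta near x for every eta > 0 once m is
    large; with a small eta the reaction is bounded by a number arbitrarily close to
    the positive part of h x. *)
Lemma penalty_near_contact x (q : R) : Om x -> h x < q -> 0 < q ->
  exists2 r, 0 < r & closed_cube x r `<=` Om /\
    exists N, forall m y, (N <= m)%N -> cube x r y -> reaction m y <= q.
Proof.
move=> Ox hq q0.
(* q2 lies strictly between the positive part of h x and q: it bounds h near x
   and leaves room for the term in eta *)
pose q1 := Num.max (h x) 0; pose q2 := (q1 + q) / 2.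
have q1q : q1 < q by rewrite /q1 gt_max hq.
have q12 : q1 < q2 by rewrite /q2; lra.
have q2q : 0 < q - q2 by rewrite /q2; lra.
have q1h : h x <= q1 by rewrite le_max lexx.
have q10 : 0 <= q1 by rewrite le_max lexx orbT.
have [r r0 [rO rh]] : exists2 r, 0 < r & closed_cube x (2 * r) `<=` Om /\ forall y,
  closed_cube x (2 * r) y -> h y <= q2.
  have H : nbhs (x : V) [set y | h y < q2].
    have hq2 : [set t : R | t < q2] (h x) by rewrite /=; lra.
    exact: (hc Ox (open_nbhs_nbhs (conj (@open_lt _ q2) hq2))).
  have NB : nbhs (x : V) (Om `&` [set y | h y < q2]).
    exact: filterI (open_nbhs_nbhs (conj oOm Ox)) H.
  move/nbhs_ballP: NB => [r /= r0 Hr].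
  have r40 : 0 < r / 4 by rewrite divr_gt0.
  exists (r / 4) => //; rewrite -cubeE in Hr.
  have sub y : closed_cube x (2 * (r / 4)) y -> cube x r y by rewrite /cube /closed_cube/=; lra.
  by split=> y /sub /Hr [] //= _ /ltW.
exists r => //; split; first by move=> y xy; apply: rO; move: xy; rewrite /closed_cube/=; lra.
pose c : R := 4 * n%:R / r ^+ 2.
have c0 : 0 <= c by apply: divr_ge0; [apply: mulr_ge0; exact: ler0n|exact: sqr_ge0].
pose eta := (q - q2) / (c + 1).
have eta0 : 0 < eta by rewrite divr_gt0// ltr_wpDl.
have [N HN] := wcvg eta0.
exists N => m y Nm yx.
have [wy|wy] := leP 0 (w m y); first by rewrite reaction_eq0// ltW.
have sub z : closed_cube y r z -> closed_cube x (2 * r) z.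
  rewrite /closed_cube/= => zy; have -> : z - x = (z - y) + (y - x) by rewrite addrA subrK.
  by apply: le_trans (ler_normD _ _) _; move: yx; rewrite /cube/=; lra.
apply: le_trans (reaction_bound (H := q2) r0 eta0 _ _ _ wy) _.
- by move=> z /sub /rO.
- move=> z /sub /rO Oz; have := HN m z Nm Oz; have := obstacle_ge0 Oz.
  by rewrite ler_norml => ? /andP[? ?]; lra.
- by move=> z /sub /rh.
have -> : 4 * n%:R * eta / r ^+ 2 = c * eta by rewrite /c; ring.
have : (c + 1) * eta = q - q2 by rewrite /eta mulrC divfK// gt_eqF// ltr_wpDl.
lra.
Qed.

Lemma penalty_off_contact x : Om x -> 0 < w0 x ->
  exists2 r, 0 < r & closed_cube x r `<=` Om /\
    exists N, forall m y, (N <= m)%N -> cube x r y -> reaction m y = 0.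
Proof.
move=> Ox wx; have w20 : 0 < w0 x / 2 by rewrite divr_gt0.
have H : nbhs (x : V) [set y | w0 x / 2 < w0 y].
  have hw : [set t : R | w0 x / 2 < t] (w0 x) by rewrite /=; lra.
  exact: (w0c Ox (open_nbhs_nbhs (conj (@open_gt _ (w0 x / 2)) hw))).
have NB : nbhs (x : V) (Om `&` [set y | w0 x / 2 < w0 y]).
  exact: filterI (open_nbhs_nbhs (conj oOm Ox)) H.
move/nbhs_ballP: NB => [r /= r0 Hr].
have r20 : 0 < r / 2 by rewrite divr_gt0.
exists (r / 2) => //; rewrite -cubeE in Hr.
have sub y : closed_cube x (r / 2) y -> cube x r y by rewrite /cube /closed_cube/=; lra.
split; first by move=> y /sub /Hr [].
have [N HN] := wcvg w20; exists N => m y Nm /cube_sub/sub/Hr[Oy /= wy].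
apply: reaction_eq0; have := HN m y Nm Oy; rewrite ler_norml => /andP[? ?]; lra.
Qed.

(** Near such a point the reactions vanish for large m, so the v1 m solve one Poisson
    equation there. *)
Lemma noncontact_equation x : Om x -> 0 < w0 x ->
  exists U : set V, [/\ open U /\ U x, U `<=` Om, Ck 2 U v10 &
    forall y, U y -> laplacian v10 y = f1 y].
Proof.
move=> Ox wx; have [r r0 [rO [N HN]]] := penalty_off_contact Ox wx.
have UO : cube x r `<=` Om by move=> y /cube_sub /rO.
have restrict k f : Ck k Om f -> Ck k (cube x r) f.
  by move=> [c d]; split=> [s y sk /UO|s i y sk /UO]; [exact: c|exact: d].
exists (cube x r).
have [||||C E] := @poisson_C2_limit R n (cube x r) v1 v10 f1 N (@open_cube _ _ x r).
- by move=> m; exact: (restrict _ _ (Cv1 m)).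
- exact: (restrict _ _ Cv10).
- by move=> i d /(dcvg1 i)[M HM]; exists M => m y Mm /UO; exact: HM.
- by move=> m y Nm yx; rewrite lap1 ?HN ?subr0//; exact: UO.
split; [|exact: UO|exact: C|exact: E].
by split; [exact: open_cube|rewrite /cube/= subrr normr0].
Qed.

Hypothesis wd : forall i, weak_der Om [:: i; i] v10 (wder Om [:: i; i] v10).

(** Reversed, the penalty itself is a smooth step from which bumps can be built. *)
Let theta (s : R) : R := - beta (- s).

Let theta_smooth l s : derivable (derive1n l theta) s (1 : R).
Proof.
have [db _ _ _] := pb.
have D k (t : R) : is_derive t (1 : R) (fun t => (-1) ^+ k.+1 * derive1n k beta (- t))
    ((-1) ^+ k.+2 * derive1n k.+1 beta (- t)).
  have Hk : is_derive (- t) (1 : R) (derive1n k beta) (derive1n k.+1 beta (- t)).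
    by rewrite derive1nS derive1E; apply: derivableP; exact: db.
  have := is_deriveZ ((-1) ^+ k.+1) (is_derive1_comp Hk (is_deriveN (is_derive_id t (1 : R)))).
  have -> // : (-1) ^+ k.+2 * derive1n k.+1 beta (- t) =
    (-1) ^+ k.+1 *: (derive1n k.+1 beta (- t) * -1).
  by rewrite -[_ *: _]/(_ * _) exprS; ring.
have E k : derive1n k theta = (fun t => (-1) ^+ k.+1 * derive1n k beta (- t)).
  elim: k => [|k IH]; first by apply/funext => t; rewrite /theta /= expr1 mulN1r.
  by apply/funext => t; rewrite derive1nS IH derive1E (@derive_val _ _ _ _ _ _ _ (D k t)).
by rewrite E; have [] := D l s.
Qed.

Let theta_le0 s : s <= 0 -> theta s = 0.
Proof. by have [_ b0 _ _] := pb; move=> s0; rewrite /theta b0 ?oppr0// oppr_ge0. Qed.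

Let theta_gt0 s : 0 < s -> 0 < theta s.
Proof.
have [_ _ bneg _] := pb; move=> s0; rewrite /theta oppr_gt0.
by have [] := bneg (- s); rewrite ?oppr_lt0.
Qed.

Let weak_local (c : V -> R) (s : R) x (r : R) N : 0 < r -> closed_cube x r `<=` Om ->
  (forall x, Om x -> {for x, continuous c}) ->
  (forall m y, (N <= m)%N -> cube x r y -> 0 <= c y + s * laplacian (v1 m) y) ->
  mu.-negligible (cube x r `&` [set x | c x + s * weak_laplacian Om v10 x < 0]).
Proof.
move=> r0 rO cc H.
apply: (weak_limit_nonneg theta_smooth theta_le0 theta_gt0 oOm r0 rO Cv1 _ cvg1 wd cc H).
by move=> y Oy; exact: (Cv10.1 [::]).
Qed.

(** The reactions are nonnegative. *)
Lemma weak_supersolution :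
  mu.-negligible (Om `&` [set x | - weak_laplacian Om v10 x + f1 x < 0]).
Proof.
apply: negligible_local => x [Ox _]; have [r [r0 rO]] := open_closed_cube oOm Ox.
exists r => //; have H : forall m y, (0 <= m)%N -> cube x r y -> 0 <=
  f1 y + -1 * laplacian (v1 m) y.
  move=> m y _ /cube_sub /rO Oy; rewrite lap1//.
  by move: (reaction_ge0 m y); move: (reaction m y) => *; lra.
apply: negligibleS (weak_local r0 rO cf1 H) => y [[_ fy] xy]; split; first exact: xy.
by move: fy => /=; move: (weak_laplacian _ _ _) => *; lra.
Qed.

(** In both cases the reactions are locally below any q > 0 for large m, because w0 is
    positive or because h <= 0 < q. So the set where f1 minus the weak Laplacian
    exceeds q is null, for each q = 1 / (k + 1). *)
Lemma weak_equation_off_contact :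
  mu.-negligible (Om `&` [set x | (0 < w0 x \/ h x <= 0)
    /\ 0 < - weak_laplacian Om v10 x + f1 x]).
Proof.
pose S k : set V := Om `&` [set x | (0 < w0 x \/ h x <= 0)
  /\ k.+1%:R^-1 < - weak_laplacian Om v10 x + f1 x].
apply: (@negligibleS _ _ _ _ (\bigcup_k S k)).
  move=> x [Ox [gx fx]]; have [k _ Hk] := near_infty_natSinv_lt (PosNum fx).
  by exists k => //; split => //; split => //; exact: (Hk k (leqnn k)).
apply: negligible_bigcup => k; apply: negligible_local => x [Ox [gx _]].
have q0 : 0 < k.+1%:R^-1 :> R by rewrite invr_gt0 ltr0n.
set q : R := k.+1%:R^-1 in q0.
have [r r0 [rO [N HN]]] : exists2 r, 0 < r & closed_cube x r `<=` Om /\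
    exists N, forall m y, (N <= m)%N -> cube x r y -> reaction m y <= q.
  case: gx => [wx|hx]; last by apply: penalty_near_contact => //; exact: le_lt_trans q0.
  have [r r0 [rO [N HN]]] := penalty_off_contact Ox wx.
  by exists r => //; split=> //; exists N => m y Nm xy; rewrite HN// ltW.
exists r => //.
have cc y : Om y -> {for y, continuous (fun y => q - f1 y)}.
  by move=> Oy; apply: (@cvgB _ R _ (nbhs (y : V))); [exact: cvg_cst|exact: cf1].
have H : forall m y, (N <= m)%N -> cube x r y -> 0 <= q - f1 y + 1 * laplacian (v1 m) y.
  move=> m y Nm xy; have Oy : Om y by apply/rO/cube_sub.
  by rewrite lap1//; move: (HN m y Nm xy); move: (reaction m y) => *; lra.
apply: negligibleS (weak_local r0 rO cc H) => y [[_ [_ fy]] xy]; split; first exact: xy.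
by move: fy => /=; rewrite -/q; move: (weak_laplacian _ _ _) => *; lra.
Qed.

End obstacle_core.

(** * Hoelder convergence *)

Section hoelder_convergence.
Context {R : realType} {n : nat}.
Notation V := 'rV[R]_n.
Notation e j := (delta_mx 0 j : V).
Implicit Types (x y : V) (Om : set V).

Lemma sup_norm_ge0 Om (f : V -> R) : Om !=set0 -> (0 <= sup_norm Om f)%E.
Proof.
move=> [x Ox]; apply: (@le_trans _ _ (`|f x|)%:E); first by rewrite lee_fin.
by apply: ereal_sup_ubound; exists x.
Qed.

(** The supremum of an empty set is -oo. A nonempty open set in positive dimension
    contains two distinct points, which excludes this case. *)
Lemma hoelder_seminorm_ge0 (a : R) Om (f : V -> R) : (0 < n)%N -> open Om -> Om !=set0 ->
  (0 <= hoelder_seminorm a Om f)%E.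
Proof.
move=> n0 oOm [x Ox]; have [r [r0 rO]] := open_closed_cube oOm Ox.
pose y : V := x + r *: e (Ordinal n0).
have Oy : Om y.
  apply: rO; rewrite /closed_cube/= /y addrAC subrr add0r.
  by apply: le_trans (norm_delta_row _ _) _; rewrite gtr0_norm.
have xy : x != y.
  apply/eqP => /rowP/(_ (Ordinal n0)); rewrite !mxE !eqxx mulr1; lra.
apply: (@le_trans _ _ (`|f x - f y| / enorm (x - y) `^ a)%:E).
  by rewrite lee_fin divr_ge0// powR_ge0.
by apply: ereal_sup_ubound; exists (x, y).
Qed.

Lemma sup_norm_le_hoelder_norm k (a : R) Om (f : V -> R) (j : 'I_k.+1) (s : j.-tuple 'I_n) :
  (0 < n)%N -> open Om -> Om !=set0 -> (sup_norm Om (pder s f) <= hoelder_norm k a Om f)%E.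
Proof.
move=> n0 oOm O0; rewrite /hoelder_norm (bigD1 j)//= (bigD1 s)//= -!addeA.
apply: leeDl; apply: adde_ge0; first by apply: sume_ge0 => t _; exact: sup_norm_ge0.
apply: adde_ge0.
  by apply: sume_ge0 => l _; apply: sume_ge0 => t _; exact: sup_norm_ge0.
by apply: sume_ge0 => t _; exact: hoelder_seminorm_ge0.
Qed.

Lemma hoelder_cvg_uniform k (a : R) Om (u_ : nat -> V -> R) (u : V -> R) (s : seq 'I_n) (d : R) :
  (0 < n)%N -> open Om -> Om !=set0 -> hoelder_cvg k a Om u_ u -> (size s <= k)%N -> 0 < d ->
  exists N, forall m y, (N <= m)%N -> Om y -> `|pder s (u_ m) y - pder s u y| <= d.
Proof.
move=> n0 oOm O0 [Hu_ [Cu _ _]] + sk d0.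
move=> /fine_cvgP[[N1 _ H1] /cvgrPdist_le/(_ _ d0)[N2 _ H2]].
exists (maxn N1 N2) => m y; rewrite geq_max => /andP[m1 m2] Oy.
have [Cum _ _] := Hu_ m.
rewrite -(pderB oOm Cum Cu sk Oy).
have := H1 m m1; have := H2 m m2; rewrite /= sub0r normrN => le fin.
have sk' : (size s < k.+1)%N by [].
have := @sup_norm_le_hoelder_norm k a Om (u_ m \- u) (Ordinal sk') (in_tuple s) n0 oOm O0.
rewrite -(fineK fin) => Hle; rewrite -lee_fin.
apply: (@le_trans _ _ (sup_norm Om (pder s (u_ m \- u)))).
  by apply: ereal_sup_ubound; exists y.
apply: (le_trans Hle); rewrite lee_fin; exact: le_trans (ler_norm _) le.
Qed.

End hoelder_convergence.

(** * The limit system *)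

Section contact.
Context {R : realType} {n : nat}.
Notation V := 'rV[R]_n.
Notation mu := (@lebesgue_row R n).

(** A nonzero Laplacian requires some nonzero d_i d_i F, so the sets of
    null_nonflat_contact for the finitely many directions i cover this one. *)
Lemma negligible_nonflat_contact (Om : set V) (F : V -> R) : open Om -> Ck 2 Om F ->
  (forall x, Om x -> 0 <= F x) ->
  mu.-negligible (Om `&` [set x | F x = 0 /\ laplacian F x != 0]).
Proof.
move=> oOm CF F0.
pose S k : set V := if insub k is Some i then
  [set x | [/\ Om x, F x = 0 & pder [:: i; i] F x != 0]] else set0.
apply: (@negligibleS _ _ _ _ (\bigcup_k S k)); last first.
  apply: negligible_bigcup => k; rewrite /S; case: insub => [i|]; last exact: negligible_set0.
  exact: null_nonflat_contact oOm CF F0.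
move=> x [Ox [Fx Lx]].
have [i Di] : exists i, pder [:: i; i] F x != 0.
  apply: contrapT => /forallNP H; move/negP: Lx; apply; apply/eqP.
  by apply: big1 => i _; have /negP := H i; rewrite negbK => /eqP.
exists (val i); first exact: I.
by rewrite /S valK; split; [exact: Ox|exact: Fx|exact: Di].
Qed.

End contact.

Theorem proposition1 (R : realType) (n : nat) (Om : set 'rV[R]_n) (alpha : R)
    (beta : R -> R) (f1 f2 psi1 psi2 g1 g2 : 'rV[R]_n -> R)
    (u1 u2 : R -> 'rV[R]_n -> R) (eps : nat -> R) (u10 u20 : 'rV[R]_n -> R)
    (n_gt0 : (0 < n)%N)
    (Om_domain : domain Om) (Om_bounded : bounded_set Om)
    (Om_smooth : smooth_boundary Om)
    (alpha01 : 0 < alpha < 1)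
    (beta_penalty : penalty beta)
    (f1_hoelder : hoelder_space 0 alpha Om f1)
    (f2_hoelder : hoelder_space 0 alpha Om f2)
    (psi1_hoelder : hoelder_space 2 alpha Om psi1)
    (psi2_hoelder : hoelder_space 2 alpha Om psi2)
    (psi_ge0 : forall x, Om x -> 0 <= psi1 x + psi2 x)
    (g1_C2 : Ck_bdry 2 Om g1) (g2_C2 : Ck_bdry 2 Om g2)
    (g1_compat : forall x, bdry Om x -> 0 <= g1 x - g2 x + psi1 x)
    (g2_compat : forall x, bdry Om x -> 0 <= g2 x - g1 x + psi2 x)
    (u_sol : forall e, 0 < e ->
       penalized_solution beta e Om f1 f2 psi1 psi2 g1 g2 (u1 e) (u2 e))
    (eps_gt0 : forall m, 0 < eps m) (eps_cvg0 : eps @ \oo --> 0)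
    (u_weak_cvg : forall p, 1 < p ->
       sobolev_weak_cvg 2 p Om (u1 \o eps) u10 /\
       sobolev_weak_cvg 2 p Om (u2 \o eps) u20)
    (u_strong_cvg : forall gamma, 0 < gamma < 1 ->
       hoelder_cvg 1 gamma Om (u1 \o eps) u10 /\
       hoelder_cvg 1 gamma Om (u2 \o eps) u20) :
  [/\ forall x, Om x ->
        0 <= u10 x - u20 x + psi1 x /\ 0 <= u20 x - u10 x + psi2 x,
      forall x, Om x -> 0 < u10 x - u20 x + psi1 x ->
        exists U : set 'rV[R]_n, [/\ open U /\ U x, U `<=` Om, Ck 2 U u10 &
          forall y, U y -> laplacian u10 y = f1 y],
      forall x, Om x -> 0 < u20 x - u10 x + psi2 x ->
        exists U : set 'rV[R]_n, [/\ open U /\ U x, U `<=` Om, Ck 2 U u20 &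
          forall y, U y -> laplacian u20 y = f2 y],
      {ae @lebesgue_row R n, forall x, Om x ->
        0 <= - weak_laplacian Om u10 x + f1 x /\
        0 <= - weak_laplacian Om u20 x + f2 x} &
      {ae @lebesgue_row R n, forall x, Om x ->
        Num.min (- weak_laplacian Om u10 x + f1 x)
                (- weak_laplacian Om u20 x + f2 x) = 0}].
Proof.
have [oOm _ O0] := Om_domain.
have Cf1 : Ck 0 Om f1 by case: f1_hoelder.
have Cf2 : Ck 0 Om f2 by case: f2_hoelder.
have cf1 := (Ck0P Om f1).1 Cf1; have cf2 := (Ck0P Om f2).1 Cf2.
have Cpsi1 : Ck 2 Om psi1 by case: psi1_hoelder.
have Cpsi2 : Ck 2 Om psi2 by case: psi2_hoelder.
have psi_ge0' x : Om x -> 0 <= psi2 x + psi1 x by rewrite addrC; exact: psi_ge0.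
have Cv1 m : Ck 2 Om ((u1 \o eps) m) by have [[C _] _ _ _ _] := u_sol _ (eps_gt0 m); exact: C.
have Cv2 m : Ck 2 Om ((u2 \o eps) m) by have [[_ C] _ _ _ _] := u_sol _ (eps_gt0 m); exact: C.
have eq1 m x : Om x -> - laplacian ((u1 \o eps) m) x + f1 x +
    beta (((u1 \o eps) m x - (u2 \o eps) m x + psi1 x) / eps m) = 0.
  by have [_ _ E _ _] := u_sol _ (eps_gt0 m); exact: E.
have eq2 m x : Om x -> - laplacian ((u2 \o eps) m) x + f2 x +
    beta (((u2 \o eps) m x - (u1 \o eps) m x + psi2 x) / eps m) = 0.
  by have [_ _ _ E _] := u_sol _ (eps_gt0 m); exact: E.
have half0 : (0 : R) < 2^-1 by rewrite invr_gt0 ltr0n.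
have half1 : 2^-1 < (1 : R) by rewrite invf_lt1 ?ltr1n ?ltr0n.
have [H1 H2] := u_strong_cvg 2^-1 (introT andP (conj half0 half1)).
have C10 : Ck 1 Om u10 by case: H1 => _ [].
have C20 : Ck 1 Om u20 by case: H2 => _ [].
have cvg1 d (d0 : 0 < d) := hoelder_cvg_uniform n_gt0 oOm O0 H1 (s := [::]) isT d0.
have cvg2 d (d0 : 0 < d) := hoelder_cvg_uniform n_gt0 oOm O0 H2 (s := [::]) isT d0.
have dcvg1 i d (d0 : 0 < d) := hoelder_cvg_uniform n_gt0 oOm O0 H1 (s := [:: i]) isT d0.
have dcvg2 i d (d0 : 0 < d) := hoelder_cvg_uniform n_gt0 oOm O0 H2 (s := [:: i]) isT d0.
have lt12 : (1 : R) < 2 by rewrite ltr1n.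
have [[_ sob1 _] [_ sob2 _]] := u_weak_cvg _ lt12.
have wd1 i : weak_der Om [:: i; i] u10 (wder Om [:: i; i] u10).
  by apply: xgetPex; have [w [ww _]] := sob1 [:: i; i] isT; exists w.
have wd2 i : weak_der Om [:: i; i] u20 (wder Om [:: i; i] u20).
  by apply: xgetPex; have [w [ww _]] := sob2 [:: i; i] isT; exists w.
have ge1 := obstacle_ge0 oOm beta_penalty cf1 cf2 Cpsi1 psi_ge0 Cv1 Cv2 C10 C20
  eps_gt0 eps_cvg0 eq1 eq2 cvg1 cvg2.
have ge2 := obstacle_ge0 oOm beta_penalty cf2 cf1 Cpsi2 psi_ge0' Cv2 Cv1 C20 C10
  eps_gt0 eps_cvg0 eq2 eq1 cvg2 cvg1.
have N1 := weak_supersolution oOm beta_penalty cf1 Cv1 C10 eq1 cvg1 wd1.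
have N2 := weak_supersolution oOm beta_penalty cf2 Cv2 C20 eq2 cvg2 wd2.
have N3 := weak_equation_off_contact oOm beta_penalty cf1 cf2 Cpsi1 psi_ge0 Cv1 Cv2 C10 C20
  eps_gt0 eps_cvg0 eq1 eq2 cvg1 cvg2 wd1.
have N4 := weak_equation_off_contact oOm beta_penalty cf2 cf1 Cpsi2 psi_ge0' Cv2 Cv1 C20 C10
  eps_gt0 eps_cvg0 eq2 eq1 cvg2 cvg1 wd2.
(* the exceptional set of the last claim: double contact where the Laplacian
   of psi1 + psi2 does not vanish *)
have N5 := negligible_nonflat_contact oOm (CkD oOm Cpsi1 Cpsi2) psi_ge0.
split.
- by move=> x Ox; split; [exact: ge1|exact: ge2].
- exact: (noncontact_equation oOm beta_penalty Cpsi1 Cv1 C10 C20 eps_gt0 eq1 cvg1 cvg2 dcvg1).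
- exact: (noncontact_equation oOm beta_penalty Cpsi2 Cv2 C20 C10 eps_gt0 eq2 cvg2 cvg1 dcvg2).
- apply: negligibleS (negligibleU N1 N2) => x /= /not_implyP[Ox].
  rewrite !leNgt => /not_andP[]/negP; rewrite negbK => ax; [left|right]; split => //.
- apply: negligibleS (negligibleU (negligibleU N1 N2) (negligibleU (negligibleU N3 N4) N5)) =>
  x /=.
  move=> /not_implyP[Ox]; apply: contra_notP => nN.
  have a0 : 0 <= - weak_laplacian Om u10 x + f1 x.
    by rewrite leNgt; apply/negP => ax; apply: nN; left; left; split; [exact: Ox|exact: ax].
  have b0 : 0 <= - weak_laplacian Om u20 x + f2 x.
    by rewrite leNgt; apply/negP => bx; apply: nN; left; right; split; [exact: Ox|exact: bx].
  have w1 := ge1 x Ox; have w2 := ge2 x Ox.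
  have good1 : 0 < (u10 \- u20 \+ psi1) x \/ f1 x - f2 x + laplacian psi1 x <= 0 ->
      - weak_laplacian Om u10 x + f1 x = 0.
    move=> G; apply/eqP; rewrite eq_le a0 andbT leNgt; apply/negP => ax; apply: nN.
    by right; left; left; split; [exact: Ox|split; [exact: G|exact: ax]].
  have good2 : 0 < (u20 \- u10 \+ psi2) x \/ f2 x - f1 x + laplacian psi2 x <= 0 ->
      - weak_laplacian Om u20 x + f2 x = 0.
    move=> G; apply/eqP; rewrite eq_le b0 andbT leNgt; apply/negP => bx; apply: nN.
    by right; left; right; split; [exact: Ox|split; [exact: G|exact: bx]].
  have [G1|nG1] := pselect (0 < (u10 \- u20 \+ psi1) x \/ f1 x - f2 x + laplacian psi1 x <= 0).
    by rewrite (good1 G1); apply/min_idPl.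
  have [G2|nG2] := pselect (0 < (u20 \- u10 \+ psi2) x \/ f2 x - f1 x + laplacian psi2 x <= 0).
    by rewrite (good2 G2); apply/min_idPr.
  (* both obstacles are in contact with h, k > 0: then psi1 + psi2 vanishes at x
     and its Laplacian h + k does not *)
  exfalso; apply: nN; right; right; split; first exact: Ox.
  have h1 : u10 x - u20 x + psi1 x <= 0.
    by rewrite leNgt; apply/negP => H; apply: nG1; left; exact: H.
  have l1 : 0 < f1 x - f2 x + laplacian psi1 x.
    by rewrite ltNge; apply/negP => H; apply: nG1; right; exact: H.
  have h2 : u20 x - u10 x + psi2 x <= 0.
    by rewrite leNgt; apply/negP => H; apply: nG2; left; exact: H.
  have l2 : 0 < f2 x - f1 x + laplacian psi2 x.
    by rewrite ltNge; apply/negP => H; apply: nG2; right; exact: H.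
  split.
    have e1 : 0 <= u10 x - u20 x + psi1 x := w1.
    have e2 : 0 <= u20 x - u10 x + psi2 x := w2.
    have F0 : psi1 x + psi2 x = 0 by clear - e1 e2 h1 h2; lra.
    exact: F0.
  rewrite (laplacianD oOm Cpsi1 Cpsi2 Ox); apply: lt0r_neq0.
  clear - l1 l2; move: l1 l2.
  by move: (laplacian psi1 x) (laplacian psi2 x) => *; lra.
Qed.
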